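(* Let $u\in\mathbb V$ be the weak solution of the model problem, let $\mathcal Q\succeq\mathcal Q_0$ be an admissible mesh of class $m$ on $\Omega$ and let $U\in\mathbb S_D(\mathcal Q)$ be the Galerkin approximation on $\mathcal Q$. Then there is a constant $C_{\mathrm{lb}}$, which does not depend on $Q$, such that for every $Q\in\mathcal Q$ $$\varepsilon_{\mathcal Q}(U,Q)\le C_{\mathrm{lb}}\big(\|u-U\|_{\mathbb V(Q)}+\operatorname{osc}_{\mathcal Q}(U,Q)\big).$$
   Context: HIERARCHICAL SPLINES. Let $V^0\subset V^1\subset V^2\subset\cdots$ be nested tensor-product $d$-variate spline spaces on a closed hyper-rectangle $D\subset\mathbb R^d$; $V^\ell$ is spanned by the tensor-product B-spline basis $\hat{\mathcal B}^\ell$ of degree $\mathbf p=(p_1,\ldots,p_d)$ on a tensor-product grid $\hat G^\ell$ of open cells, $\hat G^{\ell+1}$ being the dyadic refinement of $\hat G^\ell$ (each cell is split into $2^d$ children). A domain hierarchy of depth $N$ consists of closed sets $\hat\Omega^0\supseteq\cdots\supseteq\hat\Omega^{N-1}$ in $D$, $\hat\Omega^N=\emptyset$, with $\hat\Omega^\ell$ ($\ell\ge1$) a union of closures of cells of $\hat G^{\ell-1}$. Active elements: $\hat{\mathcal G}^\ell=\{\hat Q\in\hat G^\ell:\hat Q\subset\hat\Omega^\ell$ and no $\hat Q^*\in\hat G^{\ell^*}$, $\ell^*>\ell$, satisfies $\hat Q^*\subset\hat\Omega^{\ell^*}$ and $\hat Q^*\subset\hat Q\}$. Mesh: $\hat{\mathcal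 Q}=\bigcup_\ell\hat{\mathcal G}^\ell$. $\hat{\mathcal Q}^*\succeq\hat{\mathcal Q}$ (refinement) means that each element of $\hat{\mathcal Q}^*$ either belongs to $\hat{\mathcal Q}$ or is obtained from an element of $\hat{\mathcal Q}$ by (possibly repeated) dyadic splitting. HB-splines: $\hat{\mathcal H}(\hat{\mathcal Q})=\{\hat\beta\in\hat{\mathcal B}^\ell:\operatorname{supp}\hat\beta\subseteq\hat\Omega^\ell,\ \operatorname{supp}\hat\beta\not\subseteq\hat\Omega^{\ell+1},\ \ell=0,\ldots,N-1\}$, supports being intersected with $\hat\Omega^0$. For $\hat s\in V^\ell$, $\hat s=\sum_{\hat\beta\in\hat{\mathcal B}^{\ell+1}}c_{\hat\beta}\hat\beta$, let $\operatorname{trunc}^{\ell+1}\hat s=\sum_{\hat\beta\in\hat{\mathcal B}^{\ell+1},\,\operatorname{supp}\hat\beta\not\subseteq\hat\Omega^{\ell+1}}c_{\hat\beta}\hat\beta$. The THB-spline basis $\hat{\mathcal T}(\hat{\mathcal Q})$ consists of $\operatorname{trunc}^{N-1}(\cdots(\operatorname{trunc}^{\ell+1}\hat\beta)\cdots)$ for $\hat\beta\in\hat{\mathcal B}^\ell\cap\hat{\mathcal H}(\hat{\mathcal Q})$, $\ell=0,\ldots,N-1$; such a function has level $\ell$. $\hat{\mathcal Q}$ is admissible of class $m$ if, for every $\hat Q\in\hat{\mathcal Q}$, the functions of $\hat{\mathcal T}(\hat{\mathcal Q})$ that are non-zero on $\hat Q$ belong to at most $m$ successive levels. With $S(\hat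 Q,k)=\{\hat Q'\in\hat G^k:\exists\hat\beta\in\hat{\mathcal B}^k,\ \operatorname{supp}\hat\beta\cap\hat Q'\ne\emptyset,\ \operatorname{supp}\hat\beta\cap\hat Q\ne\emptyset\}$ (also the region covered by its closed elements) and $\hat\omega^\ell=\bigcup\{\overline{\hat Q}:\hat Q\in\hat G^\ell,\ S(\hat Q,\ell)\subseteq\hat\Omega^\ell\}$, the mesh is strictly admissible of class $m$ ($m\ge2$) if $\hat\Omega^\ell\subseteq\hat\omega^{\ell-m+1}$ for $\ell=m,\ldots,N-1$. PHYSICAL DOMAIN. $\Omega\subset\mathbb R^d$, $d\ge1$, is a bounded Lipschitz domain, $\overline\Omega=\mathbf F(\hat\Omega^0)$, where $\mathbf F=\sum_{\hat\tau\in\hat{\mathcal T}_0}\mathbf C_{\hat\tau}\hat\tau$, $\mathbf C_{\hat\tau}\in\mathbb R^d$, $\hat{\mathcal T}_0$ is the truncated basis of a strictly admissible mesh $\hat{\mathcal Q}_0$, and $\mathbf F$ is a bi-Lipschitz homeomorphism with $\|D^\alpha\mathbf F\|_{L^\infty(\hat\Omega^0)}\le C_{\mathbf F}$, $\|D^\alpha\mathbf F^{-1}\|_{L^\infty(\Omega)}\le c_{\mathbf F}^{-1}$, $|\alpha|\le1$. For $\hat{\mathcal Q}\succeq\hat{\mathcal Q}_0$: $\mathcal Q=\{\mathbf F(\hat Q):\hat Q\in\hat{\mathcal Q}\}$, $\mathcal T=\{\hat\tau\circ\mathbf F^{-1}:\hat\tau\in\hat{\mathcal T}(\hat{\mathcal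 Q})\}$, $\mathbb S(\mathcal Q)=\operatorname{span}\mathcal T$, $\mathbb S_D(\mathcal Q)=\{V\in\mathbb S(\mathcal Q):V|_{\partial\Omega}=0\}$; it is assumed that $\mathbb S_D(\mathcal Q)\subset C^1(\Omega)$. $h_Q=|Q|^{1/d}$. $\mathcal Q$ is called (strictly) admissible, and $\mathcal Q^*\succeq\mathcal Q$, if the same holds for the preimages under $\mathbf F$. MODEL PROBLEM. $-\operatorname{div}(\mathbf A\nabla u)=f$ in $\Omega$, $u|_{\partial\Omega}=0$, with $f\in L^2(\Omega)$, $\mathbf A\in C^\infty(\overline\Omega)$ matrix-valued, and $\eta_1|\boldsymbol\xi|^2\le\mathbf A(\mathbf x)\boldsymbol\xi\cdot\boldsymbol\xi$, $|\mathbf A(\mathbf x)\boldsymbol\xi|\le\eta_2|\boldsymbol\xi|$ for all $\mathbf x\in\Omega,\boldsymbol\xi\in\mathbb R^d$, where $0<\eta_1\le\eta_2$. $\mathbb V=H^1_0(\Omega)$ with $\|v\|_{\mathbb V}^2=\|\nabla v\|_{L^2(\Omega)}^2+\|v\|^2_{L^2(\Omega)}$, and $\|v\|_{\mathbb V(Q)}$ is the same norm with integrals over $Q$. $a(u,v)=\int_\Omega\mathbf A\nabla u\cdot\nabla v$. The weak solution $u\in\mathbb V$ satisfies $a(u,v)=\langle f,v\rangle$ for all $v\in\mathbb V$ ($\langle\cdot,\cdot\rangle$ is the $L^2(\Omega)$ product). The Galerkin approximation $U\in\mathbb S_D(\mathcal Q)$ satisfies $a(U,V)=\langle f,V\rangle$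 for all $V\in\mathbb S_D(\mathcal Q)$. ERROR INDICATOR AND OSCILLATION. $r=f+\operatorname{div}(\mathbf A\nabla U)\in L^2(\Omega)$ (computed elementwise), $\varepsilon_{\mathcal Q}(U,Q)=h_Q\|r\|_{L^2(Q)}$, $\operatorname{osc}_{\mathcal Q}(U,Q)=h_Q\|r-\Pi_{\mathbf n}r\|_{L^2(Q)}$, where, for fixed degrees $\mathbf n=(n_1,\ldots,n_d)$, $\Pi_{\mathbf n}:L^2(Q)\to\mathbb Q_{\mathbf n}$ is the $L^2(Q)$-projector onto the space of polynomials of degree $n_j$ in the $j$-th space direction. *)

(* Defs.v *)
From HB Require Import structures.
From mathcomp Require Import all_boot all_order all_algebra.
From mathcomp Require Import all_classical all_reals all_analysis.
Set Implicit Arguments.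
Unset Strict Implicit.
Unset Printing Implicit Defensive.
Import Order.TTheory GRing.Theory Num.Theory.
Import numFieldNormedType.Exports.
Local Open Scope classical_set_scope.
Local Open Scope ring_scope.

(* 'rV[R]_d carries the product (= Borel) sigma-algebra. *)
Definition measure_rV_display : measure_display.
Proof. exact: default_measure_display. Qed.

Section measurable_rV.
Context {R : realType} {d : nat}.

Let coord (i : 'I_d) (v : 'rV[R]_d) : measurableTypeR R := v ord0 i.

Let rV_set0 : g_sigma_preimage coord set0.
Proof. exact: sigma_algebra0. Qed.

Let rV_setC A : g_sigma_preimage coord A -> g_sigma_preimage coord (~` A).
Proof. exact: sigma_algebraC. Qed.

Let rV_bigcup (F : _^nat) : (forall i, g_sigma_preimage coord (F i)) ->
  g_sigma_preimage coord (\bigcup_i (F i)).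
Proof. exact: sigma_algebra_bigcup. Qed.

HB.instance Definition _ :=
  @isMeasurable.Build measure_rV_display
    'rV[R]_d (g_sigma_preimage coord) rV_set0 rV_setC rV_bigcup.

End measurable_rV.

Section lebesgue_rV.
Context {R : realType}.

Lemma measurable_coord d (i : 'I_d) :
  measurable_fun setT (fun v : 'rV[R]_d => v ord0 i : measurableTypeR R).
Proof.
move=> _ Y mY; rewrite setTI; apply: sub_sigma_algebra => /=.
rewrite -bigcup_seq/=; exists i => /=; first by rewrite mem_index_enum.
by exists Y => //; rewrite setTI.
Qed.

Lemma measurable_fun_coordP disp (T : measurableType disp) d
    (f : T -> 'rV[R]_d) :
  (forall i, measurable_fun setT (fun t => f t ord0 i : measurableTypeR R)) ->
  measurable_fun setT f.
Proof.
move=> mf _ A mA; rewrite setTI.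
suff: measurable `<=` [set B | measurable (f @^-1` B)] by exact.
apply: smallest_sub.
  split=> /=.
  - by rewrite preimage_set0.
  - by move=> B mB; rewrite setTD preimage_setC; exact: measurableC.
  - by move=> B mB; rewrite preimage_bigcup; exact: bigcupT_measurable.
rewrite -bigcup_seq => _ [i _ [B mB <-]] /=.
by have := mf i measurableT B mB; rewrite !setTI.
Qed.

Definition rV_cons d (p : measurableTypeR R * 'rV[R]_d) : 'rV[R]_(1 + d) :=
  row_mx (p.1 : R)%:M p.2.

Definition rV_split d (v : 'rV[R]_(1 + d)) : measurableTypeR R * 'rV[R]_d :=
  (v ord0 (lshift d ord0), rsubmx v).

Lemma rV_splitK d : cancel (@rV_split d) (@rV_cons d).
Proof.
move=> v; rewrite /rV_cons /rV_split /= -[RHS]hsubmxK; congr row_mx.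
by apply/rowP => i; rewrite !mxE !ord1 eqxx mulr1n.
Qed.

Lemma measurable_rV_cons d : measurable_fun setT (@rV_cons d).
Proof.
apply: measurable_fun_coordP => i; case: (split_ordP i) => j ->.
  rewrite (_ : (fun t => _) = fst) //.
  by apply/funext => t; rewrite row_mxEl !mxE !ord1 eqxx mulr1n.
rewrite (_ : (fun t => _) =
  (fun v : 'rV[R]_d => v ord0 j : measurableTypeR R) \o snd); last first.
  by apply/funext => t; rewrite row_mxEr.
exact: measurableT_comp (measurable_coord j) measurable_snd.
Qed.

Lemma measurable_rV_split d : measurable_fun setT (@rV_split d).
Proof.
apply/measurable_fun_pairP; split => /=.
  exact: (measurable_coord (lshift d ord0)).
apply: measurable_fun_coordP => i.
rewrite (_ : (fun t => _) =
  (fun v : 'rV[R]_(1 + d) => v ord0 (rshift 1 i) : measurableTypeR R)) //.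
  exact: measurable_coord.
by apply/funext => t /=; rewrite mxE.
Qed.

Lemma rV_consK d : cancel (@rV_cons d) (@rV_split d).
Proof.
move=> [x v]; rewrite /rV_split /rV_cons /=; congr pair.
  by rewrite row_mxEl mxE eqxx mulr1n.
by rewrite row_mxKr.
Qed.

Section lebesgue_cons.
Context {d : nat}.
Variable mu : {sigma_finite_measure set 'rV[R]_d -> \bar R}.

Definition lebesgue_cons : set 'rV[R]_(1 + d) -> \bar R :=
  pushforward (@lebesgue_measure R \x mu)%E (@rV_cons d).

HB.instance Definition _ := Measure.copy lebesgue_cons
  (measure_function_pushforward__canonical__measure_function_Measure
    (@lebesgue_measure R \x mu)%E (@measurable_rV_cons d)).

Let lebesgue_cons_sigma_finite : sigma_finite setT lebesgue_cons.
Proof.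
have /sigma_finiteP[F [TF ndF Foo]] := sigma_finiteT (@lebesgue_measure R).
have /sigma_finiteP[G [TG ndG Goo]] := sigma_finiteT mu.
exists (fun k => @rV_split d @^-1` (F k `*` G k)).
  apply/esym; rewrite -subTset => v _.
  have [k1 _ Fk] : (\bigcup_i F i) (rV_split v).1 by rewrite -TF.
  have [k2 _ Gk] : (\bigcup_i G i) (rV_split v).2 by rewrite -TG.
  exists (maxn k1 k2) => //; split.
  - by move: Fk; exact/subsetPset/ndF/leq_maxl.
  - by move: Gk; exact/subsetPset/ndG/leq_maxr.
move=> k; have [mF Fk] := Foo k; have [mG Gk] := Goo k; split.
  rewrite -[X in measurable X]setTI.
  exact: measurable_rV_split (measurableX mF mG).
rewrite /lebesgue_cons /pushforward -comp_preimage.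
rewrite (_ : _ \o _ = idfun); last by apply/funext; exact: rV_consK.
by rewrite preimage_id product_measure1E// lte_mul_pinfty// ge0_fin_numE.
Qed.

HB.instance Definition _ :=
  Measure_isSigmaFinite.Build _ _ _ lebesgue_cons lebesgue_cons_sigma_finite.

End lebesgue_cons.

(* The product of d copies of the one-dimensional Lebesgue measure, transported
   along R * 'rV_d ~ 'rV_(1 + d). *)
Fixpoint lebesgue_rV (d : nat) : {sigma_finite_measure set 'rV[R]_d -> \bar R} :=
  match d with
  | 0 => \d_(0 : 'rV[R]_0)
  | d'.+1 => [the {sigma_finite_measure set 'rV[R]_(1 + d') -> \bar R} of
                lebesgue_cons (lebesgue_rV d')]
  end.

End lebesgue_rV.

Arguments lebesgue_rV : clear implicits.

Section sobolev.
Context {R : realType} {d : nat}.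
Local Notation E := 'rV[R]_d.
Local Notation mu := (lebesgue_rV R d).
Implicit Types (A Q : set E) (f v phi : E -> R) (g : E -> E).

Definition dot (x y : E) : R := \sum_j x ord0 j * y ord0 j.

Definition enorm (x : E) : R := Num.sqrt (dot x x).

Definition bdry A : set E := closure A `\` interior A.

Definition partial (j : 'I_d) f : E -> R := 'D_(delta_mx ord0 j : E) f.

Definition grad f (x : E) : E := \row_j partial j f x.

Definition iter_partial (s : seq 'I_d) f : E -> R := foldr partial f s.

Definition C1_on A f := forall x, A x ->
  {for x, continuous f} /\
  forall j, derivable f x (delta_mx ord0 j : E) /\
            {for x, continuous (partial j f)}.

Definition smooth_on A f := forall s x, A x ->
  {for x, continuous (iter_partial s f)} /\
  forall j, derivable (iter_partial s f) x (delta_mx ord0 j : E).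

(* C^oo of the closure of the open set A: all partial derivatives on A extend
   continuously to the closure. *)
Definition smooth_up_to_bdry A f := smooth_on A f /\
  forall s, exists2 f' : E -> R,
    {within closure A, continuous f'} &
    forall x, A x -> iter_partial s f x = f' x.

Definition test_function A phi :=
  [/\ smooth_on setT phi, compact (closure [set x | phi x != 0]) &
      closure [set x | phi x != 0] `<=` A].

Definition L2 A f := measurable_fun A f /\
  (\int[mu]_(x in A) (f x ^+ 2)%:E < +oo)%E.

Definition L2norm A f : R := Num.sqrt (\int[mu]_(x in A) (f x ^+ 2)).

Definition weak_gradient A v g :=
  (forall j, L2 A (fun x => g x ord0 j)) /\
  forall phi j, test_function A phi ->
    \int[mu]_(x in A) (v x * partial j phi x) =
    - \int[mu]_(x in A) (g x ord0 j * phi x).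

Definition H1 A v := L2 A v /\ exists g, weak_gradient A v g.

(* A representative of the (a.e. unique) weak gradient on A; the default value
   is only used outside H1 A. *)
Definition wgrad A v : E -> E := xget (fun=> 0) [set g | weak_gradient A v g].

(* The H^1 norm over Q of a function v of H1 A, Q a subset of A. *)
Definition H1norm A Q v : R :=
  Num.sqrt (\int[mu]_(x in Q) dot (wgrad A v x) (wgrad A v x) +
            \int[mu]_(x in Q) (v x ^+ 2)).

Definition H10 A v := H1 A v /\
  exists phi : nat -> E -> R, (forall k, test_function A (phi k)) /\
    (fun k => H1norm A A (v - phi k)) @ \oo --> (0 : R).

(* Near each boundary point and in suitable orthonormal coordinates y *m P, A
   is the region above the graph of a Lipschitz function of the coordinates
   other than the j-th. *)
Definition bounded_lipschitz_domain A :=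
  [/\ A !=set0, open A, connected A, bounded_set A &
      forall x, bdry A x ->
        exists (P : 'M[R]_d) (j : 'I_d) (gamma : 'rV[R]_d.-1 -> R) (k : R),
          [/\ P *m P^T = 1%:M, k.-lipschitz gamma &
              \forall y \near x,
                A y <-> gamma (col' j (y *m P)) < (y *m P) ord0 j]].

End sobolev.

Section splines.
Context {R : realType}.

(* Cox-de Boor recursion (with a / 0 = 0) for the B-spline of degree p with
   knots t_i, ..., t_(i+p+1). In degree 0 the half-open knot intervals are used,
   except that the last nonempty one is closed on the right. *)
Fixpoint bspline1 (t : seq R) (p i : nat) (x : R) : R :=
  if p is q.+1 then
    (x - t`_i) / (t`_(i + q.+1) - t`_i) * bspline1 t q i x +
    (t`_(i + q.+2) - x) / (t`_(i + q.+2) - t`_i.+1) * bspline1 t q i.+1 x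
  else ((t`_i <= x < t`_i.+1) ||
        [&& t`_i < t`_i.+1, x == t`_i.+1 & x == last 0 t])%:R.

Record spline_data (d : nat) := SplineData {
  degree : 'I_d -> nat;
  lower : 'I_d -> R;
  upper : 'I_d -> R;
  knots : nat -> 'I_d -> seq R }.

Context {d : nat}.
Local Notation E := 'rV[R]_d.
Variable S : spline_data d.

Definition patch : set E :=
  [set x | forall j, lower S j <= x ord0 j <= upper S j].

Definition breaks (l : nat) (j : 'I_d) : seq R := undup (knots S l j).

Definition cell (l : nat) (i : 'I_d -> nat) : set E :=
  [set x | forall j, (breaks l j)`_(i j) < x ord0 j < (breaks l j)`_(i j).+1].

Definition grid (l : nat) : set (set E) :=
  [set Q | exists2 i : 'I_d -> nat,
     forall j, ((i j).+1 < size (breaks l j))%N & Q = cell l i].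

Definition indices (l : nat) : set {ffun 'I_d -> nat} :=
  [set i | forall j, (i j < size (knots S l j) - (degree S j).+1)%N].

(* All B-splines vanish outside [patch], so that identities between splines as
   functions on 'rV[R]_d are identities on [patch]. *)
Definition bspline (l : nat) (i : {ffun 'I_d -> nat}) (x : E) : R :=
  \prod_j bspline1 (knots S l j) (degree S j) (i j) (x ord0 j).

Definition bspline_comb (l : nat) (c : {ffun 'I_d -> nat} -> R) (x : E) : R :=
  \sum_(i \in indices l) c i * bspline l i x.

Definition spline_space (l : nat) : set (E -> R) := range (bspline_comb l).

(* Open knot vectors; breakpoints of successive levels are related by dyadic
   refinement, while the multiplicities are only constrained by nestedness. *)
Definition nested_splines :=
  [/\ forall j, lower S j < upper S j,
      forall l j,
        [/\ sorted <=%R (knots S l j),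
            all (fun x => lower S j <= x <= upper S j) (knots S l j),
            count_mem (lower S j) (knots S l j) = (degree S j).+1,
            count_mem (upper S j) (knots S l j) = (degree S j).+1 &
            forall x, (count_mem x (knots S l j) <= (degree S j).+1)%N],
      forall l j x, x \in knots S l.+1 j <->
        x \in knots S l j \/
        exists2 k, (k.+1 < size (breaks l j))%N &
          x = ((breaks l j)`_k + (breaks l j)`_k.+1) / 2 &
      forall l, spline_space l `<=` spline_space l.+1].

(* [dom H l] is meant to be empty for l >= depth H. *)
Record hierarchy := Hierarchy { depth : nat; dom : nat -> set E }.

Implicit Type H : hierarchy.

Definition domain_hierarchy H :=
  [/\ (0 < depth H)%N, dom H 0 `<=` patch,
      forall l, closed (dom H l) /\ dom H l.+1 `<=` dom H l,
      forall l, (depth H <= l)%N -> dom H l = set0 &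
      forall l, (l.+1 < depth H)%N ->
        exists2 K : set (set E), K `<=` grid l &
          dom H l.+1 = \bigcup_(Q in K) closure Q].

Definition active H (l : nat) : set (set E) :=
  [set Q | [/\ grid l Q, Q `<=` dom H l &
     ~ exists l' Q', [/\ (l < l')%N, grid l' Q', Q' `<=` dom H l' & Q' `<=` Q]]].

Definition mesh H : set (set E) :=
  [set Q | exists2 l, (l < depth H)%N & active H l Q].

Inductive dyadic_descendant (Q : set E) : set E -> Prop :=
| dyadic_refl : dyadic_descendant Q Q
| dyadic_split l Q1 Q2 : dyadic_descendant Q Q1 ->
    grid l Q1 -> grid l.+1 Q2 -> Q2 `<=` Q1 -> dyadic_descendant Q Q2.

Definition refines H' H := dom H' 0 = dom H 0 /\
  forall Q', mesh H' Q' -> exists2 Q, mesh H Q & dyadic_descendant Q Q'.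

(* Supports are always intersected with the level 0 domain. *)
Definition supp H (l : nat) (i : {ffun 'I_d -> nat}) : set E :=
  closure [set x | bspline l i x != 0] `&` dom H 0.

Definition hb_index H (l : nat) : set {ffun 'I_d -> nat} :=
  [set i | [/\ indices l i, supp H l i `<=` dom H l &
               ~ supp H l i `<=` dom H l.+1]].

(* The coefficients are unique on [indices l] since B-splines are linearly
   independent. *)
Definition coefs (l : nat) (s : E -> R) : {ffun 'I_d -> nat} -> R :=
  xget (fun=> 0) [set c | s = bspline_comb l c].

Definition trunc H (l : nat) (s : E -> R) (x : E) : R :=
  \sum_(i \in [set i | indices l i /\ ~ supp H l i `<=` dom H l])
    coefs l s i * bspline l i x.

Definition thb H (l : nat) (i : {ffun 'I_d -> nat}) : E -> R :=
  foldl (fun s k => trunc H k s) (bspline l i) (iota l.+1 (depth H - l.+1)).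

Definition thb_level H (l : nat) : set (E -> R) := thb H l @` hb_index H l.

Definition thb_basis H : set (E -> R) :=
  [set tau | exists2 l, (l < depth H)%N & thb_level H l tau].

Definition admissible H (m : nat) := forall Q, mesh H Q -> exists k,
  forall l tau, (l < depth H)%N -> thb_level H l tau ->
    (exists2 x, Q x & tau x != 0) -> (k <= l < k + m)%N.

Definition supp_ext H (Q : set E) (k : nat) : set (set E) :=
  [set Q' | grid k Q' /\ exists i, [/\ indices k i,
     supp H k i `&` Q' !=set0 & supp H k i `&` Q !=set0]].

Definition omega H (l : nat) : set E :=
  \bigcup_(Q in [set Q | grid l Q /\
     \bigcup_(Q' in supp_ext H Q l) closure Q' `<=` dom H l]) closure Q.

Definition strictly_admissible H (m : nat) := (2 <= m)%N /\
  forall l, (m <= l < depth H)%N -> dom H l `<=` omega H (l - m).+1.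

Definition geo_map H (C : (E -> R) -> E) (x : E) : E :=
  \sum_(tau \in thb_basis H) tau x *: C tau.

Definition inv_on (D : set E) (F : E -> E) (y : E) : E :=
  xget 0 [set x | D x /\ F x = y].

Section physical_domain.
Variables (H0 : hierarchy) (C : (E -> R) -> E) (Omega : set E).
(* H0 is the hierarchy on which the geometry map F is defined, the meshes H
   below refine it. *)
Let F := geo_map H0 C.
Let Finv := inv_on (dom H0 0) F.

Definition parametrization (CF cF : R) :=
  [/\ 0 < CF, 0 < cF, set_bij (dom H0 0) (closure Omega) F,
      (exists k : R, k.-lipschitz_(dom H0 0) F) /\
      (exists k : R, k.-lipschitz_(closure Omega) Finv) &
      {ae lebesgue_rV R d, forall x, dom H0 0 x ->
         enorm (F x) <= CF /\
         forall j, derivable F x (delta_mx ord0 j : E) /\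
                   enorm ('D_(delta_mx ord0 j : E) F x) <= CF} /\
      {ae lebesgue_rV R d, forall y, Omega y ->
         enorm (Finv y) <= cF^-1 /\
         forall j, derivable Finv y (delta_mx ord0 j : E) /\
                   enorm ('D_(delta_mx ord0 j : E) Finv y) <= cF^-1}].

Definition physical_mesh H : set (set E) := [set F @` Q | Q in mesh H].

Definition physical_space H : set (E -> R) :=
  [set V | exists c : (E -> R) -> R,
     V = fun y => \sum_(tau \in thb_basis H) c tau * tau (Finv y)].

Definition dirichlet_space H : set (E -> R) :=
  [set V | physical_space H V /\ forall y, bdry Omega y -> V y = 0].

End physical_domain.

End splines.

Arguments spline_data : clear implicits.
Arguments hierarchy : clear implicits.

Section model_problem.
Context {R : realType} {d : nat}.
Local Notation E := 'rV[R]_d.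
Local Notation mu := (lebesgue_rV R d).
Variables (Omega : set E) (A : E -> 'M[R]_d) (f : E -> R).

Definition mxapp (M : 'M[R]_d) (xi : E) : E := xi *m M^T.

Definition elliptic (eta1 eta2 : R) :=
  [/\ 0 < eta1 <= eta2,
      forall i j, smooth_up_to_bdry Omega (fun x => A x i j) &
      forall x xi, Omega x ->
        eta1 * enorm xi ^+ 2 <= dot (mxapp (A x) xi) xi /\
        enorm (mxapp (A x) xi) <= eta2 * enorm xi].

Definition energy (v w : E -> R) : R :=
  \int[mu]_(x in Omega) dot (mxapp (A x) (wgrad Omega v x)) (wgrad Omega w x).

Definition weak_solution (u : E -> R) := H10 Omega u /\
  forall v, H10 Omega v -> energy u v = \int[mu]_(x in Omega) (f x * v x).

Definition galerkin (SD : set (E -> R)) (U : E -> R) := SD U /\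
  forall V, SD V -> energy U V = \int[mu]_(x in Omega) (f x * V x).

(* Classical derivatives: the residual is only used on the open elements, where
   the Galerkin approximation is smooth. *)
Definition residual (U : E -> R) (x : E) : R :=
  f x + \sum_i partial i (fun y => mxapp (A y) (grad U y) ord0 i) x.

Definition meshsize (Q : set E) : R := (fine (mu Q)) `^ (d%:R^-1).

Definition tensor_poly (n : 'I_d -> nat) : set (E -> R) :=
  [set q | exists c : {ffun 'I_d -> nat} -> R,
     q = fun x : E => \sum_(k \in [set k : {ffun 'I_d -> nat} | forall j, (k j <= n j)%N])
                    c k * \prod_j x ord0 j ^+ k j].

Definition L2proj (n : 'I_d -> nat) (Q : set E) (g : E -> R) : E -> R :=
  xget (fun=> 0) [set p | tensor_poly n p /\ forall q, tensor_poly n q ->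
    \int[mu]_(x in Q) ((g x - p x) * q x) = 0].

Definition indicator (U : E -> R) (Q : set E) : R :=
  meshsize Q * L2norm Q (residual U).

Definition oscillation (n : 'I_d -> nat) (U : E -> R) (Q : set E) : R :=
  meshsize Q * L2norm Q (residual U - L2proj n Q (residual U)).

End model_problem.

(* Main.v *)
Require Import Defs.
From mathcomp Require Import all_boot all_order all_algebra.
From mathcomp Require Import all_classical all_reals all_analysis.
From mathcomp Require Import measurable_realfun ring lra zify.
Set Implicit Arguments.
Unset Strict Implicit.
Unset Printing Implicit Defensive.
Import Order.TTheory GRing.Theory Num.Theory.
Import numFieldNormedType.Exports.
Local Open Scope classical_set_scope.
Local Open Scope ring_scope.

(** The argument is the classical one with a bubble function, except that the
    bubble is not the image of a polynomial bubble on a reference cell but a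
    fixed function of class C^oo with compact support, scaled to a cube inside
    the element of the physical domain.

    Shape regularity ([element_geometry]). A cell of level l of the parametric
    grids has sides comparable to 2^-l, with constants that come from level 0
    alone ([cell_size]). The geometry map F is bi-Lipschitz, and it is smooth on
    every cell of a refinement of the initial mesh. Hence Q = F (Qhat) lies
    between two concentric cubes whose radii are both comparable to 2^-l. The
    outer cube is a Lipschitz estimate. The inner one needs a quantitative form
    of the inverse function theorem ([ball_in_image]): minimizing |F x - y|^2
    over a closed cube in Qhat gives a solution of F x = y for all y close to
    the image of the centre.

    Local estimate ([bubble_estimate]). Let r be the residual, p its projection
    on polynomials, psi the bubble supported in the inner cube, of radius rho, and
    v = psi p. Equivalence of norms on the finite-dimensional space of
    polynomials, scaled from the unit cube to all cubes ([bubble_inequalities]),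
    bounds the square of the norm of p on Q and rho^2 times the square of the norm
    of the gradient of v by a multiple of

      int psi p^2 = int_Q r v + int_Q (p - r) v.

    The last term is at most the norm of r - p times the norm of v, and the norm
    of v is at most the square root of int psi p^2. It remains to bound
    int_Q r v by the error.

    Testing the equation ([residual_identity]). Since v is a test function
    supported in Q, the weak form of the equation and an integration by parts on
    Q give int_Q r v = int_Q A grad (u - U) . grad v, so that the Cauchy-Schwarz
    inequality concludes.

    For the last step, U must belong to H^1, its weak gradient must be the
    classical one, and the flux A grad U must be of class C^1 on Q. On a cell of
    the mesh, every truncated B-spline coincides with a polynomial
    ([thb_agrees]), because truncation with respect to a finer level only
    removes B-splines that vanish on the cell. So U is, on Q, the composition of
    a polynomial with the inverse of F, and its derivatives are of the same kind
    ([pulled_partial]). On the whole domain, U takes its values among finitely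
    many Lipschitz functions, which bounds its gradient
    ([piecewise_gradient_bound]).

    The weak gradient of u - U in the statement is one representative of a class
    of functions that are equal almost everywhere; that it can be replaced by
    any other one is [weak_gradient_unique], which rests on the fundamental
    lemma of the calculus of variations and on the test functions provided by
    [bump]. Integration by parts comes from the invariance of Lebesgue measure
    under translations ([integral_derive_eq0]). *)

(** * Cubes and measurability *)

Section borel_rV.
Context {R : realType} {d : nat}.
Local Notation E := 'rV[R]_d.

Lemma rV_normE (x : E) : `|x| = \big[Num.max/0]_ij `|x ij.1 ij.2|.
Proof. exact: mx_normrE. Qed.

Lemma rV_norm_le (x : E) (e : R) : 0 <= e ->
  (`|x| <= e) <-> (forall j, `|x ord0 j| <= e).
Proof.
move=> e0; rewrite rV_normE; split.
- by move=> /bigmax_leP[_ h] j; exact: (h (ord0, j) isT).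
- by move=> h; apply/bigmax_leP; split => // -[i j] _ /=; rewrite (ord1 i).
Qed.

Lemma rV_norm_lt (x : E) (e : R) : 0 < e ->
  (`|x| < e) <-> (forall j, `|x ord0 j| < e).
Proof.
move=> e0; rewrite rV_normE; split.
- by move=> /bigmax_ltP[_ h] j; exact: (h (ord0, j) isT).
- by move=> h; apply/bigmax_ltP; split => // -[i j] _ /=; rewrite (ord1 i).
Qed.

Lemma coord_le_norm (x : E) j : `|x ord0 j| <= `|x|.
Proof. by move: j; apply/rV_norm_le. Qed.

Definition box (a b : 'I_d -> R) : set E :=
  [set x | forall j, a j < x ord0 j < b j].

Definition cube (x : E) (r : R) : set E :=
  box (fun j => x ord0 j - r) (fun j => x ord0 j + r).

Lemma cubeE (x : E) r y : 0 < r -> cube x r y <-> `|y - x| < r.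
Proof.
move=> r0; rewrite rV_norm_lt//; split => h j; have := h j;
  by rewrite !mxE ltr_distl.
Qed.

Lemma open_rVP (A : set E) :
  open A <-> forall x, A x -> exists2 r, 0 < r & cube x r `<=` A.
Proof.
rewrite openE; split => [oA x /oA|oA x /oA[r r0 rA]].
- move=> /nbhs_ballP[r /= r0 rA]; exists r => // y /(cubeE _ _ r0) yr.
  by apply: rA; rewrite -ball_normE /= distrC.
- apply/nbhs_ballP; exists r => // y; rewrite -ball_normE /= distrC => yr.
  by apply: rA; apply/cubeE.
Qed.

Lemma box_open a b : open (box a b).
Proof.
rewrite openE => x h; rewrite /interior /box /=.
apply: (@filter_forall _ _ _ _ (nbhs_filter x)) => j.
have : nbhs (x ord0 j) `]a j, b j[%classic.
  by apply: open_nbhs_nbhs; split; [exact: itv_open|rewrite /= in_itv; exact: h].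
move=> /(@coord_continuous R 1 d ord0 j x).
by move=> H; apply: (@filterS _ (nbhs x) (nbhs_filter x) _ _ _ H) => y /=;
  rewrite in_itv.
Qed.

End borel_rV.

Section borel_rV_measurable.
Context {R : realType} {d : nat}.
Local Notation E := 'rV[R]_d.

Lemma measurable_box (a b : 'I_d -> R) : measurable (box a b : set E).
Proof.
rewrite (_ : box a b = \bigcap_(j in [set: 'I_d])
  ((fun x : E => x ord0 j) @^-1` `]a j, b j[%classic)); last first.
  by apply/seteqP; split => [x h j _|x h j] /=;
    [rewrite in_itv; exact: h | have := h j I; rewrite /= in_itv].
apply: fin_bigcap_measurable => // j _.
by rewrite -[X in measurable X]setTI; apply: measurable_coord => //;
  exact: measurable_itv.
Qed.

Definition cbox (a b : 'I_d -> R) : set E :=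
  [set x | forall j, a j <= x ord0 j <= b j].

Definition ccube (x : E) (r : R) : set E :=
  cbox (fun j => x ord0 j - r) (fun j => x ord0 j + r).

(** The cubes with centre in a grid of mesh 1/(k+1) and radius 2/(k+1) form a
    countable base of the topology. *)
Lemma open_cubes (A : set E) : open A ->
  exists (c : nat * 'rV[int]_d -> E) (r : nat * 'rV[int]_d -> R)
    (P : set (nat * 'rV[int]_d)),
  (forall p, P p -> ccube (c p) (r p) `<=` A) /\
  A = \bigcup_(p in P) cube (c p) (r p).
Proof.
move=> /open_rVP oA.
pose c (p : nat * 'rV[int]_d) : E := \row_j ((p.2 ord0 j)%:~R / p.1.+1%:R).
pose r (p : nat * 'rV[int]_d) : R := 2 / p.1.+1%:R.
exists c, r, [set p | ccube (c p) (r p) `<=` A]; split => //.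
apply/seteqP; split => [x /[dup] Ax /oA[e e0 eA]|x [p pA px]]; last first.
  by apply: pA => j; have /andP[? ?] := px j; apply/andP; split; exact: ltW.
have [k ke] : exists k, 4 / k.+1%:R < e.
  exists (Num.trunc (4 / e)).
  rewrite ltr_pdivrMr// mulrC -ltr_pdivrMr//.
  by apply: (lt_le_trans (truncnS_gt _)).
have k0 : 0 < k.+1%:R :> R by [].
pose z : 'rV[int]_d := \row_j Num.floor (x ord0 j * k.+1%:R).
have xz j : (c (k, z)) ord0 j <= x ord0 j < (c (k, z)) ord0 j + 1 / k.+1%:R.
  rewrite !mxE /= -mulrDl ler_pdivrMr// ltr_pdivlMr//.
  by rewrite floor_le_tmp -intrD1 floorD1_gt.
have k1 : 0 < 1 / k.+1%:R :> R by rewrite divr_gt0.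
have rE : r (k, z) = 1 / k.+1%:R + 1 / k.+1%:R by rewrite /r /=; field.
have eE : 4 / k.+1%:R = 4 * (1 / k.+1%:R) :> R by field.
exists (k, z) => [|j].
  move=> y Qy; apply: eA => j; move: (xz j) (Qy j) k1 ke.
  rewrite /= rE eE; move: (x ord0 j) (y ord0 j) (1 / k.+1%:R) ((c (k, z)) ord0 j).
  by move=> a b w cz /andP[? ?] /andP[? ?] ? ?; apply/andP; split; lra.
move: (xz j) k1; rewrite /= rE.
move: (x ord0 j) (1 / k.+1%:R) ((c (k, z)) ord0 j) => a w cz /andP[? ?] ?.
by apply/andP; split; lra.
Qed.

(** The product sigma-algebra contains the open sets because these are countable
    unions of cubes. *)
Lemma open_measurable_rV (A : set E) : open A -> measurable A.
Proof.
move=> /open_cubes[c [r [P [_ ->]]]]; rewrite bigcup_mkcond.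
apply: countable_bigcupT_measurable => // p; case: ifP => // _.
exact: measurable_box.
Qed.

Lemma continuous_measurable_rV (A : set E) (f : E -> R) : open A ->
  (forall x, A x -> {for x, continuous f}) -> measurable_fun A f.
Proof.
move=> oA cf; apply: (measurability _ (RGenOpens.measurableE R)).
move=> _ [_ [a [b ->] <-]]; apply: open_measurable_rV.
rewrite openE => x [Ax abx]; apply: filterI; first exact: open_nbhs_nbhs.
by apply: cf => //; apply: open_nbhs_nbhs; split => //; exact: interval_open.
Qed.

Lemma measurable_dilate (c : E) (r : R) :
  measurable_fun setT (fun x : E => r *: (x - c)).
Proof.
apply: measurable_fun_coordP => i.
apply: (continuous_measurable_rV openT) => x _.
have -> : (fun t => (r *: (t - c)) ord0 i : measurableTypeR R) =
          (fun t : 'rV[R]_d => r * (t ord0 i - c ord0 i)).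
  by apply/funext => t; rewrite !mxE.
apply: (@cvgM _ _ _ (nbhs_filter x)); first exact: cvg_cst.
apply: (@cvgB _ _ _ _ (nbhs_filter x)); last exact: cvg_cst.
exact: coord_continuous.
Qed.

Lemma continuousT_measurable_rV (A : set E) (f : E -> R) : continuous f ->
  measurable_fun A f.
Proof.
move=> cf; apply: measurable_funTS.
by apply: (continuous_measurable_rV openT) => x _; exact/cf.
Qed.

End borel_rV_measurable.

(** * Lebesgue measure of boxes and integrals *)

Section lebesgue_box.
Context {R : realType}.
Local Notation mu d := (lebesgue_rV R d).

(** Lebesgue measure is defined by splitting off the first coordinate. *)
Lemma preimage_rV_cons_box d (a b : 'I_(1 + d) -> R) :
  @rV_cons R d @^-1` box a b =
  `]a (lshift d ord0), b (lshift d ord0)[%classic `*`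
  box (a \o @rshift 1 d) (b \o @rshift 1 d).
Proof.
apply/seteqP; split => [[x v]|[x v]] /=.
  move=> h; split => [|j] /=.
    by have := h (lshift d ord0); rewrite /rV_cons row_mxEl mxE eqxx mulr1n in_itv.
  by have := h (rshift 1 j); rewrite /rV_cons row_mxEr.
move=> [xab vab] j; case: (split_ordP j) => k ->.
  by rewrite /rV_cons row_mxEl !mxE !ord1 eqxx mulr1n; move: xab; rewrite in_itv.
by rewrite /rV_cons row_mxEr; exact: vab.
Qed.

Lemma lebesgue_box d (a b : 'I_d -> R) : (forall j, a j <= b j) ->
  mu d (box a b) = (\prod_j (b j - a j))%:E.
Proof.
elim: d a b => [|d IH] a b ab.
  rewrite big_ord0 /= diracE mem_set//.
  by move=> -[].
have -> : mu d.+1 (box a b) =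
  (@lebesgue_measure R \x mu d)%E (@rV_cons R d @^-1` box (a : 'I_(1 + d) -> R) b).
  by [].
rewrite preimage_rV_cons_box product_measure1E//; last exact: measurable_box.
rewrite IH => [|j /=]; last exact: ab.
rewrite big_ord_recl EFinM; congr (_ * _)%E.
  apply: etrans (lebesgue_measure_itv _) _; rewrite /= lte_fin.
  have -> : lshift d (ord0 : 'I_1) = ord0 :> 'I_(1 + d) by exact/val_inj.
  case: ltP => // ba; congr EFin; apply/esym/eqP.
  by rewrite subr_eq0 eq_le ba ab.
congr EFin; apply: eq_bigr => j _ /=.
by rewrite (_ : rshift 1 j = lift ord0 j :> 'I_(1 + d))//; exact/val_inj.
Qed.

Lemma lebesgue_cube d (x : 'rV[R]_d) (r : R) : 0 <= r ->
  mu d (cube x r) = ((2 * r) ^+ d)%:E.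
Proof.
move=> r0; rewrite lebesgue_box => [|j]; last by lra.
congr EFin; rewrite -[in RHS](card_ord d) -prodr_const.
by apply: eq_bigr => j _; ring.
Qed.

Definition boxes d : set (set 'rV[R]_d) :=
  [set B | exists a b, B = box a b].

Lemma boxes_setI d : setI_closed (@boxes d).
Proof.
move=> _ _ [a [b ->]] [a' [b' ->]].
exists (fun j => Num.max (a j) (a' j)), (fun j => Num.min (b j) (b' j)).
apply/seteqP; split => [x [h h'] j|x h].
  have /andP[? ?] := h j; have /andP[? ?] := h' j.
  by rewrite gt_max lt_min; apply/andP; split; apply/andP.
by split => j; have := h j; rewrite gt_max lt_min;
  move=> /andP[/andP[? ?] /andP[? ?]]; apply/andP.
Qed.

Lemma boxes_cover d : \bigcup_k cube (0 : 'rV[R]_d) k.+1%:R = setT.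
Proof.
rewrite -subTset => x _; exists (Num.trunc `|x|) => //.
by apply/cubeE => //; rewrite subr0 truncnS_gt.
Qed.

(** Boxes generate the sigma-algebra: the strip bounded in one coordinate is an
    increasing union of boxes. *)
Lemma measurable_boxes d : measurable = <<s @boxes d >> :> set (set 'rV[R]_d).
Proof.
apply/seteqP; split; last first.
  by apply: smallest_sub => [|_ [a [b ->]]];
    [exact: sigma_algebra_measurable|exact: measurable_box].
apply: smallest_sub; first exact: smallest_sigma_algebra.
rewrite -bigcup_seq => A [i _] [B mB <-] /=; rewrite setTI.
suff : measurable_fun setT
  (fun x : g_sigma_algebraType (@boxes d) => (x : 'rV[R]_d) ord0 i).
  by move=> /(_ measurableT _ mB); rewrite setTI.
apply: (measurability _ (RGenOpens.measurableE R)) => _ [_ [a [b ->] <-]].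
rewrite setTI (_ : _ @^-1` _ = \bigcup_k box
  (fun j => if j == i then a else - k%:R) (fun j => if j == i then b else k%:R)).
  apply: bigcupT_measurable => k; apply: sub_sigma_algebra.
  by eexists; eexists.
apply/seteqP; split => [x|x [k _ /(_ i)]] /=; last by rewrite eqxx in_itv.
rewrite in_itv => xab; exists (Num.trunc `|x|).+1 => //= j; case: eqP => [->//|_].
by rewrite -ltr_norml (le_lt_trans (coord_le_norm _ _))// truncnS_gt.
Qed.

(** Both sides are measures of [A], and they agree on boxes. *)
Lemma lebesgue_dilate d (x0 : 'rV[R]_d) (r : R) (A : set 'rV[R]_d) : 0 < r ->
  measurable A ->
  mu d ((fun x => r^-1 *: (x - x0)) @^-1` A) = ((r ^+ d)%:E * mu d A)%E.
Proof.
move=> r0 mA; pose phi (x : 'rV[R]_d) := r^-1 *: (x - x0).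
have mphi : measurable_fun setT phi by exact: measurable_dilate.
pose k : {nonneg R} := NngNum (exprn_ge0 d (ltW r0)).
pose m1 : {measure set 'rV[R]_d -> \bar R} := mscale k (mu d).
pose m2 : {measure set 'rV[R]_d -> \bar R} :=
  measure_function_pushforward__canonical__measure_function_Measure (mu d) mphi.
suff : m1 A = m2 A by move=> /esym; apply: etrans.
apply: (measure_unique (@boxes d) (fun k => cube 0 k.+1%:R)) => //.
- exact: measurable_boxes.
- exact: boxes_setI.
- by move=> i; eexists; eexists.
- exact: boxes_cover.
- move=> _ [a [b ->]].
  change ((r ^+ d)%:E * mu d (box a b) = mu d (phi @^-1` box a b))%E.
  have -> : phi @^-1` box a b =
      box (fun j => x0 ord0 j + r * a j) (fun j => x0 ord0 j + r * b j).
    apply/seteqP; split => x h j; have := h j; rewrite /phi !mxE;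
    by rewrite ltr_pdivlMl// ltr_pdivrMl// ltrBrDl ltrBlDl.
  have [ab|] := pselect (forall j, a j <= b j).
    rewrite !lebesgue_box// => [|j]; last by rewrite lerD2l ler_pM2l.
    rewrite -EFinM; congr EFin.
    rewrite (_ : r ^+ d = \prod_(j < d) r); last by rewrite prodr_const card_ord.
    by rewrite -big_split; apply: eq_bigr => j _ /=; ring.
  move=> /existsNP[j /negP]; rewrite -ltNge => ba.
  rewrite (_ : box a b = set0); last first.
    apply/seteqP; split => // x /(_ j) /andP[h1 h2].
    by have := lt_trans h1 (lt_trans h2 ba); rewrite ltxx.
  rewrite (_ : box _ _ = set0) ?measure0 ?mule0//.
  apply/seteqP; split => // x /(_ j) /andP[h1 h2].
  by have := lt_trans h1 h2; rewrite ltrD2l ltr_pM2l// ltNge (ltW ba).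
- move=> j; change ((r ^+ d)%:E * mu d (cube 0 j.+1%:R) < +oo)%E.
  by rewrite lebesgue_cube// -EFinM ltry.
Qed.

End lebesgue_box.

Section integrals_rV.
Context {R : realType} {d : nat}.
Local Notation E := 'rV[R]_d.
Local Notation mu := (lebesgue_rV R d).

Lemma compact_closed_ball_rV (M : R) : compact [set x : E | `|x| <= M].
Proof.
apply: bounded_closed_compact.
  by exists M; split; [exact: num_real|move=> r Mr x /= /le_trans; apply; exact: ltW].
apply: (@closed_comp _ _ (fun x : E => `|x|) [set y | y <= M]).
  by move=> x _; exact: norm_continuous.
exact: closed_le.
Qed.

Lemma continuous_bounded_on_ball (f : E -> R) (M : R) : continuous f ->
  exists2 B : R, 0 <= B & forall x, `|x| <= M -> `|f x| <= B.
Proof.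
move=> cf; have : compact (f @` [set x : E | `|x| <= M]).
  apply: continuous_compact; last exact: compact_closed_ball_rV.
  exact: continuous_subspaceT.
move=> /compact_bounded[B0 [_ hB]]; exists (`|B0| + 1) => [|x xM].
  by rewrite addr_ge0.
by apply: (hB (`|B0| + 1)); [rewrite ltr_pwDr// ler_norm|exists x].
Qed.

Lemma integrable_bounded (A : set E) (f : E -> R) (B : R) : measurable A ->
  (mu A < +oo)%E -> measurable_fun A f -> (forall x, A x -> `|f x| <= B) ->
  mu.-integrable A (EFin \o f).
Proof.
move=> mA Afin mf fB; apply: measurable_bounded_integrable => //.
exists B; split; first exact: num_real.
by move=> r Br x Ax; apply: (le_trans (fB _ Ax)); exact: ltW.
Qed.

(** For a negative radius the cube is empty, except in dimension 0. *)
Lemma lebesgue_cube_fin (x : E) (r : R) : (mu (cube x r) < +oo)%E.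
Proof.
have [r0|r0] := leP 0 r; first by rewrite lebesgue_cube// ltry.
have [d0|d0] := posnP d.
  have := @lebesgue_cube R d x 0 (lexx _).
  move=> h; apply: le_lt_trans (_ : mu (cube x 0) < +oo)%E.
    apply: le_measure; rewrite ?inE; [exact: measurable_box..|].
    by move=> y _ j; have := ltn_ord j; rewrite [X in (_ < X)%N]d0.
  by rewrite h ltry.
rewrite (_ : cube x r = set0) ?measure0//.
apply/seteqP; split => // y /(_ (Ordinal d0)) /andP[h1 h2].
by have := lt_trans h1 h2; rewrite ltrD2l; move: r0; clear; move=> ? ?; lra.
Qed.

Lemma bounded_support_integrable (f : E -> R) (M B : R) : measurable_fun setT f ->
  (forall x, `|f x| <= B) -> (forall x, M < `|x| -> f x = 0) ->
  mu.-integrable setT (EFin \o f).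
Proof.
move=> mf fB f0.
pose K := cube (0 : E) (`|M| + 1).
have K0 : 0 < `|M| + 1 by rewrite ltr_pwDr.
have -> : f = f \_ K.
  apply/funext => x; rewrite patchE; case: ifPn => // /negP xK.
  apply: f0; rewrite ltNge; apply/negP => xM; apply: xK; rewrite inE.
  by apply/cubeE => //; rewrite subr0; apply: (le_lt_trans xM);
  apply: (le_lt_trans (ler_norm _)); rewrite ltrDl.
rewrite -restrict_EFin; apply/(@integrable_mkcond _ _ _ mu K) => //; first exact: measurable_box.
apply: (@integrable_bounded _ _ B) => //; first exact: measurable_box.
  exact: lebesgue_cube_fin.
exact: measurable_funS mf.
Qed.

Lemma continuous_support_bounded (f : E -> R) (M : R) : continuous f ->
  (forall x, M < `|x| -> f x = 0) -> exists2 B : R, 0 <= B & forall x, `|f x| <= B.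
Proof.
move=> cf f0; have [B B0 fB] := continuous_bounded_on_ball M cf.
by exists B => // x; have [/fB//|/f0 ->] := leP `|x| M; rewrite normr0.
Qed.

Lemma continuous_support_integrable (f : E -> R) (M : R) : continuous f ->
  (forall x, M < `|x| -> f x = 0) -> mu.-integrable setT (EFin \o f).
Proof.
move=> cf f0; have [B B0 fB] := continuous_support_bounded cf f0.
apply: (bounded_support_integrable _ fB f0).
exact: continuousT_measurable_rV.
Qed.

Lemma integral_dilate (c : E) (r : R) (f : E -> \bar R) : 0 < r ->
  measurable_fun setT f -> (forall x, (0 <= f x)%E) ->
  (\int[mu]_x f (r^-1 *: (x - c)) = (r ^+ d)%:E * \int[mu]_x f x)%E.
Proof.
move=> r0 mf f0; pose k : {nonneg R} := NngNum (exprn_ge0 d (ltW r0)).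
have h := @ge0_integral_pushforward _ _ _ _ _ _ (measurable_dilate c r^-1) mu setT f
  measurableT mf (fun y _ => f0 y).
rewrite preimage_setT in h; rewrite -h.
rewrite -[RHS](@ge0_integral_mscale _ _ _ mu setT measurableT k f mf)//.
apply: eq_measure_integral => [|? A mA _]; first exact: measurable_dilate.
by have := lebesgue_dilate c r0 mA.
Qed.

Lemma integral_translate (c : E) (f : E -> R) :
  measurable_fun setT f -> mu.-integrable setT (EFin \o (fun x => f (x - c))) ->
  (\int[mu]_x (f (x - c))%:E = \int[mu]_x (f x)%:E)%E.
Proof.
move=> mf If.
have mphi : measurable_fun setT (fun x : E => x - c).
  by have := measurable_dilate c 1; under eq_fun do rewrite scale1r.
rewrite -[LHS](@integral_pushforward _ _ _ _ _ _ mphi mu setT (EFin \o f))//.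
- apply: eq_measure_integral => A mA _.
  have := lebesgue_dilate c ltr01 mA; rewrite expr1n mul1e; apply: etrans.
  rewrite /pushforward; congr (mu (_ @^-1` A)).
  by apply/funext => x; rewrite invr1 scale1r.
- exact/measurable_EFinP.
Qed.

End integrals_rV.

(** * Directional derivatives *)

Section directional.
Context {R : realType} {d : nat}.
Local Notation E := 'rV[R]_d.

Lemma line_quotient (W : normedModType R) (f : E -> W) (x v : E) (t : R) :
  (fun h : R => h^-1 *: (((fun s => f (x + s *: v)) \o shift t) (h *: (1 : R))
                   - f (x + t *: v))) =
  (fun h : R => h^-1 *: ((f \o shift (x + t *: v)) (h *: v) - f (x + t *: v))).
Proof.
apply/funext => h /=; congr (_ *: (f _ - _)).
by rewrite [h *: 1]mulr1 scalerDl addrCA.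
Qed.

Lemma is_derive_line (W : normedModType R) (f : E -> W) (x v : E) (t : R) :
  derivable f (x + t *: v) v ->
  is_derive t (1 : R) (fun s => f (x + s *: v)) ('D_v f (x + t *: v)).
Proof.
move=> df; apply: DeriveDef; rewrite /derivable /derive line_quotient//.
Qed.

Lemma line_mean_value (f : E -> R) (x v : E) (h B : R) :
  (forall y : E, derivable f y v) -> (forall y : E, `|'D_v f y| <= B) -> 0 <= h ->
  `|f (x + h *: v) - f x| <= B * h.
Proof.
move=> df fB h0.
have dl (t : R) : is_derive t (1 : R) (fun s => f (x + s *: v)) ('D_v f (x + t *: v)).
  exact: is_derive_line.
have cl : {within `[0, h], continuous (fun s => f (x + s *: v))}.
  by apply: derivable_within_continuous => t _; have [] := dl t.
have [c _ /=] := @MVT_segment R _ _ 0 h h0 (fun t _ => dl t) cl.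
rewrite scale0r addr0 subr0 => ->.
by rewrite normrM (ger0_norm h0) ler_wpM2r.
Qed.

Lemma derive_support (f : E -> R) (v : E) (M : R) :
  (forall x : E, M < `|x| -> f x = 0) -> forall x : E, M < `|x| -> 'D_v f x = 0.
Proof.
move=> f0 x Mx; rewrite (@near_eq_derive _ _ _ f (cst 0)) ?derive_cst//.
have : \forall y \near x, M < `|y|.
  exact: (@cvgr_gt R E (nbhs x) _ _ `|x| (@norm_continuous R E x) M Mx).
by move=> H; apply: (@filterS _ _ (nbhs_filter x) _ _ _ H) => y /f0.
Qed.

(** The difference quotients of f along v have integral 0, as Lebesgue measure
    is translation invariant, and they converge boundedly to the derivative. *)
Lemma integral_derive_eq0 (f : E -> R) (v : E) (M : R) : continuous f ->
  (forall x : E, derivable f x v) -> continuous ('D_v f) ->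
  (forall x : E, M < `|x| -> f x = 0) ->
  (\int[lebesgue_rV R d]_x ('D_v f x)%:E = 0)%E.
Proof.
move=> cf df cdf f0.
have [B B0 fB] := continuous_support_bounded cdf (derive_support v f0).
pose h n : R := n.+1%:R^-1.
have h0 n : 0 < h n by rewrite invr_gt0.
(* the difference quotients, written with a subtraction as in the translation
   invariance of the integral *)
pose q n (x : E) : R := (h n)^-1 * (f (x - - (h n *: v)) - f x).
pose K := cube (0 : E) (`|M| + `|v| + 1).
have K0 : 0 < `|M| + `|v| + 1 by rewrite ltr_pwDr// addr_ge0.
have mK : measurable K by exact: measurable_box.
have cshift n : continuous (fun x : E => f (x - - (h n *: v))).
  move=> x; apply: (@cvg_comp _ _ _ (fun x : E => x - - (h n *: v)) f _
    (nbhs (x - - (h n *: v)))); last exact: cf.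
  by apply: (@cvgB _ _ _ _ (nbhs_filter x)); [exact: cvg_id|exact: cvg_cst].
have sshift n (x : E) : `|M| + `|v| + 1 <= `|x| -> f (x - - (h n *: v)) = 0.
  move=> Mx; apply: f0; rewrite opprK.
  have hv : `|h n *: v| <= `|v|.
    rewrite normrZ gtr0_norm// ler_piMl//.
    by rewrite invf_le1// ler1n.
  have := lerB_normD x (h n *: v).
  have := ler_norm M.
  by move: Mx hv; clear; move=> *; lra.
have Ishift n : (lebesgue_rV R d).-integrable setT
    (EFin \o (fun x : E => f (x - - (h n *: v)))).
  by apply: (continuous_support_integrable (cshift n)) => x /ltW; exact: sshift.
have If := continuous_support_integrable cf f0.
have mf : measurable_fun setT f.
  exact: continuousT_measurable_rV.
have Iq n : (\int[lebesgue_rV R d]_x (q n x)%:E = 0)%E.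
  under eq_integral do rewrite EFinM.
  rewrite integralZl//; last exact: (integrableB measurableT (Ishift n) If).
  under eq_integral do rewrite EFinB.
  rewrite integralB//; last exact: Ishift.
  have /= -> := integral_translate mf (Ishift n).
  by rewrite subee ?mule0// (integrable_fin_num measurableT If).
have qB n x : `|q n x| <= B * \1_K x.
  rewrite indicE; case: (boolP (x \in K)) => [_|/negP xK].
    rewrite mulr1 /q normrM gtr0_norm ?invr_gt0// ler_pdivrMl// mulrC opprK.
    by apply: line_mean_value => //; exact: ltW.
  have Mx : `|M| + `|v| + 1 <= `|x|.
    rewrite leNgt; apply/negP => xM; apply: xK; rewrite inE.
    by apply/cubeE => //; rewrite subr0.
  rewrite /q sshift// f0 ?subr0 ?mulr0 ?normr0//.
  have := ler_norm M; have := normr_ge0 v.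
  by move: Mx; clear; move=> *; lra.
have cq x : (q^~ x n) @[n --> \oo] --> 'D_v f x.
  have /cvgr_dist_lt cx := df x.
  apply/cvgrPdist_lt => e e0; have := cx _ e0.
  rewrite /dnbhs /within /= => -[r /= r0 hr].
  have : \forall n \near \oo, h n < r.
    by have := @near_infty_natSinv_lt R (PosNum r0).
  apply: filterS => n hn; rewrite /q opprK.
  have := hr (h n); rewrite /= sub0r normrN gtr0_norm// => /(_ hn).
  by rewrite gt_eqF// => /(_ isT); rewrite /= [h n *: v + x]addrC.
have mq n : measurable_fun setT (fun x => (q n x)%:E).
  apply/measurable_EFinP/measurable_funM => //; apply: measurable_funB => //.
  exact: continuousT_measurable_rV.
have mdf : measurable_fun setT (fun x => ('D_v f x)%:E).
  apply/measurable_EFinP.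
  exact: continuousT_measurable_rV.
have cqE : {ae lebesgue_rV R d, forall x : E, setT x ->
    (q n x)%:E @[n --> \oo] --> ('D_v f x)%:E}.
  apply: aeW => x _; apply/fine_cvgP; split; first exact: nearW.
  exact: cq.
have IB : (lebesgue_rV R d).-integrable setT (EFin \o (fun x : E => B * \1_K x)).
  apply: (@bounded_support_integrable _ _ _ (`|M| + `|v| + 1) B).
  - by apply: measurable_funM => //; exact: measurable_indic.
  - move=> x; rewrite normrM (ger0_norm B0) ler_piMr// indicE.
    by case: (_ \in _); rewrite ?normr1 ?normr0.
  - move=> x Mx; rewrite indicE memNset ?mulr0// => /(cubeE _ _ K0).
    by rewrite subr0 ltNge (ltW Mx).
have qBE : {ae lebesgue_rV R d, forall (x : E) n, setT x ->
    (`|(q n x)%:E| <= ((B * \1_K x)%:E))%E}.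
  by apply: aeW => x n _; rewrite lee_fin; exact: qB.
have [_ _] := dominated_convergence measurableT mq mdf cqE IB qBE.
have -> : [sequence (\int[lebesgue_rV R d]_x (q n x)%:E)%E]_n = (fun=> 0%E).
  by apply/funext => n; exact: Iq.
by move=> /(cvg_unique _ (cvg_cst 0%E)) => ->.
Qed.
End directional.

(** * A class of smooth functions *)

Lemma big_pointwise_closed (T V I : Type) (C : (T -> V) -> Prop) (op : V -> V -> V)
    (idx : V) (s : seq I) (P : pred I) (F : I -> T -> V) : C (fun=> idx) ->
  (forall f g, C f -> C g -> C (fun x => op (f x) (g x))) ->
  (forall i, P i -> C (F i)) -> C (fun x => \big[op/idx]_(i <- s | P i) F i x).
Proof.
move=> C0 Cop CF; elim: s => [|i s IH]; first by under eq_fun do rewrite big_nil.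
under eq_fun do rewrite big_cons.
by case Pi: (P i) => //; exact: Cop (CF _ Pi) IH.
Qed.

Section flat_function.
Context {R : realType}.

(** Functions that are flat at 0, in a family whose span is closed under
    derivation. *)
Definition flat (c : R) (k : nat) (t : R) : R :=
  if 0 < t then t^-1 ^+ k * expR (- c * t^-1) else 0.

Lemma flat_ge0 c k t : 0 <= flat c k t.
Proof.
rewrite /flat; case: ifP => // t0.
by rewrite mulr_ge0 ?expR_ge0// exprn_ge0// invr_ge0 ltW.
Qed.

Lemma flat_gt0 c k t : (0 < flat c k t) = (0 < t).
Proof.
rewrite /flat; case: ifP => t0; last by rewrite ltxx.
by rewrite mulr_gt0 ?expR_gt0// exprn_gt0// invr_gt0.
Qed.

Lemma expR_ge_pow (y : R) (n : nat) : 0 < y -> (y / n.+1%:R) ^+ n.+1 <= expR y.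
Proof.
move=> y0; have -> : expR y = expR (y / n.+1%:R) ^+ n.+1.
  by rewrite -expRM_natl mulrCA divff ?mulr1.
rewrite lerXn2r ?nnegrE ?expR_ge0//; first by rewrite divr_ge0// ltW.
apply: le_trans (expR_ge1Dx _); by rewrite lerDr.
Qed.

(** Flatness at 0: the exponential decays faster than any power, and a quadratic
    bound makes the derivative at 0 vanish. *)
Lemma flat_le_sqr (c : R) k : 0 < c -> exists2 B : R, 0 < B &
  forall t, flat c k t <= B * t ^+ 2.
Proof.
move=> c0; pose n := k.+1.
exists ((n.+1%:R / c) ^+ n.+1); first by rewrite exprn_gt0// divr_gt0.
move=> t; rewrite /flat; case: ifP => t0; last first.
  by rewrite mulr_ge0 ?sqr_ge0// exprn_ge0// divr_ge0// ltW.
have y0 : 0 < c * t^-1 by rewrite mulr_gt0// invr_gt0.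
have := expR_ge_pow n y0.
rewrite mulNr expRN => h.
have p0 : 0 < (c * t^-1 / n.+1%:R) ^+ n.+1 by rewrite exprn_gt0// divr_gt0.
have := h; rewrite -lef_pV2 ?posrE ?expR_gt0// => {}h.
have tk0 : 0 <= t^-1 ^+ k by rewrite exprn_ge0// invr_ge0 ltW.
apply: le_trans (ler_wpM2l tk0 h) _.
rewrite -exprVn !invfM !invrK (_ : c^-1 * t * n.+1%:R = (n.+1%:R / c) * t); last by ring.
rewrite exprMn mulrCA (_ : t^-1 ^+ k * t ^+ n.+1 = t ^+ 2)//.
by rewrite /n -addn2 exprD mulrA exprVn mulVf ?mul1r// expf_neq0// gt_eqF.
Qed.

Lemma is_derive_flat (c : R) k t : 0 < c ->
  is_derive t (1 : R) (flat c k) (c * flat c k.+2 t - k%:R * flat c k.+1 t).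
Proof.
move=> c0; have [t0|t0|t0] := ltgtP 0 t.
- have tn0 : t != 0 by rewrite gt_eqF.
  have n0 : {near t, flat c k =1 (fun s => s^-1 ^+ k * expR (- c * s^-1))}.
    have : \forall s \near t, 0 < s by exact: lt_nbhsr.
    by apply: filterS => s s0; rewrite /flat s0.
  have dV : is_derive t (1 : R) (fun s : R => s^-1) (- (t^-1 ^+ 2)).
    apply: is_derive_eq; first exact: (is_deriveV tn0).
    by rewrite /GRing.scale /= mulr1 exprVn.
  have dE : is_derive t (1 : R) (fun s : R => expR (- c * s^-1))
      (c * t^-1 ^+ 2 * expR (- c * t^-1)).
    have dl : is_derive t (1 : R) (fun s : R => - c * s^-1) (- c * - (t^-1 ^+ 2)).
      exact: (is_deriveZ (- c)).
    apply: (is_derive_eq (@is_derive1_comp _ expR _ _ _ _ (is_derive_expR _) dl)).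
    ring.
  have dX : is_derive t (1 : R) (fun s : R => s^-1 ^+ k)
      (k%:R * t^-1 ^+ k.-1 * - (t^-1 ^+ 2)).
    by have := is_deriveX k dV; rewrite exprfctE.
  apply: near_eq_is_derive; first by near do apply/esym; exact: n0.
  apply: (is_derive_eq (is_deriveM dX dE)).
  rewrite /flat t0 /GRing.scale /=.
  case: k {n0 dX} => [|k] /=; first by rewrite !mul0r; ring.
  by rewrite !exprS; ring.
- have -> : c * flat c k.+2 t - k%:R * flat c k.+1 t = 0.
    by rewrite /flat ltNge (ltW t0) /= !mulr0 subr0.
  apply: (@near_eq_is_derive _ _ _ (cst 0 : R -> R)).
  have : \forall s \near t, s < 0 by exact: lt_nbhsl.
  by apply: filterS => s s0; rewrite /flat ltNge (ltW s0).
rewrite -t0; have -> : c * flat c k.+2 0 - k%:R * flat c k.+1 0 = 0.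
  by rewrite /flat ltxx !mulr0 subr0.
have [B B0 hB] := flat_le_sqr k c0.
have h : (fun h : R => h^-1 *: ((flat c k \o shift 0) (h *: (1 : R)) - flat c k 0))
    @ 0^' --> (0 : R).
  apply/cvgr0Pnorm_le => e e0.
  have H1 : \forall h \near (0 : R)^', `|h| <= e / B.
    by apply: dnbhs0_le; rewrite divr_gt0.
  have H2 : \forall h \near (0 : R)^', h != 0 by exact: nbhs_dnbhs_neq.
  apply: filterS2 H1 H2 => h hB' h0 /=.
  rewrite /shift /= addr0 [h *: 1]mulr1 {2}/flat ltxx subr0 normrM normfV.
  rewrite ler_pdivrMl ?normr_gt0// (ger0_norm (flat_ge0 _ _ _)).
  apply: le_trans (hB h) _.
  have -> : h ^+ 2 = `|h| * `|h| by rewrite -normrM -expr2 ger0_norm ?sqr_ge0.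
  by rewrite mulrCA ler_wpM2l// -ler_pdivlMl// mulrC.
by apply: DeriveDef; [apply/cvg_ex; exists 0 | exact: cvg_lim].
Unshelve. all: by end_near.
Qed.

End flat_function.

Section smooth_class.
Context {R : realType} {d : nat}.
Local Notation E := 'rV[R]_d.
Implicit Types (D : set E) (f g : E -> R).

(** A class of functions that are smooth on D, given by the way they are built
    and therefore visibly closed under partial derivation. *)
Inductive smooth D : (E -> R) -> Prop :=
| smooth_cst c : smooth D (fun=> c)
| smooth_coord j : smooth D (fun x => x ord0 j)
| smooth_flat c a b k j : 0 < c -> smooth D (fun x => flat c k (a * x ord0 j + b))
| smoothD f g : smooth D f -> smooth D g -> smooth D (fun x => f x + g x)
| smoothM f g : smooth D f -> smooth D g -> smooth D (fun x => f x * g x)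
| smoothV f : smooth D f -> (forall x, D x -> f x != 0) ->
    smooth D (fun x => (f x)^-1).

Lemma smoothB D f g : smooth D f -> smooth D g -> smooth D (fun x => f x - g x).
Proof.
move=> sf sg; have -> : (fun x => f x - g x) = (fun x => f x + (-1) * g x).
  by apply/funext => x; rewrite mulN1r.
by apply: smoothD => //; apply: smoothM => //; exact: smooth_cst.
Qed.

Lemma smooth_sum D (I : Type) (s : seq I) (P : pred I) (F : I -> E -> R) :
  (forall i, P i -> smooth D (F i)) ->
  smooth D (fun x => \sum_(i <- s | P i) F i x).
Proof.
by apply: (big_pointwise_closed (C := smooth D)); [exact: smooth_cst|exact: smoothD].
Qed.

Lemma smooth_prod D (I : Type) (s : seq I) (P : pred I) (F : I -> E -> R) :
  (forall i, P i -> smooth D (F i)) ->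
  smooth D (fun x => \prod_(i <- s | P i) F i x).
Proof.
by apply: (big_pointwise_closed (C := smooth D)); [exact: smooth_cst|exact: smoothM].
Qed.

Lemma smoothX D f n : smooth D f -> smooth D (fun x => f x ^+ n).
Proof.
move=> sf; have -> : (fun x => f x ^+ n) = (fun x => \prod_(i < n) f x).
  by apply/funext => x; rewrite prodr_const card_ord.
by apply: smooth_prod.
Qed.

(** By the Leibniz formula. *)
Lemma smooth_det D (m : nat) (M : E -> 'M[R]_m) :
  (forall i j, smooth D (fun x => M x i j)) -> smooth D (fun x => \det (M x)).
Proof.
move=> sM; apply: smooth_sum => s _.
by apply: smoothM; [exact: smooth_cst|apply: smooth_prod].
Qed.

(** By the cofactor formula. *)
Lemma smooth_invmx D (m : nat) (M : E -> 'M[R]_m) :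
  (forall i j, smooth D (fun x => M x i j)) ->
  (forall x, D x -> M x \in unitmx) ->
  forall i j, exists2 g, smooth D g & forall x, D x -> g x = invmx (M x) i j.
Proof.
move=> sM uM i j.
exists (fun x => (\det (M x))^-1 * (\adj (M x)) i j).
  apply: smoothM.
    apply: smoothV; first exact: smooth_det.
    by move=> x /uM; rewrite unitmxE unitfE.
  under eq_fun do rewrite mxE; apply: smoothM; first exact: smooth_cst.
  apply: smooth_det => k l; under eq_fun do rewrite !mxE.
  exact: sM.
by move=> x Dx; rewrite /invmx uM// [RHS]mxE.
Qed.

Lemma smooth_subset D D' f : D `<=` D' -> smooth D' f -> smooth D f.
Proof.
move=> DD'; elim => {f}.
- by move=> c; exact: smooth_cst.
- by move=> j; exact: smooth_coord.
- by move=> *; exact: smooth_flat.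
- by move=> *; exact: smoothD.
- by move=> *; exact: smoothM.
- by move=> f sf IH fD; apply: smoothV => // x /DD'; exact: fD.
Qed.

Lemma smooth_dilate f (r : R) (x0 : E) : smooth setT f ->
  smooth setT (fun x => f (r *: (x - x0))).
Proof.
elim => {f}.
- by move=> c; exact: smooth_cst.
- move=> j; under eq_fun do rewrite !mxE; apply: smoothM; first exact: smooth_cst.
  by apply: smoothB; [exact: smooth_coord|exact: smooth_cst].
- move=> c a b k j c0.
  have -> : (fun x => flat c k (a * (r *: (x - x0)) ord0 j + b)) =
    (fun x => flat c k ((a * r) * x ord0 j + (b - a * r * x0 ord0 j))).
    by apply/funext => x; rewrite !mxE; congr (flat _ _ _); ring.
  exact: smooth_flat.
- by move=> *; exact: smoothD.
- by move=> *; exact: smoothM.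
- by move=> f sf IH fD; apply: smoothV => // x _; exact: fD.
Qed.

Lemma differentiable_flat (c a b : R) k j (x : E) : 0 < c ->
  differentiable (fun x : E => flat c k (a * x ord0 j + b)) x.
Proof.
move=> c0; apply: (@differentiable_comp _ _ _ _ (fun x : E => a * x ord0 j + b)
  (flat c k)).
  apply: differentiableD; last exact: differentiable_cst.
  apply: (@differentiableM _ _ (cst a) (fun x : E => x ord0 j)).
    exact: differentiable_cst.
  exact: differentiable_coord.
apply/derivable1_diffP; have := is_derive_flat k (a * x ord0 j + b) c0.
by move=> [].
Qed.

Lemma smooth_differentiable D f : smooth D f ->
  forall x, D x -> differentiable f x.
Proof.
elim => {f}.
- by move=> c x _; exact: differentiable_cst.
- by move=> j x _; exact: differentiable_coord.
- by move=> c a b k j c0 x _; exact: differentiable_flat.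
- by move=> f g _ df _ dg x Dx; apply: differentiableD; [exact: df|exact: dg].
- by move=> f g _ df _ dg x Dx; apply: differentiableM; [exact: df|exact: dg].
- by move=> f _ df fD x Dx; apply: differentiableV; [exact: df|exact: fD].
Qed.

Lemma derive_coord (i j : 'I_d) (x : E) :
  'D_(delta_mx ord0 j) (fun x : E => x ord0 i) x = (i == j)%:R.
Proof.
rewrite /derive; apply: cvg_lim => //.
apply: (cvg_trans _ (@cvg_cst R ((i == j)%:R : R) _ _ _)).
apply: near_eq_cvg; near=> h.
rewrite /= !mxE eqxx /= addrK /GRing.scale /= mulKf//.
by near: h; exact: nbhs_dnbhs_neq.
Unshelve. all: first [exact _ | by end_near].
Qed.

(** By induction on the construction of [f]; the formula for the derivative of a
    flat function stays inside the class. *)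
Lemma smooth_partial D f j : smooth D f ->
  exists2 g, smooth D g & forall x, D x -> partial j f x = g x.
Proof.
elim => {f}.
- move=> c; exists (fun=> 0); first exact: smooth_cst.
  by move=> x _; rewrite /partial derive_cst.
- move=> i; exists (fun=> (i == j)%:R); first exact: smooth_cst.
  by move=> x _; rewrite /partial derive_coord.
- move=> c a b k i c0.
  exists (fun x => (c * flat c k.+2 (a * x ord0 i + b) -
    k%:R * flat c k.+1 (a * x ord0 i + b)) * (a * (i == j)%:R)).
    apply: smoothM; last exact: smooth_cst.
    by apply: smoothB; apply: smoothM; [exact: smooth_cst|exact: smooth_flat|
      exact: smooth_cst|exact: smooth_flat].
  move=> x _; rewrite /partial deriveE; last exact: differentiable_flat.
  have dl : differentiable (fun x : E => a * x ord0 i + b) x.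
    apply: differentiableD; last exact: differentiable_cst.
    apply: (@differentiableM _ _ (cst a) (fun x : E => x ord0 i)).
      exact: differentiable_cst.
    exact: differentiable_coord.
  have [df dfE] := is_derive_flat k (a * x ord0 i + b) c0.
  have -> : (fun x : E => flat c k (a * x ord0 i + b)) =
    flat c k \o (fun x : E => a * x ord0 i + b) by [].
  rewrite diff_comp//; last exact/derivable1_diffP.
  rewrite /= deriv1E// derive1E dfE -deriveE//.
  rewrite /GRing.scale /= mulrC; congr (_ * _).
  have -> : (fun x : E => a * x ord0 i + b) =
    (fun x : E => a * x ord0 i) + cst b by [].
  rewrite deriveD ?derive_cst ?addr0.
  - have -> : (fun x : E => a * x ord0 i) = a \*o (fun x : E => x ord0 i) by [].
    rewrite deriveMl ?derive_coord//.
    exact/diff_derivable/differentiable_coord.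
  - apply/diff_derivable/(@differentiableM _ _ (cst a) (fun x : E => x ord0 i)).
      exact: differentiable_cst.
    exact: differentiable_coord.
  - exact/diff_derivable/differentiable_cst.
- move=> f g sf [f' sf' ff'] sg [g' sg' gg'].
  exists (fun x => f' x + g' x); first exact: smoothD.
  move=> x Dx; rewrite -ff'// -gg'//; apply: deriveD.
    exact/diff_derivable/(smooth_differentiable sf).
  exact/diff_derivable/(smooth_differentiable sg).
- move=> f g sf [f' sf' ff'] sg [g' sg' gg'].
  exists (fun x => f x * g' x + g x * f' x).
    by apply: smoothD; exact: smoothM.
  move=> x Dx; rewrite -ff'// -gg'//; apply: deriveM.
    exact/diff_derivable/(smooth_differentiable sf).
  exact/diff_derivable/(smooth_differentiable sg).
- move=> f sf [f' sf' ff'] fD.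
  exists (fun x => - (f x)^-1 ^+ 2 * f' x).
    apply: smoothM => //.
    have -> : (fun x => - (f x)^-1 ^+ 2) = (fun x => 0 - (f x)^-1 ^+ 2).
      by apply/funext => x; rewrite sub0r.
    apply: smoothB; first exact: smooth_cst.
    by apply: smoothX; exact: smoothV.
  move=> x Dx; rewrite -ff'// /partial deriveV; last 2 first.
  - exact: fD.
  - exact/diff_derivable/(smooth_differentiable sf).
  by rewrite /GRing.scale /= exprVn.
Qed.

Lemma smooth_continuous D f : smooth D f ->
  forall x, D x -> {for x, continuous f}.
Proof.
by move=> sf x Dx; exact/differentiable_continuous/(smooth_differentiable sf).
Qed.

Lemma smooth_derivable D f v : smooth D f ->
  forall x, D x -> derivable f x v.
Proof.
by move=> sf x Dx; exact/diff_derivable/(smooth_differentiable sf).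
Qed.

Lemma smoothT_continuous f : smooth setT f -> continuous f.
Proof. by move=> sf x; exact: (@smooth_continuous setT _ sf x I). Qed.

Lemma smoothT_measurable f D : smooth setT f -> measurable_fun D f.
Proof. by move=> /smoothT_continuous; exact: continuousT_measurable_rV. Qed.

Lemma smoothT_derivable f v x : smooth setT f -> derivable f x v.
Proof. by move=> sf; exact: (@smooth_derivable setT _ _ sf x I). Qed.

Lemma smoothT_partial f j : smooth setT f -> smooth setT (partial j f).
Proof.
move=> /(smooth_partial j)[g sg gE]; suff -> : partial j f = g by [].
by apply/funext => x; exact: gE.
Qed.

Lemma smoothT_smooth_on f : smooth setT f -> smooth_on setT f.
Proof.
move=> sf s x _; have si : smooth setT (iter_partial s f).
  by elim: s => // j s IH /=; exact: smoothT_partial.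
split; first exact: smoothT_continuous.
by move=> j; exact: smoothT_derivable.
Qed.

End smooth_class.

(** * Test functions *)

Section test_functions.
Context {R : realType} {d : nat}.
Local Notation E := 'rV[R]_d.

Lemma compact_cbox (a b : 'I_d -> R) : compact (cbox a b : set E).
Proof.
rewrite (_ : cbox a b = [set v | forall i, `[a i, b i]%classic (v ord0 i)]).
  by apply: (@rV_compact R d (fun i => `[a i, b i]%classic)) => i; exact: segment_compact.
by apply/seteqP; split => x h j; have := h j; rewrite /= in_itv.
Qed.

Lemma closed_cbox (a b : 'I_d -> R) : closed (cbox a b : set E).
Proof. by apply: compact_closed; [exact: norm_hausdorff|exact: compact_cbox]. Qed.

Lemma box_cbox (a b : 'I_d -> R) : box a b `<=` (cbox a b : set E).
Proof. by move=> x h j; have /andP[? ?] := h j; apply/andP; split; exact: ltW. Qed.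

Lemma test_functionP (A : set E) (phi : E -> R) a b : smooth setT phi ->
  (forall x, ~ box a b x -> phi x = 0) -> cbox a b `<=` A ->
  test_function A phi.
Proof.
move=> sphi phi0 abA.
have sub : closure [set x | phi x != 0] `<=` cbox a b.
  rewrite [X in _ `<=` X]((closure_id _).1 (@closed_cbox a b)).
  apply: closure_subset => x /= /eqP phix; apply: box_cbox.
  by apply: contrapT => /phi0.
split; first exact: smoothT_smooth_on.
- by apply: (subclosed_compact _ (@compact_cbox a b) sub); exact: closed_closure.
- exact: subset_trans sub abA.
Qed.

Definition bump (c : R) (a b : 'I_d -> R) (x : E) : R :=
  \prod_j (flat c 0 (x ord0 j - a j) * flat c 0 (b j - x ord0 j)).

Lemma smooth_bump c a b D : 0 < c -> smooth D (bump c a b).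
Proof.
move=> c0; apply: smooth_prod => j _; apply: smoothM.
  have -> : (fun x : E => flat c 0 (x ord0 j - a j)) =
            (fun x : E => flat c 0 (1 * x ord0 j + - a j)).
    by apply/funext => x; rewrite mul1r.
  exact: smooth_flat.
have -> : (fun x : E => flat c 0 (b j - x ord0 j)) =
          (fun x : E => flat c 0 ((-1) * x ord0 j + b j)).
  by apply/funext => x; rewrite mulN1r addrC.
exact: smooth_flat.
Qed.

Lemma bump_ge0 c a b x : 0 <= bump c a b x.
Proof. by apply: prodr_ge0 => j _; rewrite mulr_ge0// flat_ge0. Qed.

Lemma bump_gt0 c a b x : box a b x -> 0 < bump c a b x.
Proof.
move=> abx; apply: prodr_gt0 => j _; have /andP[h1 h2] := abx j.
by rewrite mulr_gt0// flat_gt0 subr_gt0.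
Qed.

Lemma bump_eq0 c a b x : ~ box a b x -> bump c a b x = 0.
Proof.
move=> /existsNP[j /negP]; rewrite negb_and -!leNgt => h.
rewrite /bump (bigD1 j)//= /flat !subr_gt0 !ltNge.
by case/orP: h => -> /=; rewrite ?mul0r ?mulr0 ?mul0r.
Qed.

Lemma flat_le1 c (t : R) : 0 <= c -> flat c 0 t <= 1.
Proof.
move=> c0; rewrite /flat; case: ifP => // t0; rewrite expr0 mul1r -expR0.
by rewrite ler_expR mulNr oppr_le0 mulr_ge0// invr_ge0 ltW.
Qed.

Lemma bump_le1 c a b x : 0 <= c -> bump c a b x <= 1.
Proof.
move=> c0; apply: prodr_ile1 => j _.
by rewrite mulr_ge0 ?flat_ge0//= mulr_ile1 ?flat_ge0 ?flat_le1.
Qed.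

(** On the box every factor exp (-1 / ((n + 1) t)) tends to 1. *)
Lemma cvg_bump a b (x : E) :
  bump n.+1%:R^-1 a b x @[n --> \oo] --> (\1_(box a b) x : R).
Proof.
rewrite indicE; case: (boolP (x \in box a b)) => [/set_mem abx|/negP xab].
  suff : \prod_j (flat n.+1%:R^-1 0 (x ord0 j - a j) *
      flat n.+1%:R^-1 0 (b j - x ord0 j)) @[n --> \oo] --> \prod_(j < d) (1 : R).
    by rewrite prodr_const expr1n.
  have cf (t : R) : 0 < t -> flat n.+1%:R^-1 0 t @[n --> \oo] --> (1 : R).
    move=> t0; rewrite /flat t0; under eq_fun do rewrite expr0 mul1r.
    suff : expR (- n.+1%:R^-1 * t^-1) @[n --> \oo] --> expR (- 0 * t^-1).
      by rewrite oppr0 mul0r expR0.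
    apply: (@cvg_comp _ _ _ _ expR _ (nbhs (- 0 * t^-1))).
      by apply: cvgM; [apply: cvgN; exact: cvg_harmonic|exact: cvg_cst].
    exact: continuous_expR.
  have cp (s : seq 'I_d) : \prod_(j <- s) (flat n.+1%:R^-1 0 (x ord0 j - a j) *
      flat n.+1%:R^-1 0 (b j - x ord0 j)) @[n --> \oo] --> \prod_(j <- s) (1 : R).
    elim: s => [|j s IH].
      by under eq_fun do rewrite big_nil; rewrite big_nil; exact: cvg_cst.
    under eq_fun do rewrite big_cons; rewrite big_cons; apply: cvgM => //.
    have /andP[h1 h2] := abx j.
    suff : flat n.+1%:R^-1 0 (x ord0 j - a j) * flat n.+1%:R^-1 0 (b j - x ord0 j)
      @[n --> \oo] --> (1 * 1 : R) by rewrite mulr1.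
    by apply: cvgM; apply: cf; rewrite subr_gt0.
  exact: cp.
have -> : (fun n => bump n.+1%:R^-1 a b x) = (fun=> 0).
  by apply/funext => n; apply: bump_eq0 => abx; apply: xab; rewrite inE.
exact: cvg_cst.
Qed.

Lemma cbox_sub a b a' b' : (exists x : E, box a b x) ->
  (box a b : set E) `<=` box a' b' -> (cbox a b : set E) `<=` cbox a' b'.
Proof.
move=> [x0 abx0] sub x abx j.
(* the segment from x to a point of the open box lies in the open box *)
have sx (t : R) : 0 < t < 1 -> a' j < x ord0 j + t * (x0 ord0 j - x ord0 j) < b' j.
  move=> /andP[t0 t1]; have := sub (x + t *: (x0 - x)).
  rewrite /box /= => /(_ _ j); rewrite !mxE; apply => k; rewrite !mxE.
  have /andP[h1 h2] := abx k; have /andP[h3 h4] := abx0 k.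
  have -> : x ord0 k + t * (x0 ord0 k - x ord0 k) =
    (1 - t) * x ord0 k + t * x0 ord0 k by ring.
  by apply/andP; split; nra.
have : `[a' j, b' j]%classic (x ord0 j).
  have cl : closed `[a' j, b' j]%classic by exact: itv_closed.
  apply: (@closed_cvg _ _ \oo _ (fun n => x ord0 j + n.+2%:R^-1 * (x0 ord0 j - x ord0 j))
    _ cl).
    apply: nearW => n; rewrite /= in_itv /=.
    have n01 : 0 < (n.+2%:R^-1 : R) < 1.
      by apply/andP; split; [rewrite invr_gt0|rewrite invf_lt1 ?ltr1n].
    by have /andP[? ?] := sx _ n01; apply/andP; split; exact: ltW.
  suff : x ord0 j + n.+2%:R^-1 * (x0 ord0 j - x ord0 j) @[n --> \oo] -->
      x ord0 j + 0 * (x0 ord0 j - x ord0 j) by rewrite mul0r addr0.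
  apply: cvgD; first exact: cvg_cst.
  apply: cvgM; last exact: cvg_cst.
  by have := @cvg_harmonic R; rewrite -cvg_shiftS.
by rewrite /= in_itv.
Qed.

End test_functions.

(** * Integration by parts *)

Section integration_by_parts.
Context {R : realType} {d : nat}.
Local Notation E := 'rV[R]_d.
Local Notation mu := (lebesgue_rV R d).

(** Compact support is recorded by any closed bounded set outside of which the
    function vanishes, rather than by the closure of the set where it is nonzero. *)
Definition C1c (K : set E) (phi : E -> R) :=
  [/\ closed K, (exists M : R, forall x, K x -> `|x| <= M),
      (forall x, ~ K x -> phi x = 0), continuous phi &
      forall j, (forall x : E, derivable phi x (delta_mx ord0 j : E)) /\
                continuous (partial j phi)].

Lemma test_function_C1c (A : set E) phi : test_function A phi ->
  exists2 K, C1c K phi & K `<=` A.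
Proof.
move=> [sphi cK KA]; exists (closure [set x | phi x != 0]) => //; split.
- exact: closed_closure.
- have [M [_ hM]] := compact_bounded cK; exists (M + 1) => x Kx.
  by apply: (hM (M + 1)) => //; rewrite ltrDl.
- by move=> x nKx; apply: contrapT => /eqP phix; apply: nKx; exact: subset_closure.
- by move=> x; have [] := sphi [::] x I.
- move=> j; split => x; first by have [_] := sphi [::] x I; apply.
  by have [] := sphi [:: j] x I.
Qed.

Lemma near_rVS (x : E) (P Q : E -> Prop) : (forall y, P y -> Q y) ->
  (\forall y \near x, P y) -> \forall y \near x, Q y.
Proof. by move=> PQ; apply: (@filterS _ (nbhs x) (nbhs_filter x)). Qed.

Lemma near_open (A : set E) (x : E) : open A -> A x -> \forall y \near x, A y.
Proof. by move=> oA Ax; apply: open_nbhs_nbhs. Qed.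

Lemma near_notin (K : set E) (x : E) : closed K -> ~ K x ->
  \forall y \near x, ~ K y.
Proof. by move=> cK Kx; apply: (@near_open (~` K)) => //; exact: closed_openC. Qed.

Lemma near_eq_continuous (f g : E -> R) (x : E) : (\forall y \near x, f y = g y) ->
  {for x, continuous g} -> {for x, continuous f}.
Proof.
move=> fg cg; rewrite /prop_for /continuous_at (nbhs_singleton fg).
apply: (cvg_trans _ cg); apply: (@near_eq_cvg _ _ (nbhs x) (nbhs_filter x)).
by apply: near_rVS fg => y ->.
Qed.

Lemma C1c_partial0 (K : set E) phi j x : C1c K phi -> ~ K x ->
  partial j phi x = 0.
Proof.
move=> [cK _ phi0 _ _] Kx; rewrite /partial (@near_eq_derive _ _ _ phi (cst 0)) ?derive_cst//.
by apply: near_rVS (near_notin cK Kx) => y /phi0.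
Qed.

Lemma continuous_mul_cutoff (A K : set E) (h phi : E -> R) : open A -> closed K ->
  K `<=` A -> (forall x, ~ K x -> phi x = 0) -> continuous phi ->
  (forall x, A x -> {for x, continuous h}) -> continuous (fun x => h x * phi x).
Proof.
move=> oA cK KA phi0 cphi ch x.
have [Ax|Ax] := pselect (A x).
  by apply: (@cvgM _ _ _ (nbhs_filter x)); [exact: ch|exact: cphi].
have Kx : ~ K x by move=> /KA.
apply: (@near_eq_continuous _ (cst 0)); last exact: cst_continuous.
by apply: near_rVS (near_notin cK Kx) => y /phi0 ->; rewrite mulr0.
Qed.

Lemma integrable_cutoff (A K : set E) (h phi : E -> R) M : open A -> closed K ->
  K `<=` A -> (forall x, ~ K x -> phi x = 0) -> continuous phi ->
  (forall x, K x -> `|x| <= M) ->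
  (forall x, A x -> {for x, continuous h}) ->
  mu.-integrable setT (EFin \o (fun x => h x * phi x)).
Proof.
move=> oA cK KA phi0 cphi KM ch.
apply: (@continuous_support_integrable _ _ _ M).
  exact: (continuous_mul_cutoff oA cK KA).
move=> x Mx; rewrite phi0 ?mulr0// => /KM.
by rewrite leNgt Mx.
Qed.

(** The product v phi extends by 0 to a function of class C^1 on the whole space,
    and the integral of its derivative is 0. *)
Lemma integration_by_parts_cutoff (A K : set E) (v phi : E -> R) j : open A ->
  C1c K phi -> K `<=` A ->
  (forall x, A x -> [/\ {for x, continuous v}, derivable v x (delta_mx ord0 j : E) &
     {for x, continuous (partial j v)}]) ->
  \int[mu]_x (v x * partial j phi x) = - \int[mu]_x (partial j v x * phi x).
Proof.
move=> oA Kphi KA Cv; have [cK [M KM] phi0 cphi dphi] := Kphi.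
have [dpj cpj] := dphi j.
pose g x := v x * phi x.
have g0 x : ~ K x -> \forall y \near x, g y = 0.
  by move=> Kx; apply: near_rVS (near_notin cK Kx) => y /phi0; rewrite /g => ->; rewrite mulr0.
have dg x : is_derive x (delta_mx ord0 j : E) g
    (v x * partial j phi x + partial j v x * phi x).
  have [Ax|Ax] := pselect (A x).
    have [_ dv _] := Cv x Ax.
    have := @is_deriveM _ _ v phi x (delta_mx ord0 j : E) _ _ (DeriveDef dv erefl)
      (DeriveDef (dpj x) erefl).
    by move=> /is_derive_eq; apply; rewrite /GRing.scale /= [phi x * _]mulrC.
  have Kx : ~ K x by move=> /KA.
  rewrite (C1c_partial0 j Kphi Kx) phi0// !mulr0 addr0.
  apply: (@near_eq_is_derive _ _ _ (cst 0 : E -> R)).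
  by apply: near_rVS (g0 x Kx) => y ->.
have pg : partial j g = fun x => v x * partial j phi x + partial j v x * phi x.
  by apply/funext => x; rewrite /partial derive_val.
have I1 : mu.-integrable setT (EFin \o (fun x => v x * partial j phi x)).
  apply: (integrable_cutoff oA cK KA _ cpj KM) => [x Kx|x /Cv[]//].
  exact: (C1c_partial0 j Kphi Kx).
have I2 : mu.-integrable setT (EFin \o (fun x => partial j v x * phi x)).
  by apply: (integrable_cutoff oA cK KA phi0 cphi KM) => x /Cv[].
have cg : continuous g.
  by apply: (continuous_mul_cutoff oA cK KA phi0 cphi) => x /Cv[].
have cdg : continuous (partial j g).
  rewrite pg => x; apply: (@cvgD _ _ _ _ (nbhs_filter x)).
    apply: (continuous_mul_cutoff oA cK KA _ cpj) => [y Ky|y /Cv[]//].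
    exact: (C1c_partial0 j Kphi Ky).
  by apply: (continuous_mul_cutoff oA cK KA phi0 cphi) => y /Cv[].
have g0' (x : E) : M < `|x| -> g x = 0.
  by move=> Mx; rewrite /g phi0 ?mulr0// => /KM; rewrite leNgt Mx.
have h : (\int[mu]_x (partial j g x)%:E = 0)%E.
  exact: (integral_derive_eq0 cg (fun x => @ex_derive _ _ _ _ _ _ _ (dg x)) cdg g0').
rewrite pg in h; apply/eqP; rewrite -subr_eq0 opprK -RintegralD//.
by rewrite /Rintegral h.
Qed.

Lemma Rintegral_support (B K : set E) (f : E -> R) : K `<=` B ->
  (forall x, ~ K x -> f x = 0) -> \int[mu]_(x in B) f x = \int[mu]_x f x.
Proof.
move=> KB f0; rewrite Rintegral_mkcond; congr (Rintegral _ _ _).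
apply/funext => x; rewrite patchE; case: ifPn => // /negP xB.
by rewrite f0// => /KB Bx; apply: xB; rewrite inE.
Qed.

End integration_by_parts.

(** * The fundamental lemma of the calculus of variations *)

Section fundamental_lemma.
Context {R : realType} {d : nat}.
Local Notation E := 'rV[R]_d.
Local Notation mu := (lebesgue_rV R d).

Lemma box_empty (a b : 'I_d -> R) :
  ~ (exists x : E, box a b x) -> box a b = set0 :> set E.
Proof. by move=> n; apply/seteqP; split => // x abx; apply: n; exists x. Qed.

(** Bumps converge to the indicator of a box, so that the hypothesis extends
    from test functions to indicators of boxes, and then to indicators of all
    measurable sets, the boxes being stable under intersection. *)
Lemma fundamental_lemma_box (A : set E) (g : E -> R) (a b : 'I_d -> R) :
  cbox a b `<=` A -> mu.-integrable (box a b) (EFin \o g) ->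
  (forall phi, test_function A phi -> \int[mu]_(x in A) (g x * phi x) = 0) ->
  {ae mu, forall x, box a b x -> g x = 0}.
Proof.
move=> abA Ig g0; set B := box a b.
have mB : measurable B by exact: measurable_box.
have mg : measurable_fun B g by apply/measurable_EFinP; case/integrableP: Ig.
have box0 a' b' : (box a' b' : set E) `<=` B ->
    (\int[mu]_(x in box a' b') (g x)%:E = 0)%E.
  move=> sub; have [ne|/box_empty ->] := pselect (exists x : E, box a' b' x);
    last by rewrite integral_set0.
  have csub := subset_trans (cbox_sub ne sub) abA.
  have mB' : measurable (box a' b' : set E) by exact: measurable_box.
  have Ig' : mu.-integrable (box a' b') (EFin \o g) by exact: integrableS Ig.
  pose phi n : E -> R := bump n.+1%:R^-1 a' b'.
  have n0 n : 0 < n.+1%:R^-1 :> R by rewrite invr_gt0.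
  have mphi n : measurable_fun (box a' b') (phi n).
    by apply: smoothT_measurable; exact: (smooth_bump a' b' setT (n0 n)).
  have Iphi n : (\int[mu]_(x in box a' b') (g x * phi n x)%:E = 0)%E.
    have It : mu.-integrable (box a' b') (EFin \o (fun x => g x * phi n x)).
      apply: (le_integrable mB' _ _ Ig').
        by apply/measurable_EFinP/measurable_funM => //; exact: measurable_funS mg.
      move=> x _; rewrite lee_fin normrM ler_piMr//.
      by rewrite ger0_norm ?bump_ge0// bump_le1// ltW.
    have tphi : test_function A (phi n).
      by apply: (@test_functionP _ _ A _ a' b') => //; [exact: smooth_bump|
        move=> x; exact: bump_eq0].
    rewrite -(fineK (integrable_fin_num mB' It)); congr EFin.
    rewrite -/(Rintegral mu (box a' b') (fun x => g x * phi n x)).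
    have phi0 x : ~ box a' b' x -> g x * phi n x = 0.
      by move=> /(bump_eq0 n.+1%:R^-1) h; rewrite /phi h mulr0.
    rewrite (Rintegral_support (@subset_refl _ _) phi0) -(g0 _ tphi).
    rewrite [RHS](Rintegral_support _ phi0)//.
    exact: subset_trans (@box_cbox _ _ a' b') csub.
  have mEg : measurable_fun (box a' b') (EFin \o g) by case/integrableP: Ig'.
  have mEgphi n : measurable_fun (box a' b') (fun x => (g x * phi n x)%:E).
    by apply/measurable_EFinP/measurable_funM => //; exact: measurable_funS mg.
  have cphi : {ae mu, forall x, box a' b' x ->
      (g x * phi n x)%:E @[n --> \oo] --> (EFin \o g) x}.
    apply: aeW => x abx; apply/fine_cvgP; split; first exact: nearW.
    suff : g x * phi n x @[n --> \oo] --> g x * \1_(box a' b') x.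
      by rewrite indicE mem_set// mulr1.
    by apply: cvgM; [exact: cvg_cst|exact: cvg_bump].
  have dom : {ae mu, forall (x : E) n, box a' b' x ->
      (`|(g x * phi n x)%:E| <= `|(EFin \o g) x|)%E}.
    apply: aeW => x n _; rewrite lee_fin normrM ler_piMr//.
    by rewrite ger0_norm ?bump_ge0// bump_le1// ltW.
  have Iabs : mu.-integrable (box a' b') (abse \o (EFin \o g)).
    exact: integrable_abse.
  have [_ _] := dominated_convergence mB' mEgphi mEg cphi Iabs dom.
  have -> : [sequence (\int[mu]_(x in box a' b') (g x * phi n x)%:E)%E]_n = (fun=> 0%E).
    by apply/funext => n; exact: Iphi.
  by move=> /(cvg_unique _ (cvg_cst 0%E)) => <-.
have sub0 : forall S, measurable S ->
    (\int[mu]_(x in B `&` S) (g x)%:E = 0)%E.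
  rewrite (@measurable_boxes R d); apply: dynkin_induction.
  - exact: measurable_boxes.
  - exact: boxes_setI.
  - by rewrite setIT; exact: box0.
  - move=> _ [a' [b' ->]].
    have [a'' [b'' e]] : boxes (B `&` box a' b').
      by apply: boxes_setI; [exists a, b|exists a', b'].
    by rewrite e; apply: box0; rewrite -e; exact: subIsetl.
  - move=> S mS S0.
    have mBS : measurable (B `&` S) by exact: measurableI.
    have mBC : measurable (B `&` ~` S) by apply: measurableI => //; exact: measurableC.
    have BE : B = (B `&` S) `|` (B `&` ~` S) by rewrite -setIUr setUCr setIT.
    have := box0 a b (@subset_refl _ _); rewrite -/B [X in integral _ X]BE.
    rewrite integral_setU_EFin//.
    + by rewrite S0 add0e.
    + by rewrite -BE.
    + by apply/disj_setPS => x [[_ Sx] [_ nSx]].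
  - move=> F mF tF F0; rewrite setI_bigcupr integral_bigcup//.
    + by apply: eseries0 => n _ _; exact: F0.
    + by apply: trivIset_setIl.
    + by move=> k; exact: measurableI.
    + apply: (integrableS mB _ _ Ig); first by apply: bigcupT_measurable => k; exact: measurableI.
      by move=> x [k _ []].
have h : ae_eq mu B (EFin \o g) (cst 0%E).
  apply: integral_ae_eq => //.
  move=> S SB mS; rewrite integral0 -[S](setIidr SB).
  exact: sub0.
by apply: filterS h => x /[apply] [] /= [].
Qed.

(** The open set is a countable union of cubes. *)
Lemma fundamental_lemma (A : set E) (g : E -> R) : open A ->
  (forall a b, cbox a b `<=` A -> mu.-integrable (box a b) (EFin \o g)) ->
  (forall phi, test_function A phi -> \int[mu]_(x in A) (g x * phi x) = 0) ->
  {ae mu, forall x, A x -> g x = 0}.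
Proof.
move=> oA Ig g0; have [c [r [P [PA AE]]]] := open_cubes oA.
have ae1 (n : nat) : {ae mu, forall x, forall p, unpickle n = Some p -> P p ->
    cube (c p) (r p) x -> g x = 0}.
  case: (unpickle n) => [p|]; last exact: aeW.
  have [Pp|nPp] := pselect (P p); last by apply: aeW => x _ [<-] /nPp.
  have := fundamental_lemma_box (PA p Pp) (Ig _ _ (PA p Pp)) g0.
  by apply: filterS => x h _ [<-] _; exact: h.
have := ae_foralln ae1.
apply: filterS => x h; rewrite AE => -[p Pp xp].
exact: (h (pickle p) p (pickleK p)).
Qed.

End fundamental_lemma.

(** * Square integrable functions and weak gradients *)

Section weak_gradients.
Context {R : realType} {d : nat}.
Local Notation E := 'rV[R]_d.
Local Notation mu := (lebesgue_rV R d).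
Implicit Types (A B : set E) (f g : E -> R).

Lemma L2_measurable A f : L2 A f -> measurable_fun A f. Proof. by case. Qed.

Lemma L2_sqr_integrable A f : measurable A -> L2 A f ->
  mu.-integrable A (EFin \o (fun x => f x ^+ 2)).
Proof.
move=> mA [mf ff]; apply/integrableP; split.
  by apply/measurable_EFinP; exact: measurable_funX.
apply: le_lt_trans ff; apply: ge0_le_integral => //.
- by do 2 apply: measurableT_comp => //; exact: measurable_funX.
- by apply/measurable_EFinP; exact: measurable_funX.
- by move=> x _ /=; rewrite ger0_norm// sqr_ge0.
Qed.

Lemma L2_mul_integrable A f g : measurable A -> L2 A f -> L2 A g ->
  mu.-integrable A (EFin \o (fun x => f x * g x)).
Proof.
move=> mA lf lg.
have If := L2_sqr_integrable mA lf; have Ig := L2_sqr_integrable mA lg.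
apply: (le_integrable mA _ _ (integrableD mA If Ig)).
  by apply/measurable_EFinP/measurable_funM; exact: L2_measurable.
move=> x _; rewrite lee_fin normrM [leRHS]ger0_norm ?addr_ge0 ?sqr_ge0//.
rewrite -(real_normK (num_real (f x))) -(real_normK (num_real (g x))).
by have := normr_ge0 (f x); have := normr_ge0 (g x); nra.
Qed.

Lemma L2_sub A B f : measurable A -> measurable B -> A `<=` B -> L2 B f -> L2 A f.
Proof.
move=> mA mB AB [mf ff]; split; first exact: measurable_funS mf.
apply: le_lt_trans ff; apply: ge0_subset_integral => //.
- by apply/measurable_EFinP; exact: measurable_funX.
- by move=> x _; rewrite lee_fin sqr_ge0.
Qed.

Lemma L2_le A f g : measurable A -> measurable_fun A f ->
  mu.-integrable A (EFin \o g) -> (forall x, A x -> f x ^+ 2 <= g x) -> L2 A f.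
Proof.
move=> mA mf /integrableP[mg gfin] fg; split => //.
apply: le_lt_trans gfin; apply: ge0_le_integral => //.
- by move=> x _; rewrite lee_fin sqr_ge0.
- by apply/measurable_EFinP; exact: measurable_funX.
- exact: measurableT_comp.
- by move=> x Ax; rewrite lee_fin (le_trans (fg x Ax))// ler_norm.
Qed.

Lemma L2_bounded A f (B : R) : measurable A -> (mu A < +oo)%E ->
  measurable_fun A f -> (forall x, A x -> `|f x| <= B) -> L2 A f.
Proof.
move=> mA Afin mf fB; apply: (@L2_le A f (fun=> B ^+ 2)) => //.
  by apply: (@integrable_bounded _ _ _ _ `|B ^+ 2|).
move=> x /fB fx; rewrite -real_normK ?num_real// lerXn2r ?nnegrE//.
exact: le_trans fx.
Qed.

Lemma L2_sum A f g : measurable A -> L2 A f -> L2 A g -> L2 A (fun x => f x + g x).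
Proof.
move=> mA lf lg; have If := L2_sqr_integrable mA lf; have Ig := L2_sqr_integrable mA lg.
apply: (L2_le mA _ (integrableZl mA 2 (integrableD mA If Ig))).
  by apply: measurable_funD; exact: L2_measurable.
by move=> x _ /=; have := sqr_ge0 (f x - g x); rewrite !expr2; lra.
Qed.

Lemma L2_opp A f : L2 A f -> L2 A (fun x => - f x).
Proof.
move=> [mf ff]; split; first exact: measurableT_comp.
by under eq_integral do rewrite sqrrN.
Qed.

Lemma L2_mul_bounded A f g (B : R) : measurable A -> L2 A f ->
  measurable_fun A g -> (forall x, A x -> `|g x| <= B) ->
  L2 A (fun x => g x * f x).
Proof.
move=> mA lf mg gB; have If := L2_sqr_integrable mA lf.
apply: (L2_le mA _ (integrableZl mA (B ^+ 2) If)).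
  by apply: measurable_funM => //; exact: L2_measurable.
move=> x /gB gx /=; rewrite exprMn ler_wpM2r ?sqr_ge0//.
rewrite -real_normK ?num_real// lerXn2r ?nnegrE//; exact: le_trans gx.
Qed.

(** The constant function 1 is square integrable on [B]. *)
Lemma L2_integrable A B f : measurable A -> L2 A f -> measurable B -> B `<=` A ->
  (mu B < +oo)%E -> mu.-integrable B (EFin \o f).
Proof.
move=> mA lf mB BA Bfin.
have lB := L2_sub mB mA BA lf.
have l1 : L2 B (fun=> 1) by apply: (@L2_bounded _ _ 1) => // x _; rewrite normr1.
have := L2_mul_integrable mB lB l1.
by under [X in _ \o X]eq_fun do rewrite mulr1.
Qed.

Lemma C1c_L2 (K : set E) phi A : measurable A -> C1c K phi ->
  L2 A phi /\ forall j, L2 A (partial j phi).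
Proof.
move=> mA Kphi; have [cK [M KM] phi0 cphi dphi] := Kphi.
have h (f : E -> R) : continuous f -> (forall x, ~ K x -> f x = 0) -> L2 A f.
  move=> cf f0; apply: (@L2_sub _ setT) => //.
  apply: (@L2_le setT f (fun x => f x * f x)) => //.
  - exact: continuousT_measurable_rV.
  - apply: (@continuous_support_integrable _ _ _ M).
      by move=> x; apply: (@cvgM _ _ _ (nbhs_filter x)); exact: cf.
    by move=> x Mx; rewrite f0 ?mulr0// => /KM; rewrite leNgt Mx.
split; first exact: h.
by move=> j; apply: h => [|x Kx]; [have [_] := dphi j|exact: (C1c_partial0 j Kphi)].
Qed.

Lemma dot_integrable A (g h : E -> E) : measurable A ->
  (forall j, L2 A (fun x => g x ord0 j)) -> (forall j, L2 A (fun x => h x ord0 j)) ->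
  mu.-integrable A (EFin \o (fun x => dot (g x) (h x))).
Proof.
move=> mA lg lh.
have -> : EFin \o (fun x => dot (g x) (h x)) =
    (fun x => \sum_j (EFin \o (fun x => (g x ord0 j * h x ord0 j)%R)) x)%E.
  by apply/funext => x /=; rewrite /dot -sumEFin.
by apply: integrable_sum => // j _; exact: L2_mul_integrable.
Qed.

(** The difference of two weak gradients is orthogonal to all test functions. *)
Lemma weak_gradient_unique A v (g1 g2 : E -> E) : open A -> weak_gradient A v g1 ->
  weak_gradient A v g2 -> {ae mu, forall x, A x -> g1 x = g2 x}.
Proof.
move=> oA [l1 h1] [l2 h2]; have mA := open_measurable_rV oA.
have aej (j : 'I_d) : {ae mu, forall x, A x -> g1 x ord0 j - g2 x ord0 j = 0}.
  apply: fundamental_lemma => //.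
    move=> a b abA; apply: (@L2_integrable A) => //.
    - by apply: L2_sum => //; exact: L2_opp.
    - exact: measurable_box.
    - exact: subset_trans (@box_cbox _ _ a b) abA.
    - have [M0 hM] : exists M : R, box a b `<=` cube (0 : E) M.
        have [M [_ hM]] := compact_bounded (@compact_cbox R d a b).
        exists (`|M| + 2) => x /(@box_cbox _ _ a b) /(hM (`|M| + 1)) xM.
        apply/cubeE; first by rewrite ltr_pwDr.
        rewrite subr0 (le_lt_trans (xM _))//; last by rewrite ltrD2l ltr1n.
        by rewrite (le_lt_trans (ler_norm _))// ltrDl.
      apply: le_lt_trans (lebesgue_cube_fin 0 M0).
      by apply: le_measure => //; rewrite inE; exact: measurable_box.
  move=> phi tphi; have [K Kphi KA] := test_function_C1c tphi.
  have [lphi _] := C1c_L2 mA Kphi.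
  under eq_Rintegral do rewrite mulrBl.
  rewrite RintegralB//; [|exact: L2_mul_integrable..].
  by have := h1 phi j tphi; rewrite h2// => /eqP; rewrite eqr_opp => /eqP ->; rewrite subrr.
have : {ae mu, forall x, forall j, A x -> g1 x ord0 j - g2 x ord0 j = 0}.
  pose P n x := forall j : 'I_d, val j = n -> A x -> g1 x ord0 j - g2 x ord0 j = 0.
  have : forall n, {ae mu, forall x, P n x}.
    move=> n; have [nd|nd] := ltnP n d.
      have := aej (Ordinal nd); apply: filterS => x h j jn.
      by rewrite (_ : j = Ordinal nd)//; exact: val_inj.
    by apply: aeW => x j jn; have := ltn_ord j; rewrite jn ltnNge nd.
  move=> /ae_foralln; apply: filterS => x h j; exact: (h j).
apply: filterS => x h Ax; apply/rowP => j.
by apply/eqP; rewrite -subr_eq0 h.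
Qed.

Lemma wgrad_weak_gradient A v (g : E -> E) : weak_gradient A v g ->
  weak_gradient A v (wgrad A v).
Proof.
by move=> h; rewrite /wgrad; apply: (@xgetPex _ (fun=> 0) [set g | weak_gradient A v g]); exists g.
Qed.

Lemma wgradE A v (g : E -> E) : open A -> weak_gradient A v g ->
  {ae mu, forall x, A x -> wgrad A v x = g x}.
Proof.
by move=> oA h; exact: (weak_gradient_unique oA (wgrad_weak_gradient h) h).
Qed.

Lemma weak_gradientB A v w (g h : E -> E) : measurable A -> L2 A v -> L2 A w ->
  weak_gradient A v g -> weak_gradient A w h ->
  weak_gradient A (v - w) (fun x => g x - h x).
Proof.
move=> mA lv lw [lg hg] [lh hh]; split => [j|phi j tphi].
  have -> : (fun x => (g x - h x) ord0 j) = (fun x => g x ord0 j + - (h x ord0 j)).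
    by apply/funext => x; rewrite !mxE.
  by apply: L2_sum => //; exact: L2_opp.
have [K Kphi KA] := test_function_C1c tphi.
have [lphi /(_ j) lpj] := C1c_L2 mA Kphi.
have -> : (fun x => (v - w) x * partial j phi x) =
  (fun x => v x * partial j phi x - w x * partial j phi x).
  by apply/funext => x; rewrite -mulrBl.
have -> : (fun x => (g x - h x) ord0 j * phi x) =
  (fun x => g x ord0 j * phi x - h x ord0 j * phi x).
  by apply/funext => x; rewrite !mxE mulrBl.
rewrite !RintegralB//; try exact: L2_mul_integrable.
by rewrite hg// hh// opprB addrC opprK.
Qed.

Lemma C1_weak_gradient A v : open A -> C1_on A v ->
  (forall j, L2 A (partial j v)) -> weak_gradient A v (grad v).
Proof.
move=> oA cv lv; split => [j|phi j tphi].
  by under eq_fun do rewrite mxE.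
have [K Kphi KA] := test_function_C1c tphi.
have [_ _ phi0 _ _] := Kphi.
rewrite (@Rintegral_support _ _ A K) => //; last first.
  by move=> x Kx; rewrite (C1c_partial0 j Kphi Kx) mulr0.
rewrite (@Rintegral_support _ _ A K) => //; last first.
  by move=> x Kx; rewrite phi0// mulr0.
rewrite (integration_by_parts_cutoff (j := j) oA Kphi KA).
  by congr (- _); apply: eq_Rintegral => x _; rewrite mxE.
by move=> x /cv[cvx /(_ j)[]].
Qed.

Lemma test_function_C1_on A B phi : test_function A phi -> C1_on B phi.
Proof.
move=> /test_function_C1c[K [_ _ _ cphi dphi] _] x _; split; first exact: cphi.
by move=> j; have [dp cp] := dphi j; split; [exact: dp|exact: cp].
Qed.

Lemma test_function_weak_gradient A phi : open A -> test_function A phi ->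
  weak_gradient A phi (grad phi).
Proof.
move=> oA tphi; have [K Kphi KA] := test_function_C1c tphi.
have [_ lp] := C1c_L2 (open_measurable_rV oA) Kphi.
by apply: C1_weak_gradient => //; exact: test_function_C1_on tphi.
Qed.

(** A constant sequence approximates the test function; the norm of the zero
    function is 0 although its weak gradient is only known almost everywhere. *)
Lemma test_function_H10 A phi : open A -> test_function A phi -> H10 A phi.
Proof.
move=> oA tphi; have mA := open_measurable_rV oA.
have [K Kphi KA] := test_function_C1c tphi.
have [lphi lp] := C1c_L2 mA Kphi.
split; first by split => //; exists (grad phi); exact: test_function_weak_gradient.
exists (fun=> phi); split => //; rewrite subrr.
have w0 : weak_gradient A (0 : E -> R) (fun=> 0).
  split => [j|psi j _].
    have -> : (fun x : E => (0 : E) ord0 j) = (fun=> 0) by apply/funext => x; rewrite mxE.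
    split; first exact: measurable_cst.
    by rewrite expr0n /= integral0.
  under eq_Rintegral do rewrite mul0r.
  under [in RHS]eq_Rintegral do rewrite mxE mul0r.
  by rewrite /Rintegral integral0 oppr0.
suff -> : H1norm A A (0 : E -> R) = 0 by exact: cvg_cst.
have aew := wgradE oA w0; have [lw _] := wgrad_weak_gradient w0.
rewrite /H1norm (_ : Rintegral _ _ _ = 0); last first.
  rewrite /Rintegral (@ae_eq_integral _ _ _ mu A (cst 0%E))//.
  - by rewrite integral_cst// mul0e.
  - by have /integrableP[] := dot_integrable mA lw lw.
  - apply: filterS aew => x h /h ->; congr EFin.
    by rewrite /dot big1// => j _; rewrite mxE mul0r.
under eq_Rintegral do rewrite expr0n /=.
by rewrite /Rintegral integral0 addr0 sqrtr0.
Qed.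

End weak_gradients.

(** * Cells of the dyadic grids *)

Section adjacent.
Context {R : realType}.
Implicit Types (s : seq R).

Definition adjacent s (a b : R) :=
  [/\ a \in s, b \in s, a < b & forall x, x \in s -> x <= a \/ b <= x].

Lemma nth_adjacent s i : sorted <%R s -> (i.+1 < size s)%N ->
  adjacent s s`_i s`_i.+1.
Proof.
move=> ss si; have is_ : (i < size s)%N by exact: ltn_trans si.
split; [exact: mem_nth|exact: mem_nth|by rewrite lt_sorted_ltn_nth|].
move=> x xs; rewrite -(nth_index 0 xs).
have ix : (index x s < size s)%N by rewrite index_mem.
have [h|h] := leqP (index x s) i; [left|right].
  by rewrite lt_sorted_leq_nth.
by rewrite lt_sorted_leq_nth.
Qed.

Lemma adjacent_nth s a b : sorted <%R s -> adjacent s a b ->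
  exists i, [/\ (i.+1 < size s)%N, a = s`_i & b = s`_i.+1].
Proof.
move=> ss [as_ bs ab h]; exists (index a s).
have ia : (index a s < size s)%N by rewrite index_mem.
have ib : (index b s < size s)%N by rewrite index_mem.
have iab : (index a s < index b s)%N.
  by rewrite -(lt_sorted_ltn_nth 0 ss)// !nth_index.
have si : ((index a s).+1 < size s)%N by exact: leq_ltn_trans ib.
split; rewrite ?nth_index//; apply/eqP; rewrite eq_le; apply/andP; split; last first.
  by rewrite -[leRHS](nth_index 0 bs) lt_sorted_leq_nth.
have [|//] := h _ (mem_nth 0 si).
by rewrite leNgt -{1}[a](nth_index 0 as_) lt_sorted_ltn_nth// ltnSn.
Qed.

Lemma adjacent_uniq s a b a' b' x : adjacent s a b -> adjacent s a' b' ->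
  a < x < b -> a' < x < b' -> a = a' /\ b = b'.
Proof.
move=> [as_ bs ab h] [as' bs' ab' h'] /andP[ax xb] /andP[ax' xb'].
have h1 := h _ as'; have h2 := h _ bs'; have h3 := h' _ as_; have h4 := h' _ bs.
split; apply/eqP; rewrite eq_le; apply/andP; split.
- by case: h3 => //; move: ax xb'; lra.
- by case: h1 => //; move: ax' xb; lra.
- by case: h2 => //; move: ax xb'; lra.
- by case: h4 => //; move: ax' xb; lra.
Qed.

Lemma adjacent_exists s (x lo hi : R) : sorted <%R s -> lo \in s -> hi \in s ->
  lo <= x -> x < hi -> exists a b, adjacent s a b /\ a <= x < b.
Proof.
move=> ss los his lox xhi.
have [n /andP[ns nx] nmax] : exists2 n, (n < size s)%N && (s`_n <= x) &
    forall m, (m < size s)%N && (s`_m <= x) -> (m <= n)%N.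
  have ex : exists n, (n < size s)%N && (s`_n <= x).
    by exists (index lo s); rewrite index_mem los nth_index.
  have ub : forall n, (n < size s)%N && (s`_n <= x) -> (n <= size s)%N.
    by move=> n /andP[/ltnW].
  by case: (ex_maxnP ex ub) => n h1 h2; exists n.
have nh : (n < index hi s)%N.
  rewrite ltnNge; apply/negP => hn.
  have : hi <= s`_n by rewrite -[leLHS](nth_index 0 his) lt_sorted_leq_nth// inE ?index_mem.
  by move: xhi nx; lra.
have ns1 : (n.+1 < size s)%N by apply: (leq_ltn_trans nh); rewrite index_mem.
exists s`_n, s`_n.+1; split; first exact: nth_adjacent.
rewrite nx /= ltNge; apply/negP => h.
by have := nmax n.+1; rewrite ns1 h ltnn => /(_ isT).
Qed.

End adjacent.

Section cells.
Context {R : realType} {d : nat}.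
Local Notation E := 'rV[R]_d.
Variable S : spline_data R d.
Hypothesis SN : nested_splines S.

Lemma breaks_sorted l j : sorted <%R (breaks S l j).
Proof.
have [_ kn _ _] := SN; have [ks _ _ _ _] := kn l j.
rewrite lt_sorted_uniq_le undup_uniq /=.
apply: (subseq_sorted _ _ ks); first exact: le_trans.
exact: undup_subseq.
Qed.

Lemma lower_breaks l j : lower S j \in breaks S l j.
Proof.
have [_ kn _ _] := SN; have [_ _ kl _ _] := kn l j.
by rewrite mem_undup -has_pred1 has_count kl.
Qed.

Lemma upper_breaks l j : upper S j \in breaks S l j.
Proof.
have [_ kn _ _] := SN; have [_ _ _ kl _] := kn l j.
by rewrite mem_undup -has_pred1 has_count kl.
Qed.

Lemma breaks_bounds l j x : x \in breaks S l j -> lower S j <= x <= upper S j.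
Proof.
have [_ kn _ _] := SN; have [_ kb _ _ _] := kn l j.
by rewrite mem_undup => /(allP kb).
Qed.

(** Between two adjacent breakpoints, refinement inserts the midpoint only. *)
Lemma breaks_refined l j a b x : adjacent (breaks S l j) a b ->
  x \in breaks S l.+1 j -> [\/ x <= a, x = (a + b) / 2 | b <= x].
Proof.
have [_ _ ref _] := SN; move=> ab; rewrite mem_undup => /ref.
have [aS bS ab0 hab] := ab.
case=> [xk|[k ks ->]].
  by have := hab x; rewrite mem_undup => /(_ xk)[?|?]; [constructor 1|constructor 3].
have [as_ bs ab1 hab'] := nth_adjacent (breaks_sorted l j) ks.
set a' := _`_k in as_ ab1 hab' *; set b' := _`_k.+1 in bs ab1 hab' *.
have h1 := hab _ as_; have h2 := hab _ bs; have h3 := hab' _ aS; have h4 := hab' _ bS.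
have [aa|aa] := ltP a a'.
  constructor 3; have : b <= a' by case: h1 => //; move: aa; lra.
  by move: ab1; lra.
have [bb|bb] := ltP b' b.
  constructor 1; have : b' <= a by case: h2 => //; move: bb; lra.
  by move: ab1; lra.
constructor 2.
have e1 : a' = a by case: h3 => ?; apply/eqP; rewrite eq_le; apply/andP; split; lra.
have e2 : b' = b by case: h4 => ?; apply/eqP; rewrite eq_le; apply/andP; split; lra.
by rewrite e1 e2.
Qed.

Lemma breaks_sub l j x : x \in breaks S l j -> x \in breaks S l.+1 j.
Proof.
have [_ _ ref _] := SN.
by rewrite !mem_undup => h; apply/ref; left.
Qed.

Lemma breaks_mid l j a b : adjacent (breaks S l j) a b ->
  (a + b) / 2 \in breaks S l.+1 j.
Proof.
have [_ _ ref _] := SN.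
move=> /(adjacent_nth (breaks_sorted l j))[i [il -> ->]].
by rewrite mem_undup; apply/ref; right; exists i.
Qed.

Lemma adjacent_half l j a b : adjacent (breaks S l j) a b ->
  adjacent (breaks S l.+1 j) a ((a + b) / 2).
Proof.
move=> ab; have [aS bS ab0 _] := ab; split; [exact: breaks_sub|exact: breaks_mid|lra|].
move=> x /(breaks_refined ab)[?|->|?]; [by left|by right|right; lra].
Qed.

(** The point [a] lies in an interval of level [l], whose endpoints and midpoint
    are breakpoints of the next level. *)
Lemma adjacent_parent l j a b : adjacent (breaks S l.+1 j) a b ->
  exists a' b', [/\ adjacent (breaks S l j) a' b', a' <= a, b <= b' &
    b - a = (b' - a') / 2].
Proof.
move=> [aS bS ab h].
have /andP[la _] := breaks_bounds aS; have /andP[_ bu] := breaks_bounds bS.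
have [a' [b' [ab' /andP[aa' ab'']]]] := adjacent_exists (breaks_sorted l j)
  (lower_breaks l j) (upper_breaks l j) la (lt_le_trans ab bu).
exists a', b'; split => //.
- have [_ b'S _ _] := ab'.
  by have [|//] := h _ (breaks_sub b'S); move: ab''; lra.
- have [a'S b'S ab0 _] := ab'.
  have hb : b <= b' by have [|//] := h _ (breaks_sub b'S); move: ab''; lra.
  have hm := h _ (breaks_mid ab').
  have := breaks_refined ab' aS; have := breaks_refined ab' bS.
  case=> h1; case=> h2; case: hm => h3; lra.
Qed.

Lemma gridP l (Q : set E) : grid S l Q <-> exists a b,
  (forall j, adjacent (breaks S l j) (a j) (b j)) /\ Q = box a b.
Proof.
split=> [[i il ->]|[a [b [ab ->]]]].
  exists (fun j => (breaks S l j)`_(i j)), (fun j => (breaks S l j)`_(i j).+1).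
  by split => // j; apply: nth_adjacent => //; exact: breaks_sorted.
have /choice[i ih] : forall j, exists i, [/\ (i.+1 < size (breaks S l j))%N,
    a j = (breaks S l j)`_i & b j = (breaks S l j)`_i.+1].
  by move=> j; apply: adjacent_nth (breaks_sorted l j) (ab j).
exists i => [j|]; first by have [] := ih j.
apply/seteqP; split => x h j; have [_ aE bE] := ih j; have := h j.
  by rewrite aE bE.
by rewrite -aE -bE.
Qed.

Lemma grid_open l (Q : set E) : grid S l Q -> open Q.
Proof. by move=> /gridP[a [b [_ ->]]]; exact: box_open. Qed.

Lemma grid_parent l (Q : set E) : grid S l.+1 Q -> exists2 Q', grid S l Q' & Q `<=` Q'.
Proof.
move=> /gridP[a [b [ab ->]]].
have /choice[f fh] : forall j, exists p : R * R, [/\ adjacent (breaks S l j) p.1 p.2,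
    p.1 <= a j, b j <= p.2 & b j - a j = (p.2 - p.1) / 2].
  by move=> j; have [a' [b' h]] := adjacent_parent (ab j); exists (a', b').
exists (box (fun j => (f j).1) (fun j => (f j).2)).
  by apply/gridP; exists (fun j => (f j).1), (fun j => (f j).2); split => // j; have [] := fh j.
move=> x h j; have [_ h1 h2 _] := fh j; have := h j => /andP[h3 h4].
by apply/andP; split; [exact: le_lt_trans h3|exact: lt_le_trans h2].
Qed.

Lemma grid_ancestor k l (Q : set E) : (k <= l)%N -> grid S l Q ->
  exists2 Q', grid S k Q' & Q `<=` Q'.
Proof.
elim: l Q => [|l IH] Q; first by rewrite leqn0 => /eqP -> gQ; exists Q.
rewrite leq_eqVlt => /orP[/eqP -> gQ|kl /grid_parent[Q' /(IH _ kl)[Q'' gQ'' Q'Q''] QQ']].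
  by exists Q.
by exists Q'' => //; exact: subset_trans Q'Q''.
Qed.

Lemma grid_child l (Q : set E) : grid S l Q -> exists2 Q', grid S l.+1 Q' & Q' `<=` Q.
Proof.
move=> /gridP[a [b [ab ->]]]; exists (box a (fun j => (a j + b j) / 2)).
  by apply/gridP; exists a, (fun j => (a j + b j) / 2); split => // j; exact: adjacent_half.
move=> x h j; have /andP[h1 h2] := h j; have [_ _ abj _] := ab j.
by apply/andP; split => //; move: h1 h2 abj; clear; move=> *; lra.
Qed.

Lemma grid_disjoint l (Q Q' : set E) x : grid S l Q -> grid S l Q' ->
  Q x -> Q' x -> Q = Q'.
Proof.
move=> /gridP[a [b [ab ->]]] /gridP[a' [b' [ab' ->]]] h h'.
apply/seteqP; split => y hy j; have [e1 e2] := adjacent_uniq (ab j) (ab' j) (h j) (h' j).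
  by rewrite -e1 -e2.
by rewrite e1 e2.
Qed.

Lemma adjacent_level0 l j a b : adjacent (breaks S l j) a b ->
  exists a0 b0, adjacent (breaks S 0 j) a0 b0 /\ b - a = (b0 - a0) / 2 ^+ l.
Proof.
elim: l a b => [|l IH] a b ab; first by exists a, b; rewrite expr0 divr1.
have [a' [b' [/IH[a0 [b0 [ab0 e]]] _ _ ->]]] := adjacent_parent ab.
by exists a0, b0; split => //; rewrite e exprS invfM; ring.
Qed.

Lemma seq_min_pos (s : seq R) : exists2 e : R, 0 < e & forall x, x \in s -> 0 < x -> e <= x.
Proof.
elim: s => [|x s [e e0 IH]]; first by exists 1.
have [x0|x0] := ltP 0 x; last first.
  exists e => // y; rewrite inE => /orP[/eqP ->|]; last exact: IH.
  by rewrite ltNge x0.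
exists (Num.min e x) => [|y]; first by rewrite lt_min e0.
rewrite inE => /orP[/eqP -> _|ys y0]; first by rewrite ge_min lexx orbT.
by rewrite ge_min IH.
Qed.

(** Every interval of level l is 2^-l times as long as one of the finitely many
    intervals of level 0. *)
Lemma cell_size : exists c0 c1 : R, [/\ 0 < c0, 0 < c1 & forall l j a b,
  adjacent (breaks S l j) a b -> c0 / 2 ^+ l <= b - a <= c1 / 2 ^+ l].
Proof.
pose diffs j := [seq y - x | x <- breaks S 0 j, y <- breaks S 0 j].
have [c0 c00 hc0] := seq_min_pos (flatten [seq diffs j | j <- enum 'I_d]).
pose c1 := 1 + \sum_j (upper S j - lower S j).
have [lu _ _ _] := SN.
have s0 j : upper S j - lower S j <= \sum_j (upper S j - lower S j).
  rewrite (bigD1 j)//= lerDl sumr_ge0// => k _.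
  by rewrite subr_ge0 ltW.
exists c0, c1; split => //.
  by rewrite ltr_wpDr// sumr_ge0// => k _; rewrite subr_ge0 ltW.
move=> l j a b /adjacent_level0[a0 [b0 [ab0 ->]]].
have [a0S b0S a0b0 _] := ab0.
have p2 : 0 < 2 ^+ l :> R by rewrite exprn_gt0.
rewrite !ler_pM2r ?invr_gt0//; apply/andP; split.
  apply: hc0; last by rewrite subr_gt0.
  apply/flatten_mapP; exists j; first by rewrite mem_enum.
  by apply/allpairsP; exists (a0, b0).
have /andP[h1 _] := breaks_bounds a0S; have /andP[_ h2] := breaks_bounds b0S.
by have := s0 j; rewrite /c1; move: h1 h2; clear; move=> *; lra.
Qed.

End cells.

(** * Truncated B-splines on the cells of a mesh *)

Section spline_functions.
Context {R : realType} {d : nat}.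
Local Notation E := 'rV[R]_d.
Variable S : spline_data R d.
Hypothesis SN : nested_splines S.

(** Smoothness of the extension on the whole space keeps [agrees] stable under
    shrinking [Q] and provides bounds up to the boundary of [Q]. *)
Definition agrees (Q : set E) (s : E -> R) :=
  exists2 g, smooth setT g & forall x, Q x -> s x = g x.

Lemma agrees_cst Q c : agrees Q (fun=> c).
Proof. by exists (fun=> c) => //; exact: smooth_cst. Qed.

Lemma agreesD Q s t : agrees Q s -> agrees Q t -> agrees Q (fun x => s x + t x).
Proof.
move=> [g sg gE] [h sh hE]; exists (fun x => g x + h x); first exact: smoothD.
by move=> x Qx; rewrite gE// hE.
Qed.

Lemma agreesM Q s t : agrees Q s -> agrees Q t -> agrees Q (fun x => s x * t x).
Proof.
move=> [g sg gE] [h sh hE]; exists (fun x => g x * h x); first exact: smoothM.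
by move=> x Qx; rewrite gE// hE.
Qed.

Lemma agrees_eq Q s t : (forall x, Q x -> s x = t x) -> agrees Q t -> agrees Q s.
Proof. by move=> st [g sg gE]; exists g => // x Qx; rewrite st// gE. Qed.

Lemma agrees_sub (Q Q' : set E) s : Q' `<=` Q -> agrees Q s -> agrees Q' s.
Proof. by move=> sub [g sg gE]; exists g => // x /sub; exact: gE. Qed.

Lemma agrees_sum Q (I : Type) (r : seq I) (P : pred I) (F : I -> E -> R) :
  (forall i, P i -> agrees Q (F i)) -> agrees Q (fun x => \sum_(i <- r | P i) F i x).
Proof.
by apply: (big_pointwise_closed (C := agrees Q)); [exact: agrees_cst|exact: agreesD].
Qed.

Lemma agrees_prod Q (I : Type) (r : seq I) (P : pred I) (F : I -> E -> R) :
  (forall i, P i -> agrees Q (F i)) -> agrees Q (fun x => \prod_(i <- r | P i) F i x).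
Proof.
by apply: (big_pointwise_closed (C := agrees Q)); [exact: agrees_cst|exact: agreesM].
Qed.

Lemma smooth_agrees Q f : smooth setT f -> agrees Q f.
Proof. by move=> sf; exists f. Qed.

(** The sets on which the different smooth functions are taken are left
    unspecified: they may depend on the half-open conventions for B-splines,
    and only the number of the smooth functions matters for uniform bounds. *)
Definition piecewise_smooth (s : E -> R) :=
  exists (I : finType) (g : I -> E -> R), (forall i, smooth setT (g i)) /\
    forall x, exists i, s x = g i x.

Lemma piecewise_cst c : piecewise_smooth (fun=> c).
Proof.
exists unit, (fun _ _ => c); split => [_|x]; first exact: smooth_cst.
by exists tt.
Qed.

Lemma smooth_piecewise f : smooth setT f -> piecewise_smooth f.
Proof. by move=> sf; exists unit, (fun=> f); split => // x; exists tt. Qed.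

Lemma piecewise_bool (b : E -> bool) : piecewise_smooth (fun x => (b x)%:R).
Proof.
exists bool, (fun (i : bool) _ => i%:R); split => [i|x]; first exact: smooth_cst.
by exists (b x).
Qed.

Lemma piecewiseD s t : piecewise_smooth s -> piecewise_smooth t ->
  piecewise_smooth (fun x => s x + t x).
Proof.
move=> [I [g [sg gE]]] [J [h [sh hE]]].
exists (I * J)%type, (fun p x => g p.1 x + h p.2 x); split => [p|x].
  exact: smoothD.
by have [i ->] := gE x; have [j ->] := hE x; exists (i, j).
Qed.

Lemma piecewiseM s t : piecewise_smooth s -> piecewise_smooth t ->
  piecewise_smooth (fun x => s x * t x).
Proof.
move=> [I [g [sg gE]]] [J [h [sh hE]]].
exists (I * J)%type, (fun p x => g p.1 x * h p.2 x); split => [p|x].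
  exact: smoothM.
by have [i ->] := gE x; have [j ->] := hE x; exists (i, j).
Qed.

Lemma piecewise_sum (I : Type) (r : seq I) (P : pred I) (F : I -> E -> R) :
  (forall i, P i -> piecewise_smooth (F i)) ->
  piecewise_smooth (fun x => \sum_(i <- r | P i) F i x).
Proof.
by apply: (big_pointwise_closed (C := piecewise_smooth)); [exact: piecewise_cst|exact: piecewiseD].
Qed.

Lemma piecewise_prod (I : Type) (r : seq I) (P : pred I) (F : I -> E -> R) :
  (forall i, P i -> piecewise_smooth (F i)) ->
  piecewise_smooth (fun x => \prod_(i <- r | P i) F i x).
Proof.
by apply: (big_pointwise_closed (C := piecewise_smooth)); [exact: piecewise_cst|exact: piecewiseM].
Qed.

Lemma smooth_affine_coord D j (a b c : R) : smooth D (fun x : E => (a * x ord0 j + b) / c).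
Proof.
apply: smoothM; last exact: smooth_cst.
apply: smoothD; last exact: smooth_cst.
by apply: smoothM; [exact: smooth_cst|exact: smooth_coord].
Qed.

Lemma bspline1_piecewise (t : seq R) p i j :
  piecewise_smooth (fun x : E => bspline1 t p i (x ord0 j)).
Proof.
elim: p i => [|p IH] i /=; first exact: piecewise_bool.
apply: piecewiseD; apply: piecewiseM => //; apply: smooth_piecewise.
  under eq_fun do rewrite -[X in X - _]mul1r.
  exact: smooth_affine_coord.
under eq_fun do rewrite addrC -[X in X + _]mulN1r.
exact: smooth_affine_coord.
Qed.

(** On an interval that contains no knot, all the conditions in the recursion are
    constant. The hypothesis on [i] keeps the knots in range. *)
Lemma bspline1_agrees (t : seq R) p i j a b : adjacent (undup t) a b ->
  (i + p.+1 < size t)%N ->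
  agrees [set x : E | a < x ord0 j < b] (fun x => bspline1 t p i (x ord0 j)).
Proof.
move=> ab; elim: p i => [|p IH] i it /=.
  have [_ _ _ hab] := ab.
  have h1 : t`_i <= a \/ b <= t`_i.
    by apply: hab; rewrite mem_undup mem_nth// (leq_ltn_trans _ it)// leq_addr.
  have h2 : t`_i.+1 <= a \/ b <= t`_i.+1.
    by apply: hab; rewrite mem_undup mem_nth// -addn1.
  exists (fun=> ((t`_i <= a) && (b <= t`_i.+1))%:R); first exact: smooth_cst.
  move=> x /= /andP[ax xb]; congr (_%:R).
  have -> : (x ord0 j == t`_i.+1) = false.
    by apply/negbTE/eqP => e; case: h2; rewrite -e leNgt ?ax ?xb.
  rewrite andFb andbF orbF; congr (nat_of_bool (_ && _)).
    apply/idP/idP => h; last exact: le_trans h (ltW ax).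
    by case: h1 => // /(lt_le_trans xb); rewrite ltNge h.
  apply/idP/idP => h; last exact: lt_le_trans xb h.
  by case: h2 => // h2; have := lt_trans ax (lt_le_trans h h2); rewrite ltxx.
apply: agreesD; apply: agreesM.
- apply: smooth_agrees; under eq_fun do rewrite -[X in X - _]mul1r.
  exact: smooth_affine_coord.
- by apply: IH; move: it; lia.
- apply: smooth_agrees; under eq_fun do rewrite addrC -[X in X + _]mulN1r.
  exact: smooth_affine_coord.
- by apply: IH; move: it; lia.
Qed.

Lemma bspline_piecewise l i : piecewise_smooth (bspline S l i).
Proof. by apply: piecewise_prod => j _; exact: bspline1_piecewise. Qed.

Lemma bspline_agrees k l i (Q : set E) : (k <= l)%N -> grid S l Q -> indices S k i ->
  agrees Q (bspline S k i).
Proof.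
move=> kl gQ ik; have [Q' /(gridP SN)[a [b [ab ->]]] QQ'] := grid_ancestor SN kl gQ.
apply: (agrees_sub QQ'); apply: agrees_prod => j _.
apply: agrees_sub (bspline1_agrees j (ab j) _) => [x /(_ j)//|].
by have := ik j; rewrite ltn_subRL addnC.
Qed.

Lemma finite_multi_indices (n : 'I_d -> nat) :
  finite_set [set k : {ffun 'I_d -> nat} | forall j, (k j <= n j)%N].
Proof.
pose N := (\max_j n j)%N.
pose f (g : {ffun 'I_d -> 'I_N.+1}) : {ffun 'I_d -> nat} := [ffun j => val (g j)].
apply: (sub_finite_set (B := f @` setT)); last exact: finite_image.
move=> k kn; exists [ffun j => inord (k j)] => //; apply/ffunP => j.
rewrite /f !ffunE /= inordK// ltnS; apply: leq_trans (leq_bigmax j).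
exact: kn.
Qed.

Lemma finite_indices l : finite_set (indices S l).
Proof.
apply: sub_finite_set (finite_multi_indices (fun j => size (knots S l j))) => i il j.
by apply: ltnW; apply: leq_trans (il j) _; exact: leq_subr.
Qed.

Lemma bspline_combE l c : bspline_comb S l c =
  fun x => \sum_(i <- finmap.enum_fset (fset_set (indices S l))) c i * bspline S l i x.
Proof.
by apply/funext => x; rewrite /bspline_comb fsbig_finite//; exact: finite_indices.
Qed.

Lemma comb_agrees k l c (Q : set E) : (k <= l)%N -> grid S l Q ->
  agrees Q (bspline_comb S k c).
Proof.
move=> kl gQ; rewrite bspline_combE.
under eq_fun do rewrite big_seq.
apply: agrees_sum => i; rewrite in_fset_set; last exact: finite_indices.
rewrite inE => ik; apply: agreesM; first exact: agrees_cst.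
exact: bspline_agrees kl gQ ik.
Qed.

Lemma comb_piecewise k c : piecewise_smooth (bspline_comb S k c).
Proof.
rewrite bspline_combE; apply: piecewise_sum => i _.
by apply: piecewiseM; [exact: piecewise_cst|exact: bspline_piecewise].
Qed.

Variable H : hierarchy R d.
Hypothesis HH : domain_hierarchy S H.

Lemma dom_sub k l : (k <= l)%N -> dom H l `<=` dom H k.
Proof.
have [_ _ hd _ _] := HH.
elim: l => [|l IH]; first by rewrite leqn0 => /eqP ->.
rewrite leq_eqVlt => /orP[/eqP -> //|/IH]; apply: subset_trans.
by have [] := hd l.
Qed.

(** Otherwise, Q would contain a cell of level k on which the hierarchy is
    refined. *)
Lemma active_disjoint l k (Q : set E) x : active S H l Q -> (l < k)%N ->
  Q x -> ~ dom H k x.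
Proof.
move=> [gQ QH nact] lk Qx kx; have [_ _ _ d0 dK] := HH.
case: k => // k in lk kx *.
have [kd|kd] := ltnP k.+1 (depth H); last by move: kx; rewrite d0.
have [K Kg KE] := dK k kd; move: kx; rewrite KE => -[Q1 KQ1 clx].
have gQ1 := Kg _ KQ1.
have [y [Q1y Qy]] : Q1 `&` Q !=set0.
  apply: clx; apply: open_nbhs_nbhs; split => //; exact: (grid_open SN gQ).
have [Q2 gQ2 Q12] := grid_ancestor SN (lk : (l <= k)%N) gQ1.
have e := grid_disjoint SN gQ gQ2 Qy (Q12 _ Q1y).
have [Q3 gQ3 Q31] := grid_child SN gQ1.
apply: nact; exists k.+1, Q3; split => //.
- rewrite KE => z /Q31 Q1z; exists Q1 => //; exact: subset_closure.
- by rewrite e; exact: subset_trans Q12.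
Qed.

Definition kept l : set {ffun 'I_d -> nat} :=
  [set i | indices S l i /\ ~ supp S H l i `<=` dom H l].

Lemma truncE l s : trunc S H l s = bspline_comb S l
  (fun i => if `[< kept l i >] then coefs S l s i else 0).
Proof.
apply/funext => x; rewrite /trunc /bspline_comb -/(kept l).
rewrite -[RHS](fsbig_widen (kept l) (indices S l)) => [|i []//|i [il nk]]; last first.
  by rewrite /=; case: asboolP => //; rewrite mul0r.
by apply: eq_fsbigr => i; rewrite inE => ki; case: asboolP.
Qed.

Lemma trunc_spline l s : spline_space S l (trunc S H l s).
Proof. by rewrite truncE; eexists. Qed.

Lemma coefsP l s : spline_space S l s -> s = bspline_comb S l (coefs S l s).
Proof.
move=> [c _ <-]; rewrite /coefs.
by apply: (@xgetPex _ (fun=> 0) [set c0 | bspline_comb S l c = bspline_comb S l c0]); exists c.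
Qed.

(** A B-spline that is removed has its support in the domain of level [k], which
    does not meet the active cell [Q] of lower level. *)
Lemma trunc_active l k (Q : set E) s x : active S H l Q -> (l < k)%N ->
  spline_space S k s -> Q x -> trunc S H k s x = s x.
Proof.
move=> aQ lk /coefsP sE Qx; rewrite [in RHS]sE /trunc /bspline_comb -/(kept k).
apply: fsbig_widen => [i []//|i [ik nk]] /=.
have [->|bx] := eqVneq (bspline S k i x) 0; first by rewrite mulr0.
exfalso; apply: nk; split => // sub.
apply: (active_disjoint aQ lk Qx); apply: sub; split.
  by apply: subset_closure.
have [_ QH _] := aQ; apply: (dom_sub (leq0n l)); exact: QH.
Qed.

Lemma bspline_spline k i : indices S k i -> spline_space S k (bspline S k i).
Proof.
move=> ik; exists (fun i' => (i' == i)%:R) => //; apply/funext => x.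
rewrite /bspline_comb -(fsbig_widen [set i] (indices S k)) => [|_ ->//|i' [_ /eqP ne]].
  by rewrite fsbig_set1 eqxx mul1r.
by rewrite /= (negbTE ne) mul0r.
Qed.

(** Truncations with respect to levels up to [l] yield combinations of B-splines
    of these levels, which are polynomials on [Q]; later truncations do not
    change the values on [Q]. If [k] is greater than [l], then the B-spline
    itself vanishes on [Q]. *)
Lemma thb_agrees l k i (Q : set E) : active S H l Q -> hb_index S H k i ->
  agrees Q (thb S H k i).
Proof.
move=> aQ [ik isub _]; have [gQ QH _] := aQ.
have [_ _ _ nest] := SN.
rewrite /thb; move: (_ - _)%N => n.
have start : agrees Q (bspline S k i).
  have [kl|lk] := leqP k l; first exact: bspline_agrees kl gQ ik.
  exists (fun=> 0); first exact: smooth_cst.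
  move=> x Qx; apply/eqP; apply: contrapT => /negP bx.
  apply: (active_disjoint aQ lk Qx); apply: isub; split; first exact: subset_closure.
  by apply: (dom_sub (leq0n l)); exact: QH.
have := bspline_spline ik.
elim: n k (bspline S k i) start {ik isub} => [//|n IH] k s sQ sk /=.
apply: IH; last exact: trunc_spline.
have [kl|lk] := leqP k.+1 l.
  by rewrite truncE; exact: comb_agrees kl gQ.
by apply: agrees_eq sQ => x Qx; apply: (trunc_active aQ lk) => //; exact: nest.
Qed.

Lemma thb_piecewise k i : piecewise_smooth (thb S H k i).
Proof.
rewrite /thb; have := bspline_piecewise k i.
elim: (iota _ _) (bspline S k i) => [//|k' r IH] s _ /=.
by apply: IH; rewrite truncE; exact: comb_piecewise.
Qed.

Lemma thb_basis_finite : finite_set (thb_basis S H).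
Proof.
rewrite (_ : thb_basis S H = \bigcup_(l in `I_(depth H)) thb_level S H l); last first.
  by apply/seteqP; split => [t [l]|t [l]]; exists l.
apply: bigcup_finite => // l _; apply: finite_image.
by apply: sub_finite_set (finite_indices l) => i [].
Qed.

Lemma thb_basis_agrees tau (Q : set E) : mesh S H Q -> thb_basis S H tau ->
  agrees Q tau.
Proof. by move=> [l _ aQ] [k _ [i ik <-]]; exact: thb_agrees aQ ik. Qed.

Lemma thb_basis_piecewise tau : thb_basis S H tau -> piecewise_smooth tau.
Proof. by move=> [k _ [i _ <-]]; exact: thb_piecewise. Qed.

End spline_functions.

(** * Local surjectivity and inverse functions *)

Section differential.
Context {R : realType} {d : nat}.
Local Notation E := 'rV[R]_d.

Lemma derive_partials (f : E -> R) (x v : E) : differentiable f x ->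
  'D_v f x = \sum_j v ord0 j * partial j f x.
Proof.
move=> df; rewrite deriveE// {1}(row_sum_delta v) linear_sum.
by apply: eq_bigr => j _; rewrite linearZ /= /partial deriveE.
Qed.

Lemma differential_estimate (f : E -> R) (x : E) : differentiable f x ->
  forall e : R, 0 < e -> \forall h \near (0 : E),
    `|f (x + h) - f x - \sum_j h ord0 j * partial j f x| <= e * `|h|.
Proof.
move=> df e e0; have /eqaddoP/(_ e e0) := diff_locally df.
apply: near_rVS => h; rewrite /= !fctE /cst /= addrC => hh.
by rewrite -derive_partials// deriveE//; move: hh; rewrite addrC opprD addrA [h + x]addrC.
Qed.

(** The Jacobian matrix, acting on row vectors from the right. *)
Definition jac (F : E -> E) (x : E) : 'M[R]_d :=
  \matrix_(j, i) partial j (fun y => F y ord0 i) x.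

Lemma jacE (F : E -> E) (x v : E) i :
  (v *m jac F x) ord0 i = \sum_j v ord0 j * partial j (fun y => F y ord0 i) x.
Proof. by rewrite mxE; apply: eq_bigr => j _; rewrite mxE. Qed.

Lemma differential_estimate_rV (F : E -> E) (x : E) :
  (forall i, differentiable (fun y => F y ord0 i) x) ->
  forall e : R, 0 < e -> \forall h \near (0 : E),
    `|F (x + h) - F x - h *m jac F x| <= e * `|h|.
Proof.
move=> dF e e0.
have : \forall h \near (0 : E), forall i, `|F (x + h) ord0 i - F x ord0 i -
    \sum_j h ord0 j * partial j (fun y => F y ord0 i) x| <= e * `|h|.
  apply: (@filter_forall _ _ _ _ (nbhs_filter (0 : E))) => i.
  exact: (@differential_estimate (fun y => F y ord0 i) x (dF i) e e0).
apply: near_rVS => h hh; apply/rV_norm_le; first by rewrite mulr_ge0// ltW.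
by move=> i; have := hh i; rewrite -jacE !mxE.
Qed.

(** A lower Lipschitz bound passes to the differential. *)
Lemma jac_unit (F : E -> E) (Q : set E) (L : R) (x : E) : open Q -> Q x ->
  (forall i, differentiable (fun y => F y ord0 i) x) ->
  (forall y, Q y -> `|y - x| <= L * `|F y - F x|) -> jac F x \in unitmx.
Proof.
move=> oQ Qx dF lF; rewrite -row_free_unit -kermx_eq0; apply/eqP/row_matrixP => i.
rewrite row0; set v := row i _.
have vJ : v *m jac F x = 0 by rewrite -row_mul mulmx_ker row0.
apply/eqP; apply: contrapT => /negP v0.
have nv : 0 < `|v| by rewrite normr_gt0.
(* a kernel vector v would give |t v| <= L |F (x + t v) - F x| <= |t v| / 2 *)
pose e := (2 * (`|L| + 1))^-1.
have L0 : 0 < `|L| + 1 by rewrite ltr_pwDr.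
have e0 : 0 < e by rewrite invr_gt0 mulr_gt0.
have /nbhs_ballP[r /= r0 hr] := differential_estimate_rV dF e0.
have [s s0 sQ] := (open_rVP Q).1 oQ x Qx.
pose t := Num.min r s / (2 * `|v|).
have m0 : 0 < Num.min r s by rewrite lt_min r0.
have t0 : 0 < t by rewrite divr_gt0// mulr_gt0.
have ntv : `|t *: v| = Num.min r s / 2.
  by rewrite normrZ gtr0_norm// /t; field; rewrite gt_eqF.
have ms : Num.min r s <= s by rewrite ge_min lexx orbT.
have mr : Num.min r s <= r by rewrite ge_min lexx.
have mlt : Num.min r s / 2 < Num.min r s by rewrite ltr_pdivrMr// ltr_pMr// ltr1n.
have hs : `|t *: v| < s by rewrite ntv (lt_le_trans mlt).
have hr' : `|t *: v| < r by rewrite ntv (lt_le_trans mlt).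
have tv0 : 0 < `|t *: v| by rewrite ntv divr_gt0.
have Qtv : Q (x + t *: v) by apply: sQ; apply/cubeE => //; rewrite addrC addKr.
have h1 : `|F (x + t *: v) - F x| <= e * `|t *: v|.
  have := hr (t *: v); rewrite -ball_normE /= sub0r normrN => /(_ hr').
  by rewrite -scalemxAl vJ scaler0 subr0.
have h2 := lF _ Qtv; rewrite [x + _]addrC addrK [_ + x]addrC in h2.
have h3 : `|t *: v| <= (`|L| + 1) * (e * `|t *: v|).
  apply: (le_trans h2); apply: (le_trans (_ : _ <= (`|L| + 1) * `|F (x + t *: v) - F x|)).
    by rewrite ler_wpM2r// (le_trans (ler_norm _))// lerDl.
  by rewrite ler_wpM2l// ltW.
have h4 : (`|L| + 1) * (e * `|t *: v|) = `|t *: v| / 2.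
  by rewrite /e; field; rewrite gt_eqF.
by move: h3 tv0; rewrite h4; lra.
Qed.

Lemma norm_le_sumsq (x : E) : `|x| ^+ 2 <= \sum_i x ord0 i ^+ 2.
Proof.
have s0 : 0 <= \sum_i x ord0 i ^+ 2 by apply: sumr_ge0 => i _; exact: sqr_ge0.
rewrite -[leRHS]sqr_sqrtr// lerXn2r ?nnegrE ?sqrtr_ge0//.
apply/rV_norm_le; first exact: sqrtr_ge0.
move=> i; rewrite -sqrtr_sqr ler_sqrt// (bigD1 i)//= lerDl.
by apply: sumr_ge0 => j _; exact: sqr_ge0.
Qed.

Lemma sumsq_le_norm (x : E) : \sum_i x ord0 i ^+ 2 <= d%:R * `|x| ^+ 2.
Proof.
rewrite -[X in X%:R * _](card_ord d) mulr_natl -sumr_const; apply: ler_sum => i _.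
by rewrite -real_normK ?num_real// lerXn2r ?nnegrE// coord_le_norm.
Qed.

(** Quantitative surjectivity: the squared distance from F to a point near
    F x0 attains its minimum over the closed cube at an interior point, where
    its gradient vanishes; as the Jacobian is invertible, the minimum is 0. *)
Lemma ball_in_image (F : E -> E) (Q : set E) (x0 : E) (L rho : R) :
  (0 < d)%N -> open Q -> 0 < L -> 0 < rho ->
  (forall i, smooth setT (fun y => F y ord0 i)) ->
  (forall x y, Q x -> Q y -> `|x - y| <= L * `|F x - F y|) ->
  (forall x, `|x - x0| <= rho -> Q x) ->
  forall y, `|y - F x0| < rho / (L * (d%:R + 1)) ->
    exists2 x, `|x - x0| < rho & F x = y.
Proof.
move=> d0 oQ L0 rho0 sF lF BQ y yr.
pose Phi x := \sum_i (F x ord0 i - y ord0 i) ^+ 2.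
have sPhi : smooth setT Phi.
  apply: smooth_sum => i _; apply: smoothX; apply: smoothB => //.
  exact: smooth_cst.
have d1 : 1 <= d%:R :> R by rewrite ler1n.
pose B := [set x : E | `|x - x0| <= rho].
have cB : compact B.
  have -> : B = ccube x0 rho.
    apply/seteqP; split => x /=.
      by move=> /(rV_norm_le _ (ltW rho0)) h j; have := h j; rewrite !mxE ler_distl.
    move=> h; apply/rV_norm_le; first exact: ltW.
    by move=> j; rewrite !mxE ler_distl; exact: h.
  exact: compact_cbox.
have B0 : B !=set0 by exists x0; rewrite /B /= subrr normr0 ltW.
have [|x /set_mem Bx xmin] := EVT_min_rV B0 cB (f := Phi).
  by apply: continuous_subspaceT; exact: smoothT_continuous.
have Qx : Q x by exact: BQ.
have Qx0 : Q x0 by apply: BQ; rewrite subrr normr0 ltW.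
have xlt : `|x - x0| < rho.
  rewrite ltNge; apply/negP => xrho.
  have xx0 : `|x - x0| = rho by apply/eqP; rewrite eq_le Bx.
  have h1 := lF _ _ Qx Qx0; rewrite xx0 in h1.
  have h2 : `|F x - F x0| <= `|F x - y| + `|y - F x0|.
    by rewrite -[F x - F x0](subrKA y) ler_normD.
  set t := `|y - F x0| in yr h2.
  have h3 : `|F x - y| ^+ 2 <= d%:R * t ^+ 2.
    have e1 : `|F x - y| ^+ 2 <= Phi x.
      apply: le_trans (norm_le_sumsq _) _; apply: ler_sum => i _.
      by rewrite !mxE.
    apply: (le_trans e1); apply: (le_trans (xmin x0 _)).
      by rewrite inE /B /= subrr normr0 ltW.
    have := sumsq_le_norm (F x0 - y); rewrite distrC -/t; apply: le_trans.
    by apply: ler_sum => i _; rewrite !mxE.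
  have t0 : 0 <= t by exact: normr_ge0.
  move: yr; rewrite ltr_pdivlMr; last by rewrite mulr_gt0// ltr_wpDl.
  move=> yr.
  have h4 : rho <= L * (`|F x - y| + t) by apply: le_trans h1 _; rewrite ler_pM2l.
  have h5 : `|F x - y| <= d%:R * t.
    rewrite -(@ler_pXn2r _ 2) ?nnegrE ?mulr_ge0//; apply: (le_trans h3).
    by rewrite exprMn ler_wpM2r ?sqr_ge0// expr2 ler_peMl// ler0n.
  have : L * (`|F x - y| + t) <= t * (L * (d%:R + 1)).
    have : L * `|F x - y| <= L * (d%:R * t) by rewrite ler_pM2l.
    by move: L0; clear; move=> *; lra.
  by move: h4 yr; clear; move=> *; lra.
exists x => //.
have uJ : jac F x \in unitmx.
  apply: (@jac_unit F Q L x oQ Qx) => [i|z Qz]; last exact: lF.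
  exact: (smooth_differentiable (sF i)).
pose w : E := F x - y; pose v := w *m invmx (jac F x).
pose del := (rho - `|x - x0|) / (`|v| + 1).
have v1 : 0 < `|v| + 1 by rewrite ltr_wpDl.
have del0 : 0 < del by rewrite divr_gt0// subr_gt0.
have dPhi (t : R) : is_derive t (1 : R) (fun s => Phi (x + s *: v)) ('D_v Phi (x + t *: v)).
  by apply: is_derive_line; exact: smoothT_derivable.
have Bt (t : R) : t \in `]- del, del[ -> B (x + t *: v).
  rewrite in_itv /= -ltr_norml => tdel; rewrite /B /= addrAC.
  apply: (le_trans (ler_normD _ _)); rewrite normrZ.
  have : `|t| * `|v| <= del * (`|v| + 1).
    by apply: ler_pM => //; [exact: ltW|rewrite lerDl].
  rewrite /del divfK ?gt_eqF//; clear; move=> *; lra.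
have [] := @derive1_at_min R (fun s => Phi (x + s *: v)) (- del) del 0.
- by move: del0; clear; move=> *; lra.
- by move=> t _; have [] := dPhi t.
- by rewrite in_itv /=; apply/andP; split => //; rewrite oppr_lt0.
- move=> t /Bt Btv; rewrite scale0r addr0; apply: xmin.
  by rewrite inE.
move=> _; rewrite (@derive_val _ _ _ _ _ _ _ (dPhi 0)) scale0r addr0.
have sF' i : differentiable (fun z => F z ord0 i) x by exact: (smooth_differentiable (sF i)).
have dF i : is_derive x v (fun z => F z ord0 i - y ord0 i) (w ord0 i).
  have -> : w ord0 i = 'D_v (fun z => F z ord0 i) x - 0.
    rewrite subr0 derive_partials// -jacE /v -mulmxA mulVmx// mulmx1//.
  apply: is_deriveB; apply: DeriveDef => //.
  exact: diff_derivable.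
have -> : Phi = \sum_i ((fun z => F z ord0 i - y ord0 i) * (fun z => F z ord0 i - y ord0 i)).
  by apply/funext => z; rewrite /Phi fct_sumE; apply: eq_bigr => i _; rewrite expr2.
have dS := @is_derive_sum _ _ _ _ _ x v _ (fun i => is_deriveM (dF i) (dF i)).
rewrite (@derive_val _ _ _ _ _ _ _ dS) => s0.
have ws : \sum_i w ord0 i ^+ 2 = 0.
  have : \sum_i w ord0 i ^+ 2 *+ 2 = 0.
    rewrite -[RHS]s0; apply: eq_bigr => i _.
    by rewrite /GRing.scale /= mulr2n expr2 /w !mxE.
  by rewrite sumrMnl => /eqP; rewrite mulrn_eq0 /= => /eqP.
apply/eqP; rewrite -subr_eq0 -/w -normr_eq0 -sqrf_eq0 eq_le sqr_ge0 andbT -ws.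
exact: norm_le_sumsq.
Qed.

End differential.

Section inverse_function.
Context {R : realType} {d : nat}.
Local Notation E := 'rV[R]_d.
Variables (Q : set E) (F G : E -> E) (L : R).
Hypotheses (d0 : (0 < d)%N) (oQ : open Q) (L0 : 0 < L).
Hypothesis sF : forall i, smooth setT (fun y => F y ord0 i).
Hypothesis lF : forall x y, Q x -> Q y -> `|x - y| <= L * `|F x - F y|.
Hypothesis GF : forall x, Q x -> G (F x) = x.
Let V := F @` Q.

Lemma image_open : open V.
Proof.
apply/open_rVP => _ [x0 Qx0 <-]; have [s s0 sQ] := (open_rVP Q).1 oQ x0 Qx0.
have s2 : 0 < s / 2 by rewrite divr_gt0.
exists (s / 2 / (L * (d%:R + 1))); first by rewrite divr_gt0// mulr_gt0// ltr_wpDl.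
have sub x : `|x - x0| <= s / 2 -> Q x.
  move=> h; apply: sQ; apply/cubeE => //; apply: (le_lt_trans h).
  by rewrite ltr_pdivrMr// ltr_pMr// ltr1n.
move=> y /cubeE; rewrite divr_gt0 ?mulr_gt0 ?ltr_wpDl// => /(_ isT) yr.
have [x xs <-] := ball_in_image d0 oQ L0 s2 sF lF sub yr.
by exists x => //; apply: sub; exact: ltW.
Qed.

Lemma inverse_lipschitz y y' : V y -> V y' -> `|G y - G y'| <= L * `|y - y'|.
Proof. by move=> [x Qx <-] [x' Qx' <-]; rewrite !GF//; exact: lF. Qed.

Lemma inverse_in y : V y -> Q (G y).
Proof. by move=> [x Qx <-]; rewrite GF. Qed.

Lemma inverseK y : V y -> F (G y) = y.
Proof. by move=> [x Qx <-]; rewrite GF. Qed.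

Lemma inverse_continuous y : V y -> {for y, continuous G}.
Proof.
move=> Vy; apply/(@cvgrPdist_le _ _ _ _ (nbhs_filter y)) => e e0.
have : \forall z \near y, V z /\ `|y - z| <= e / L.
  apply: (@filterI _ _ (nbhs_filter y)); first exact: (near_open image_open).
  apply/nbhs_ballP; exists (e / L) => /=; first by rewrite divr_gt0.
  by move=> z; rewrite -ball_normE /=; exact: ltW.
apply: near_rVS => z [Vz yz]; apply: le_trans (inverse_lipschitz Vy Vz) _.
by rewrite -ler_pdivlMl// mulrC.
Qed.

Lemma mulmx_norm_bound (M : 'M[R]_d) :
  exists2 C : R, 0 < C & forall w : E, `|w *m M| <= C * `|w|.
Proof.
exists (1 + \sum_j \sum_i `|M j i|).
  by rewrite ltr_wpDr// sumr_ge0// => j _; exact: sumr_ge0.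
have Ms0 : 0 <= \sum_j \sum_i `|M j i| by apply: sumr_ge0 => j _; exact: sumr_ge0.
move=> w; apply/rV_norm_le; first by rewrite mulr_ge0// addr_ge0.
move=> i; rewrite mxE; apply: (le_trans (ler_norm_sum _ _ _)).
apply: (@le_trans _ _ (\sum_j `|M j i| * `|w|)).
  by apply: ler_sum => j _; rewrite normrM mulrC ler_wpM2l// coord_le_norm.
rewrite -mulr_suml ler_wpM2r//; apply: (@le_trans _ _ (\sum_j \sum_i `|M j i|)); last first.
  by rewrite lerDr.
by apply: ler_sum => j _; rewrite (bigD1 i)//= lerDl sumr_ge0.
Qed.

Lemma inverse_jac_unit y : V y -> jac F (G y) \in unitmx.
Proof.
move=> Vy; apply: (@jac_unit _ _ F Q L _ oQ (inverse_in Vy)) => [i|z Qz].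
  exact: (smooth_differentiable (sF i)).
by apply: lF => //; exact: inverse_in.
Qed.

(** From the differentiability of [F] and the Lipschitz bound of its inverse. *)
Lemma inverse_is_derive y v : V y ->
  is_derive y v G (v *m invmx (jac F (G y))).
Proof.
move=> Vy; set x := G y; set J := jac F x.
have uJ : J \in unitmx by exact: inverse_jac_unit.
have [C C0 hC] := mulmx_norm_bound (invmx J).
suff cq : (fun h : R => h^-1 *: ((G \o shift y) (h *: v) - G y)) @ 0^' --> v *m invmx J.
  by apply: DeriveDef; [apply/cvg_ex; exists (v *m invmx J)|exact: cvg_lim].
apply/cvgrPdist_le => e e0.
pose e' := e / (C * (L * (`|v| + 1))).
have v1 : 0 < `|v| + 1 by rewrite ltr_wpDl.
have e'0 : 0 < e' by rewrite divr_gt0// !mulr_gt0.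
have dF i : differentiable (fun z => F z ord0 i) x by exact: (smooth_differentiable (sF i)).
have /nbhs_ballP[r /= r0 hr] := differential_estimate_rV dF e'0.
have [s s0 sV] := (open_rVP V).1 image_open y Vy.
pose del := Num.min s (r / L) / (`|v| + 1).
have m0 : 0 < Num.min s (r / L) by rewrite lt_min s0 divr_gt0.
have del0 : 0 < del by rewrite divr_gt0.
have N1 : \forall t \near (0 : R)^', `|t| < del by exact: dnbhs0_lt.
have N2 : \forall t \near (0 : R)^', t != 0 by exact: nbhs_dnbhs_neq.
apply: filterS2 N1 N2 => t tdel t0 /=.
have tv : `|t *: v| < Num.min s (r / L).
  rewrite normrZ; move: tdel; rewrite ltr_pdivlMr//; apply: le_lt_trans.
  by rewrite ler_wpM2l// lerDl.
have Vt : V (t *: v + y).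
  apply: sV; apply/cubeE => //; rewrite addrK (lt_le_trans tv)//.
  by rewrite ge_min lexx.
pose h := G (t *: v + y) - x.
have hL : `|h| <= L * `|t *: v|.
  by have := inverse_lipschitz Vt Vy; rewrite addrK.
have hr' : `|h| < r.
  apply: (le_lt_trans hL); rewrite -ltr_pdivlMl// mulrC (lt_le_trans tv)//.
  by rewrite ge_min lexx orbT.
have := hr h; rewrite -ball_normE /= sub0r normrN => /(_ hr').
rewrite -/J {1}/h addrCA subrr addr0 (inverseK Vt) (inverseK Vy) addrK => est.
rewrite -/h.
have -> : v *m invmx J - t^-1 *: h = t^-1 *: ((t *: v - h *m J) *m invmx J).
  have e1 : (t *: v) *m invmx J = t *: (v *m invmx J) by rewrite scalemxAl.
  have e2 : t^-1 *: (t *: (v *m invmx J)) = v *m invmx J.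
    by rewrite scalerA mulVf// scale1r.
  by rewrite mulmxBl e1 mulmxK// [RHS]scalerBr e2.
rewrite normrZ normfV ler_pdivrMl ?normr_gt0//.
apply: (le_trans (hC _)).
apply: (@le_trans _ _ (C * (e' * (L * `|t *: v|)))).
  rewrite ler_pM2l//; apply: (le_trans est); rewrite ler_pM2l//.
rewrite normrZ; apply: (@le_trans _ _ (`|t| * (e' * (C * (L * (`|v| + 1)))))); last first.
  by rewrite /e' divfK// gt_eqF// !mulr_gt0.
rewrite [leLHS](_ : _ = `|t| * (e' * (C * (L * `|v|)))); last by ring.
by rewrite ler_wpM2l// ler_pM2l// ler_pM2l// ler_pM2l// lerDl.
Qed.

Lemma inverse_comp_is_derive (W : E -> R) y v : V y -> differentiable W (G y) ->
  is_derive y v (fun z => W (G z))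
    (\sum_j (v *m invmx (jac F (G y))) ord0 j * partial j W (G y)).
Proof.
move=> Vy dW; have dG := inverse_is_derive v Vy.
have Gy0 : G (y + 0 *: v) = G y by rewrite scale0r addr0.
have dG0 : derivable G (y + 0 *: v) v by rewrite scale0r addr0; have [] := dG.
have dg := is_derive_line dG0; rewrite scale0r addr0 (@derive_val _ _ _ _ _ _ _ dG) in dg.
have [dg1 dg2] := dg.
have difg : differentiable (fun s : R => G (y + s *: v)) 0 by exact/derivable1_diffP.
have dW' : differentiable W ((fun s : R => G (y + s *: v)) 0) by rewrite Gy0.
have dWg := differentiable_comp difg dW'.
have dWg1 : derivable (W \o (fun s : R => G (y + s *: v))) 0 1 by exact/derivable1_diffP.
have E1 : 'D_1 (W \o (fun s : R => G (y + s *: v))) 0 =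
    \sum_j (v *m invmx (jac F (G y))) ord0 j * partial j W (G y).
  have dg3 : 'd (fun s : R => G (y + s *: v)) 0 (1 : R) = v *m invmx (jac F (G y)).
    by rewrite -deriveE.
  by rewrite deriveE// diff_comp//= dg3 Gy0 -derive_partials// deriveE.
have lq := line_quotient (fun z => W (G z)) y v 0.
rewrite scale0r addr0 in lq.
apply: DeriveDef.
  by rewrite /derivable -lq; move: dWg1; rewrite /derivable /= scale0r addr0.
rewrite /derive -lq -E1 /derive /=; by rewrite scale0r addr0.
Qed.

(** These functions are stable under partial derivation because the entries of
    the Jacobian matrix of [G] at [y] are smooth functions of [G y]. *)
Definition pulled (f : E -> R) :=
  exists2 W, smooth Q W & forall y, V y -> f y = W (G y).

Lemma pulled_continuous f y : pulled f -> V y -> {for y, continuous f}.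
Proof.
move=> [W sW fE] Vy; apply: (@near_eq_continuous _ _ _ (fun z => W (G z))).
  by apply: near_rVS (near_open image_open Vy) => z /fE.
apply: (@continuous_comp _ _ _ G W); first exact: inverse_continuous.
by apply: (smooth_continuous sW); exact: inverse_in.
Qed.

Lemma pulled_is_derive f i : pulled f -> exists2 W, smooth Q W &
  forall y, V y -> is_derive y (delta_mx ord0 i : E) f (W (G y)).
Proof.
move=> [W sW fE].
have /choice[Wj Wjh] : forall j, exists Wj, smooth Q Wj /\
    forall x, Q x -> partial j W x = Wj x.
  by move=> j; have [g sg gE] := smooth_partial j sW; exists g.
have sJ k l : smooth setT (fun x => jac F x k l).
  have -> : (fun x => jac F x k l) = partial k (fun y => F y ord0 l).
    by apply/funext => x; rewrite mxE.
  exact: smoothT_partial.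
have sJQ k l : smooth Q (fun x => jac F x k l) by exact: smooth_subset (sJ k l).
have uJ x : Q x -> jac F x \in unitmx.
  by move=> Qx; have := @inverse_jac_unit (F x); rewrite GF//; apply; exists x.
have /choice[Mj Mjh] : forall j, exists Mj, smooth Q Mj /\
    forall x, Q x -> Mj x = invmx (jac F x) i j.
  by move=> j; have [g sg gE] := smooth_invmx sJQ uJ i j; exists g.
exists (fun x => \sum_j Mj j x * Wj j x).
  by apply: smooth_sum => j _; apply: smoothM; [have [] := Mjh j|have [] := Wjh j].
move=> y Vy; have Qy := inverse_in Vy.
have -> : \sum_j Mj j (G y) * Wj j (G y) =
  \sum_j ((delta_mx ord0 i : E) *m invmx (jac F (G y))) ord0 j * partial j W (G y).
  apply: eq_bigr => j _; have [_ ->//] := Wjh j; have [_ ->//] := Mjh j.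
  by rewrite -rowE mxE.
apply: (@near_eq_is_derive _ _ _ (fun z => W (G z))).
  by apply: near_rVS (near_open image_open Vy) => z /fE.
apply: inverse_comp_is_derive => //.
exact: (smooth_differentiable sW).
Qed.

Lemma pulled_derivable f i y : pulled f -> V y ->
  derivable f y (delta_mx ord0 i : E).
Proof. by move=> /(pulled_is_derive i)[W _ h] /h[]. Qed.

Lemma pulled_partial f i : pulled f -> pulled (partial i f).
Proof.
move=> /(pulled_is_derive i)[W sW h]; exists W => // y /h dy.
by rewrite /partial derive_val.
Qed.

End inverse_function.

(** * Bounded gradients and Lipschitz domains *)

Section domain_geometry.
Context {R : realType} {d : nat}.
Local Notation E := 'rV[R]_d.

Lemma lipschitz_bound (A : set E) (f : E -> E) :
  (exists k : R, k.-lipschitz_A f) ->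
  exists2 L : R, 0 < L & forall x y, A x -> A y -> `|f x - f y| <= L * `|x - y|.
Proof.
move=> [k lk]; exists (`|k| + 1); first by rewrite ltr_pwDr.
move=> x y Ax Ay; apply: (le_trans (lk (x, y) (conj Ax Ay))).
by rewrite ler_wpM2r// (le_trans (ler_norm _))// lerDl.
Qed.

Lemma smooth_lipschitz (p : E -> R) (M : R) : smooth setT p ->
  exists2 L : R, 0 <= L & forall x y, `|x| <= M -> `|y| <= M ->
    `|p x - p y| <= L * `|x - y|.
Proof.
move=> sp; have cp j : continuous (partial j p).
  exact/smoothT_continuous/smoothT_partial.
have /choice[B hB] : forall j, exists B : R, 0 <= B /\ forall x : E, `|x| <= M -> `|partial j p x| <= B.
  by move=> j; have [B B0 h] := continuous_bounded_on_ball M (cp j); exists B.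
exists (\sum_j B j); first by apply: sumr_ge0 => j _; have [] := hB j.
move=> y x yM xM; pose v := y - x.
have dl (t : R) : is_derive t (1 : R) (fun s => p (x + s *: v)) ('D_v p (x + t *: v)).
  by apply: is_derive_line; exact: smoothT_derivable.
have cl : {within `[0, 1], continuous (fun s : R => p (x + s *: v))}.
  by apply: derivable_within_continuous => t _; have [] := dl t.
have [t] := @MVT_segment R _ _ 0 1 ler01 (fun t _ => dl t) cl.
rewrite in_itv /= => /andP[t0 t1].
have -> : x + 1 *: v = y by rewrite scale1r /v addrC subrK.
rewrite scale0r addr0 subr0 mulr1 => ->.
have xt : `|x + t *: v| <= M.
  have -> : x + t *: v = (1 - t) *: x + t *: y.
    by rewrite /v scalerBr scalerBl scale1r addrA addrAC.
  apply: (le_trans (ler_normD _ _)); rewrite !normrZ (ger0_norm t0) ger0_norm ?subr_ge0//.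
  by move: xM yM t0 t1; clear; move=> *; nra.
rewrite derive_partials; last exact: (smooth_differentiable sp).
apply: (le_trans (ler_norm_sum _ _ _)); rewrite mulr_suml; apply: ler_sum => j _.
rewrite normrM mulrC; apply: ler_pM => //; last exact: coord_le_norm.
by have [_] := hB j; apply.
Qed.

Lemma norm_delta_le1 (j : 'I_d) : `|delta_mx ord0 j : E| <= 1.
Proof.
apply/rV_norm_le => // i; rewrite mxE eqxx /=.
by case: (i == j); rewrite ?normr1 ?normr0.
Qed.

(** At each point y, one of the smooth pieces takes the values of the function
    at points of the line through y that are arbitrarily close to y; by
    continuity it also takes the value at y, so that its Lipschitz constant
    bounds the derivative. *)
Lemma piecewise_gradient_bound (A : set E) (G : E -> E) (s U : E -> R) (M L : R) :
  open A -> C1_on A U -> piecewise_smooth s ->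
  (forall y, A y -> `|G y| <= M) ->
  (forall x y, A x -> A y -> `|G x - G y| <= L * `|x - y|) -> 0 < L ->
  (forall y, A y -> U y = s (G y)) ->
  exists B : R, forall y j, A y -> `|U y| <= B /\ `|partial j U y| <= B.
Proof.
move=> oA CU [I [g [sg sE]]] GM GL L0 UE.
have /choice[K hK] : forall i, exists K : R, 0 <= K /\ forall x y, `|x| <= M ->
    `|y| <= M -> `|g i x - g i y| <= K * `|x - y|.
  by move=> i; have [K K0 h] := smooth_lipschitz M (sg i); exists K.
have /choice[B hB] : forall i, exists B : R, 0 <= B /\ forall x : E, `|x| <= M -> `|g i x| <= B.
  move=> i; have cg : continuous (g i) by exact: smoothT_continuous.
  by have [B B0 h] := continuous_bounded_on_ball M cg; exists B.
have KK i : K i <= \sum_i K i.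
  by rewrite (bigD1 i)//= lerDl sumr_ge0// => k _; have [] := hK k.
have BB i : B i <= \sum_i B i.
  by rewrite (bigD1 i)//= lerDl sumr_ge0// => k _; have [] := hB k.
have K0 : 0 <= \sum_i K i by apply: sumr_ge0 => k _; have [] := hK k.
have B0 : 0 <= \sum_i B i by apply: sumr_ge0 => k _; have [] := hB k.
exists (\sum_i B i + (\sum_i K i) * L) => y j Ay; split.
  have [i e] := sE (G y); rewrite UE// e.
  have [_ h] := hB i; apply: (le_trans (h _ (GM _ Ay))).
  by rewrite (le_trans (BB i))// lerDl mulr_ge0// ltW.
have [cU /(_ j)[dU _]] := CU y Ay.
set e := (delta_mx ord0 j : E) in dU *.
have line0 (P : E -> Prop) : (\forall z \near y, P z) ->
    \forall t \near (0 : R)^', P (t *: e + y).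
  move=> /nbhs_ballP[r /= r0 hr].
  have : \forall t \near (0 : R)^', `|t| < r by exact: dnbhs0_lt.
  apply: filterS => t tr; apply: hr; rewrite -ball_normE /= opprD addrCA subrr addr0 normrN normrZ.
  by apply: le_lt_trans tr; rewrite ler_piMr// norm_delta_le1.
(* otherwise each piece would be avoided near y, which is impossible as there are
   finitely many of them *)
have [i hi] : exists i, forall P : R -> Prop, (\forall t \near (0 : R)^', P t) ->
    exists2 t, P t & s (G (t *: e + y)) = g i (G (t *: e + y)).
  apply: contrapT => /forallNP h.
  have /choice[P hP] : forall i, exists P : R -> Prop, (\forall t \near (0 : R)^', P t) /\
      forall t, P t -> s (G (t *: e + y)) <> g i (G (t *: e + y)).
    move=> i; have /existsNP[P /not_implyP[P1 P2]] := h i; exists P; split => // t Pt st.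
    by apply: P2; exists t.
  have : \forall t \near (0 : R)^', forall i, P i t.
    by apply: filter_forall => i; have [] := hP i.
  move=> h1; have [t Pt] := @filter_ex _ (0 : R)^' _ _ h1; have [i si] := sE (G (t *: e + y)).
  by have [_ /(_ t (Pt i))] := hP i.
have [Ki0 hKi] := hK i.
have est t : A (t *: e + y) -> s (G (t *: e + y)) = g i (G (t *: e + y)) ->
    `|U (t *: e + y) - g i (G y)| <= (\sum_i K i) * L * `|t|.
  move=> At st; rewrite UE// st.
  apply: (le_trans (hKi _ _ (GM _ At) (GM _ Ay))).
  apply: (@le_trans _ _ ((\sum_i K i) * (L * `|t|))); last by rewrite mulrA.
  apply: ler_pM => //; apply: (le_trans (GL _ _ At Ay)); rewrite addrK normrZ ler_pM2l//.
  by rewrite ler_piMr// norm_delta_le1.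
have Ug : U y = g i (G y).
  apply/eqP; rewrite -subr_eq0 -normr_le0; apply/ler_addgt0Pl => eps eps0; rewrite addr0.
  have c0 : 0 < (\sum_i K i) * L + 1 by rewrite ltr_wpDl// mulr_ge0// ltW.
  have N1 : \forall t \near (0 : R)^', `|t| < eps / 2 / ((\sum_i K i) * L + 1).
    by apply: dnbhs0_lt; rewrite !divr_gt0.
  have N2 : \forall t \near (0 : R)^', A (t *: e + y) by apply: line0; exact: near_open.
  have N3 : \forall t \near (0 : R)^', `|U y - U (t *: e + y)| < eps / 2.
    apply: (line0 (fun z => `|U y - U z| < eps / 2)).
    by have /(@cvgrPdist_lt _ _ _ _ (nbhs_filter y)) := cU; apply; rewrite divr_gt0.
  have [t [t1 [t2 t3]] st] := hi _ (filterI N1 (filterI N2 N3)).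
  have h1 := est t t2 st.
  rewrite -(subrKA (U (t *: e + y))); apply: (le_trans (ler_normD _ _)).
  have h2 : (\sum_i K i) * L * `|t| <= eps / 2.
    move: t1; rewrite ltr_pdivlMr// mulrC => /ltW; apply: le_trans.
    by rewrite ler_wpM2r// lerDl.
  by move: h1 h2 t3; clear; move=> *; lra.
rewrite leNgt; apply/negP => big.
have : \forall t \near (0 : R)^', \sum_i B i + (\sum_i K i) * L <
    `|t^-1 *: (U (t *: e + y) - U y)|.
  have h : (fun t : R => `|t^-1 *: (U (t *: e + y) - U y)|) @ (0 : R)^' --> `|partial j U y|.
    by apply: cvg_norm; exact: dU.
  exact: (cvgr_gt _ h).
have N2 : \forall t \near (0 : R)^', A (t *: e + y) by apply: line0; exact: near_open.
have N3 : \forall t \near (0 : R)^', t != 0 by exact: nbhs_dnbhs_neq.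
move=> N1; have [t [t1 [t2 t3]] st] := hi _ (filterI N1 (filterI N2 N3)).
have h1 := est t t2 st; rewrite -Ug in h1.
move: t1; rewrite normrZ normfV ltr_pdivlMl ?normr_gt0// => t1.
have : 0 <= (\sum_i B i) * `|t| by rewrite mulr_ge0.
by move: t1 h1; clear; move=> *; lra.
Qed.

Lemma norm_col'_le (x : E) j : `|col' j x| <= `|x|.
Proof. by apply/rV_norm_le => // i; rewrite mxE coord_le_norm. Qed.

(** A Lipschitz domain lies on one side of its boundary. *)
Lemma lipschitz_domain_interior (A : set E) x : bounded_lipschitz_domain A ->
  (closure A)° x -> A x.
Proof.
move=> [_ oA _ _ lA] xA; apply: contrapT => nAx.
have bx : bdry A x.
  split; first exact: interior_subset.
  by move=> /interior_subset.
have [P [j [gam [k [PP lk eqv]]]]] := lA x bx.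
have /nbhs_ballP[r /= r0 hr] : \forall y \near x, (A y <-> gam (col' j (y *m P)) < (y *m P) ord0 j)
    /\ closure A y by apply: (@filterI _ _ (nbhs_filter x)).
have [C C0 hC] := mulmx_norm_bound P.
have xg : (x *m P) ord0 j <= gam (col' j (x *m P)).
  rewrite leNgt; apply/negP => h; apply: nAx.
  by have [hx _] := hr x (ballxx x r0); apply/hx.
(* moving from x down the j-th coordinate axis reaches points that are strictly
   below the graph, and yet in the closure of A *)
pose e : E := (delta_mx ord0 j : E) *m P^T.
have eP : e *m P = delta_mx ord0 j.
  by rewrite -mulmxA (mulmx1C PP) mulmx1.
have e1 : 0 < `|e| + 1 by rewrite ltr_wpDl.
pose t := r / 2 / (`|e| + 1).
have t0 : 0 < t by rewrite !divr_gt0.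
have ter : `|t *: e| < r / 2 + r / 4.
  rewrite normrZ gtr0_norm//; apply: (@le_lt_trans _ _ (t * (`|e| + 1))).
    by rewrite ler_pM2l// lerDl.
  by rewrite /t divfK ?gt_eqF//; move: r0; clear; move=> *; lra.
pose y := x - t *: e.
have yr : ball x r y.
  rewrite -ball_normE /= /y opprB addrCA subrr addr0 (lt_trans ter)//.
  by move: r0; clear; move=> *; lra.
have [_ cy] := hr y yr.
have k1 : 0 < C * (`|k| + 1) by rewrite mulr_gt0// ltr_wpDl.
pose eta := Num.min (r / 4) (t / (C * (`|k| + 1))).
have eta0 : 0 < eta by rewrite lt_min !divr_gt0.
have [z [Az yz]] : A `&` ball y eta !=set0 by apply: cy; exact: nbhsx_ballx.
have nyz : `|z - y| < eta by move: yz; rewrite -ball_normE /= distrC.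
have zr : ball x r z.
  rewrite -ball_normE /= -(subrKA y); apply: (le_lt_trans (ler_normD _ _)).
  have h1 : `|x - y| < r / 2 + r / 4 by rewrite /y opprB addrCA subrr addr0.
  have h2 : `|y - z| < r / 4 by rewrite distrC (lt_le_trans nyz)// ge_min lexx.
  by move: h1 h2; clear; move=> *; lra.
have [[/(_ Az) h _] _] := hr z zr.
have zyP : `|z *m P - y *m P| <= C * eta.
  by rewrite -mulmxBl (le_trans (hC _))// ler_pM2l// ltW.
have yPj : (y *m P) ord0 j = (x *m P) ord0 j - t.
  by rewrite /y mulmxBl -scalemxAl eP !mxE !eqxx mulr1.
have yPc : col' j (y *m P) = col' j (x *m P).
  apply/rowP => i; rewrite /y mulmxBl -scalemxAl eP !mxE eqxx /=.
  by rewrite eq_sym (negbTE (neq_lift _ _)) mulr0 subr0.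
have h1 : (z *m P) ord0 j <= (x *m P) ord0 j - t + C * eta.
  rewrite -yPj -lerBlDl; apply: le_trans zyP.
  have := coord_le_norm (z *m P - y *m P) j; rewrite !mxE; apply: le_trans.
  by rewrite ler_norm.
have h2 : gam (col' j (x *m P)) - `|k| * (C * eta) <= gam (col' j (z *m P)).
  have := lk (col' j (z *m P), col' j (y *m P)) (conj I I); rewrite /= yPc => hk.
  rewrite lerBlDr -lerBlDl; apply: le_trans (ler_norm _) _; rewrite distrC.
  apply: (le_trans hk); apply: (@le_trans _ _ (`|k| * `|col' j (z *m P) - col' j (x *m P)|)).
    by rewrite ler_wpM2r// ler_norm.
  rewrite ler_wpM2l//; apply: le_trans zyP; rewrite -yPc.
  have -> : col' j (z *m P) - col' j (y *m P) = col' j (z *m P - y *m P).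
    by apply/rowP => i; rewrite !mxE.
  exact: norm_col'_le.
have h3 : C * eta * (`|k| + 1) <= t.
  have : eta <= t / (C * (`|k| + 1)) by rewrite ge_min lexx orbT.
  by rewrite ler_pdivlMr// mulrA [eta * C]mulrC.
by move: xg h h1 h2 h3; clear; move=> *; lra.
Qed.

End domain_geometry.

(** * Norm equivalence on finite-dimensional spaces *)

Section quadratic_lower_bound.
Context {R : realType}.

(** The constant is the minimum of [g] on the unit sphere, which is compact. *)
Lemma quadratic_lower_bound (m : nat) (g : 'rV[R]_m -> R) :
  continuous g -> (forall (t : R) c, g (t *: c) = t ^+ 2 * g c) ->
  (forall c, c != 0 -> 0 < g c) ->
  exists2 lam : R, 0 < lam & forall c, lam * `|c| ^+ 2 <= g c.
Proof.
move=> cg gZ g0; pose Sph := [set c : 'rV[R]_m | `|c| = 1].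
have g00 : g 0 = 0 by have := gZ 0 0; rewrite scale0r expr0n mul0r.
have [ne|/set0P/negP/negPn/eqP emp] := pselect (Sph !=set0); last first.
  exists 1 => // c; suff -> : c = 0 by rewrite normr0 expr0n mulr0 g00.
  apply/eqP; apply: contrapT => /negP c0.
  have : Sph (`|c|^-1 *: c).
    by rewrite /Sph /= normrZ normfV normr_id mulVf// normr_eq0.
  by rewrite emp.
have cS : compact Sph.
  apply: (subclosed_compact _ (@compact_closed_ball_rV R m 1)); last first.
    by move=> c /= ->.
  apply: (@closed_comp _ _ (fun x : 'rV[R]_m => `|x|) [set y | y = 1]).
    by move=> x _; exact: norm_continuous.
  exact: closed_eq.
have [|c0 /set_mem Sc0 min0] := EVT_min_rV ne cS (f := g).
  exact: continuous_subspaceT.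
have c0n0 : c0 != 0 by rewrite -normr_eq0 Sc0 oner_eq0.
exists (g c0); first exact: g0.
move=> c; have [->|cn0] := eqVneq c 0; first by rewrite normr0 expr0n mulr0 g00.
have nc : `|c| != 0 by rewrite normr_eq0.
have -> : c = `|c| *: (`|c|^-1 *: c) by rewrite scalerA divff// scale1r.
rewrite gZ normrZ normr_id [`|_^-1 *: c|](_ : _ = 1); last first.
  by rewrite normrZ normfV normr_id mulVf.
rewrite mulr1 mulrC ler_wpM2l ?sqr_ge0//; apply: min0.
by rewrite inE /Sph /= normrZ normfV normr_id mulVf.
Qed.

End quadratic_lower_bound.

Section spans.
Context {R : realType} {d : nat}.
Local Notation E := 'rV[R]_d.
Local Notation mu := (lebesgue_rV R d).

Lemma Rintegral_sum (D : set E) (I : Type) (s : seq I) (F : I -> E -> R) :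
  measurable D -> (forall i, mu.-integrable D (EFin \o F i)) ->
  mu.-integrable D (EFin \o (fun x => \sum_(i <- s) F i x)) /\
  \int[mu]_(x in D) (\sum_(i <- s) F i x) = \sum_(i <- s) \int[mu]_(x in D) F i x.
Proof.
move=> mD iF; elim: s => [|i s [IH1 IH2]].
  have -> : (fun x => \sum_(i <- [::]) F i x) = (fun=> 0) :> (E -> R).
    by apply/funext => x; rewrite big_nil.
  by rewrite big_nil /Rintegral integral0; split => //; exact: integrable0.
have -> : (fun x => \sum_(k <- i :: s) F k x) = (fun x => F i x + \sum_(k <- s) F k x).
  by apply/funext => x; rewrite big_cons.
rewrite big_cons; split; last by rewrite RintegralD// IH2.
exact: (integrableD mD (iF i) IH1).
Qed.

Variables (m : nat) (e : 'I_m -> E -> R).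

Definition lincomb (c : 'rV[R]_m) (x : E) : R := \sum_k c ord0 k * e k x.

Lemma lincombZ t c x : lincomb (t *: c) x = t * lincomb c x.
Proof. by rewrite /lincomb mulr_sumr; apply: eq_bigr => k _; rewrite mxE mulrA. Qed.

Lemma smooth_lincomb D c : (forall k, smooth D (e k)) -> smooth D (lincomb c).
Proof.
by move=> se; apply: smooth_sum => k _; apply: smoothM => //; exact: smooth_cst.
Qed.

Lemma lincomb_bound (f : 'I_m -> E -> R) (B : R) (c : 'rV[R]_m) (x : E) : (forall k, `|f k x| <= B) ->
  `|\sum_k c ord0 k * f k x| <= m%:R * B * `|c|.
Proof.
move=> fB; apply: (le_trans (ler_norm_sum _ _ _)).
apply: (@le_trans _ _ (\sum_(k < m) B * `|c|)); last first.
  by rewrite sumr_const card_ord -mulrA mulr_natl.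
apply: ler_sum => k _; rewrite normrM mulrC; apply: ler_pM => //.
exact: coord_le_norm.
Qed.

Lemma positive_integral (D : set E) (f : E -> R) (x0 : E) : open D -> D x0 ->
  (forall x, D x -> 0 <= f x) -> {for x0, continuous f} -> 0 < f x0 ->
  mu.-integrable D (EFin \o f) -> 0 < \int[mu]_(x in D) f x.
Proof.
move=> oD Dx0 f0 cf fx0 If; have mD := open_measurable_rV oD.
have : \forall x \near x0, D x /\ f x0 / 2 < f x.
  apply: (@filterI _ _ (nbhs_filter x0)); first exact: near_open.
  apply: (@cvgr_gt R E (nbhs x0) _ _ (f x0) cf).
  by rewrite ltr_pdivrMr// ltr_pMr// ltr1n.
move=> /nbhs_ballP[r /= r0 hr].
have sub : cube x0 r `<=` [set x | D x /\ f x0 / 2 < f x].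
  by move=> x /(cubeE _ _ r0) xr; apply: hr; rewrite -ball_normE /= distrC.
have mC : measurable (cube x0 r) by exact: measurable_box.
have CD : cube x0 r `<=` D by move=> x /sub[].
have h1 : \int[mu]_(x in cube x0 r) (f x0 / 2) <= \int[mu]_(x in D) f x.
  apply: (@le_trans _ _ (\int[mu]_(x in cube x0 r) f x)).
    apply: le_Rintegral => //.
    - apply: (@integrable_bounded _ _ _ _ `|f x0 / 2|) => //.
      exact: lebesgue_cube_fin.
    - exact: integrableS If.
    - by move=> x /sub[_ /ltW].
  apply: fine_le.
  - by apply: integrable_fin_num => //; exact: integrableS If.
  - exact: integrable_fin_num.
  - apply: ge0_subset_integral => //.
    by case/integrableP: If.
have muC : fine (mu (cube x0 r)) = (2 * r) ^+ d.
  by rewrite [X in fine X](lebesgue_cube x0 (ltW r0)).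
have h2 : 0 < \int[mu]_(x in cube x0 r) (f x0 / 2).
  by rewrite Rintegral_cst// muC mulr_gt0 ?divr_gt0// exprn_gt0// mulr_gt0.
exact: lt_le_trans h2 h1.
Qed.

End spans.

Section gram.
Context {R : realType} {d : nat}.
Local Notation E := 'rV[R]_d.
Local Notation mu := (lebesgue_rV R d).
Variables (m : nat) (e : 'I_m -> E -> R).
Hypothesis se : forall k, smooth setT (e k).

Definition independent_on (O : set E) :=
  forall c : 'rV[R]_m, (forall x, O x -> lincomb e c x = 0) -> c = 0.

Lemma partial_lincomb (f : 'I_m -> E -> R) (c : 'rV[R]_m) j x :
  (forall k, smooth setT (f k)) ->
  partial j (fun y => \sum_k c ord0 k * f k y) x = \sum_k c ord0 k * partial j (f k) x.
Proof.
move=> sf.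
have -> : (fun y => \sum_k c ord0 k * f k y) = \sum_k (c ord0 k \*: f k).
  by apply/funext => y; rewrite fct_sumE.
have df k : is_derive x (delta_mx ord0 j : E) (f k) (partial j (f k) x).
  by apply: DeriveDef => //; exact: smoothT_derivable.
have dS := @is_derive_sum _ _ _ _ _ x (delta_mx ord0 j : E) _
  (fun k => is_deriveZ (c ord0 k) (df k)).
by rewrite /partial (@derive_val _ _ _ _ _ _ _ dS).
Qed.

Lemma Rintegral_cube_bound (f : E -> R) (A B : R) : 0 <= A ->
  measurable_fun (cube 0 A) f -> (forall x, cube 0 A x -> `|f x| <= B) ->
  \int[mu]_(x in cube 0 A) (f x ^+ 2) <= B ^+ 2 * (2 * A) ^+ d.
Proof.
move=> A0 mf fB; have mC : measurable (cube (0 : E) A) by exact: measurable_box.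
have h x : cube 0 A x -> f x ^+ 2 <= B ^+ 2.
  move=> /fB fx; rewrite -real_normK ?num_real// lerXn2r ?nnegrE//.
  exact: le_trans fx.
apply: (@le_trans _ _ (\int[mu]_(x in cube 0 A) (B ^+ 2))).
  apply: le_Rintegral => //.
  - apply: (@integrable_bounded _ _ _ _ (B ^+ 2)) => //; first exact: lebesgue_cube_fin.
      exact: measurable_funX.
    by move=> x Cx; rewrite ger0_norm ?sqr_ge0// h.
  - apply: (@integrable_bounded _ _ _ _ `|B ^+ 2|) => //.
    exact: lebesgue_cube_fin.
rewrite Rintegral_cst//.
by have -> : fine (mu (cube 0 A)) = (2 * A) ^+ d by rewrite [X in fine X](lebesgue_cube 0 A0).
Qed.

(** As functions of the coefficients, the integral on the right is a positive
    definite quadratic form, while those on the left are at most a multiple of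
    the squared norm. *)
Lemma span_norm_equivalence (psi : E -> R) (O : set E) (A : R) :
  smooth setT psi -> open O -> 0 < A -> (forall x, O x -> `|x| <= 1) ->
  (forall x, O x -> 0 < psi x) -> (forall x, 0 <= psi x) ->
  (forall x, ~ O x -> psi x = 0) -> independent_on O ->
  exists2 K : R, 0 <= K & forall c,
    \int[mu]_(x in cube 0 A) (lincomb e c x ^+ 2) <=
      K * \int[mu]_x (psi x * lincomb e c x ^+ 2) /\
    forall j, \int[mu]_x (partial j (fun y => psi y * lincomb e c y) x ^+ 2) <=
      K * \int[mu]_x (psi x * lincomb e c x ^+ 2).
Proof.
move=> spsi oO A0 O1 psi0 psige0 psiO ind.
have supp x : 1 < `|x| -> psi x = 0.
  by move=> x1; apply: psiO => /O1; rewrite leNgt x1.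
have cS := @smoothT_continuous R d.
have Ipsi f : smooth setT f -> mu.-integrable setT (EFin \o (fun x => psi x * f x)).
  move=> sf; apply: (@continuous_support_integrable _ _ _ 1).
    by apply: cS; exact: smoothM.
  by move=> x /supp ->; rewrite mul0r.
pose G k l := \int[mu]_x (psi x * (e k x * e l x)).
pose g (c : 'rV[R]_m) := \int[mu]_x (psi x * lincomb e c x ^+ 2).
have gE c : g c = \sum_k c ord0 k * \sum_l c ord0 l * G k l.
  have Il k l : mu.-integrable setT (EFin \o (fun x => c ord0 l * (psi x * (e k x * e l x)))).
    exact: (integrableZl measurableT (c ord0 l) (Ipsi _ (smoothM (se k) (se l)))).
  have Is k : mu.-integrable setT
      (EFin \o (fun x => \sum_l c ord0 l * (psi x * (e k x * e l x)))).
    by have [] := Rintegral_sum (index_enum _) measurableT (Il k).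
  have -> : g c = \int[mu]_x (\sum_k c ord0 k *
      \sum_l c ord0 l * (psi x * (e k x * e l x))).
    apply: eq_Rintegral => x _; rewrite /lincomb expr2 mulr_suml mulr_sumr.
    apply: eq_bigr => k _; rewrite !mulr_sumr; apply: eq_bigr => l _; ring.
  have [_ ->] := Rintegral_sum (index_enum _) measurableT
    (fun k => integrableZl measurableT (c ord0 k) (Is k)).
  apply: eq_bigr => k _; rewrite RintegralZl//; congr (_ * _).
  have [_ ->] := Rintegral_sum (index_enum _) measurableT (Il k).
  apply: eq_bigr => l _; rewrite RintegralZl//.
  by apply: Ipsi; exact: smoothM.
have cg : continuous g.
  have sg : smooth setT (fun c : 'rV[R]_m => \sum_k c ord0 k * \sum_l c ord0 l * G k l).
    apply: smooth_sum => k _; apply: smoothM; first exact: smooth_coord.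
    apply: smooth_sum => l _; apply: smoothM; first exact: smooth_coord.
    exact: smooth_cst.
  have -> : g = (fun c : 'rV[R]_m => \sum_k c ord0 k * \sum_l c ord0 l * G k l).
    by apply/funext => c; exact: gE.
  exact: smoothT_continuous.
have sl c : smooth setT (lincomb e c) by exact: smooth_lincomb.
have gZ (t : R) c : g (t *: c) = t ^+ 2 * g c.
  rewrite /g -RintegralZl//; last by apply: Ipsi; exact: smoothX.
  by apply: eq_Rintegral => x _; rewrite lincombZ exprMn mulrCA.
have gpos c : c != 0 -> 0 < g c.
  move=> c0; have [x Ox cx] : exists2 x, O x & lincomb e c x != 0.
    apply: contrapT => h; move/eqP: c0; apply; apply: ind => x Ox.
    by apply: contrapT => /eqP cx; apply: h; exists x.
  apply: (@positive_integral R d setT (fun x => psi x * lincomb e c x ^+ 2) x) => //.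
  - exact: openT.
  - by move=> y _; rewrite mulr_ge0 ?sqr_ge0.
  - by apply: cS; apply: smoothM => //; exact: smoothX.
  - by rewrite mulr_gt0 ?psi0// exprn_even_gt0.
  - by apply: Ipsi; exact: smoothX.
have [lam lam0 glam] := quadratic_lower_bound cg gZ gpos.
have /choice[B hB] : forall k, exists B : R, 0 <= B /\ forall x : E, `|x| <= A -> `|e k x| <= B.
  by move=> k; have [B B0 h] := @continuous_bounded_on_ball R d (e k) A (cS _ (se k)); exists B.
have spe k : smooth setT (fun y => psi y * e k y) by exact: smoothM.
have /choice[B' hB'] : forall p : 'I_d * 'I_m, exists B : R, 0 <= B /\ forall x : E,
    `|partial p.1 (fun y => psi y * e p.2 y) x| <= B.
  move=> [j k] /=; have sp := smoothT_partial j (spe k).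
  have [|B0 B00 h] := @continuous_support_bounded _ _ _ 1 (cS _ sp); last by exists B0.
  by apply: derive_support => x /supp ->; rewrite mul0r.
pose Bs := \sum_k B k; pose Bs' := \sum_p B' p.
have Bs0 : 0 <= Bs by apply: sumr_ge0 => k _; have [] := hB k.
have Bs'0 : 0 <= Bs' by apply: sumr_ge0 => k _; have [] := hB' k.
have leB k : B k <= Bs.
  by rewrite /Bs (bigD1 k)//= lerDl sumr_ge0// => l _; have [] := hB l.
have leB' p : B' p <= Bs'.
  by rewrite /Bs' (bigD1 p)//= lerDl sumr_ge0// => l _; have [] := hB' l.
pose K1 := (m%:R * Bs) ^+ 2 * (2 * A) ^+ d / lam.
pose K2 := (m%:R * Bs') ^+ 2 * (2 * 2) ^+ d / lam.
have K10 : 0 <= K1 by rewrite !mulr_ge0 ?invr_ge0 ?exprn_ge0 ?mulr_ge0// ltW.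
have K20 : 0 <= K2 by rewrite !mulr_ge0 ?invr_ge0 ?exprn_ge0 ?mulr_ge0// ltW.
have g0 c : 0 <= g c.
  by apply: Rintegral_ge0 => x _; rewrite mulr_ge0 ?sqr_ge0.
have N1 : 0 <= (m%:R * Bs) ^+ 2 * (2 * A) ^+ d.
  by apply: mulr_ge0; [exact: sqr_ge0 | apply: exprn_ge0; rewrite mulr_ge0// ltW].
have N2 : 0 <= (m%:R * Bs') ^+ 2 * (2 * 2) ^+ d.
  by apply: mulr_ge0; [exact: sqr_ge0 | apply: exprn_ge0; rewrite mulr_ge0].
have scale (K c2 : R) c : 0 <= K -> c2 <= K * `|c| ^+ 2 -> c2 <= K / lam * g c.
  move=> K0 /le_trans; apply; rewrite -mulrA ler_wpM2l//.
  by rewrite ler_pdivlMl// glam.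
exists (K1 + K2); first exact: addr_ge0.
move=> c; rewrite -/(g c); split.
  apply: (@le_trans _ _ (K1 * g c)); last by rewrite ler_wpM2r// lerDl.
  apply: (scale _ _ c N1).
  rewrite mulrAC -exprMn; apply: Rintegral_cube_bound.
  - exact: ltW.
  - exact: smoothT_measurable.
  - move=> x /(cubeE _ _ A0); rewrite subr0 => xA; apply: lincomb_bound => k.
  by have [_ h] := hB k; rewrite (le_trans (h _ (ltW xA))).
move=> j; apply: (@le_trans _ _ (K2 * g c)); last by rewrite ler_wpM2r// lerDr.
have -> : (fun y => psi y * lincomb e c y) = (fun y => \sum_k c ord0 k * (psi y * e k y)).
  by apply/funext => y; rewrite /lincomb mulr_sumr; apply: eq_bigr => k _; rewrite mulrCA.
under eq_Rintegral do rewrite (partial_lincomb _ _ _ spe).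
rewrite -(@Rintegral_support _ _ (cube 0 2) [set x | `|x| <= 1]).
- apply: (scale _ _ c N2).
  rewrite mulrAC -exprMn; apply: Rintegral_cube_bound => //.
    apply: smoothT_measurable; apply: smooth_sum => k _; apply: smoothM; first exact: smooth_cst.
    exact: smoothT_partial.
  move=> x _.
  apply: (@lincomb_bound R d m (fun k => partial j (fun y => psi y * e k y)) Bs' c x) => k.
  by have [_ h] := hB' (j, k); exact: le_trans (h x) (leB' (j, k)).
- by move=> x /= x1; apply/cubeE => //; rewrite subr0 (le_lt_trans x1)// ltr1n.
- move=> x /= /negP; rewrite -ltNge => x1; rewrite big1 ?expr0n// => k _.
  rewrite /partial (@derive_support _ _ (fun y => psi y * e k y) _ 1) ?mulr0// => y /supp ->.
  by rewrite mul0r.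
Qed.

End gram.

(** * Polynomials *)

Section polynomials.
Context {R : realType} {d : nat}.
Local Notation E := 'rV[R]_d.
Local Notation exponent := {ffun 'I_d -> nat}.

Definition monomial (k : exponent) (x : E) : R := \prod_j x ord0 j ^+ k j.

Lemma smooth_monomial k D : smooth D (monomial k).
Proof. by apply: smooth_prod => j _; apply: smoothX; exact: smooth_coord. Qed.

Lemma tensor_polyP (n : 'I_d -> nat) : exists r : seq exponent,
  [/\ uniq r, forall k, k \in r <-> forall j, (k j <= n j)%N &
      forall q : E -> R, tensor_poly n q <->
        exists c : exponent -> R, q = fun x => \sum_(k <- r) c k * monomial k x].
Proof.
have fin := finite_multi_indices n.
exists (finmap.enum_fset (fset_set [set k : exponent | forall j, (k j <= n j)%N])); split.
- exact: finmap.fset_uniq.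
- by move=> k; rewrite in_fset_set// inE.
- by move=> q; split=> -[c ->]; exists c; apply/funext => x; rewrite fsbig_finite.
Qed.

Lemma tensor_poly0 n : tensor_poly n ((fun=> 0) : E -> R).
Proof.
have [r [_ _ rP]] := tensor_polyP n; apply/rP; exists (fun=> 0).
by apply/funext => x; rewrite big1// => k _; rewrite mul0r.
Qed.

Lemma tensor_polyD n (p q : E -> R) : tensor_poly n p -> tensor_poly n q ->
  tensor_poly n (fun x => p x + q x).
Proof.
have [r [ur rn rP]] := tensor_polyP n.
move=> /rP[c ->] /rP[c' ->]; apply/rP; exists (fun k => c k + c' k).
by apply/funext => x; rewrite -big_split; apply: eq_bigr => k _; rewrite mulrDl.
Qed.

Lemma tensor_polyZ n (a : R) (p : E -> R) : tensor_poly n p ->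
  tensor_poly n (fun x => a * p x).
Proof.
have [r [ur rn rP]] := tensor_polyP n.
move=> /rP[c ->]; apply/rP; exists (fun k => a * c k).
by apply/funext => x; rewrite mulr_sumr; apply: eq_bigr => k _; rewrite mulrA.
Qed.

Lemma tensor_poly_monomial n (k : exponent) : (forall j, (k j <= n j)%N) ->
  tensor_poly n (monomial k : E -> R).
Proof.
have [r [ur rn rP]] := tensor_polyP n; move=> /rn kr.
apply/rP; exists (fun k' => (k' == k)%:R); apply/funext => x.
rewrite (bigD1_seq k)//= eqxx mul1r big1 ?addr0// => k' /negPf ->.
by rewrite mul0r.
Qed.

Lemma tensor_poly_sum n (I : Type) (s : seq I) (P : pred I) (F : I -> E -> R) :
  (forall i, P i -> tensor_poly n (F i)) ->
  tensor_poly n (fun x => \sum_(i <- s | P i) F i x).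
Proof.
by apply: (big_pointwise_closed (C := tensor_poly n)); [exact: tensor_poly0|exact: tensor_polyD].
Qed.

Lemma tensor_poly_sub n n' (p : E -> R) : (forall j, (n j <= n' j)%N) ->
  tensor_poly n p -> tensor_poly n' p.
Proof.
move=> nn'; have [r [ur rn rP]] := tensor_polyP n.
move=> /rP[c ->]; under eq_fun do rewrite big_seq_cond.
apply: tensor_poly_sum => k /andP[/rn kn _].
apply: tensor_polyZ; apply: tensor_poly_monomial => j.
exact: leq_trans (kn j) (nn' j).
Qed.

Lemma smooth_tensor_poly n (p : E -> R) D : tensor_poly n p -> smooth D p.
Proof.
have [r [ur rn rP]] := tensor_polyP n.
move=> /rP[c ->]; apply: smooth_sum => k _; apply: smoothM; first exact: smooth_cst.
exact: smooth_monomial.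
Qed.

(** Each univariate factor is expanded, and the product of the sums is
    distributed. *)
Lemma tensor_poly_affine N (q : E -> R) (y0 : E) (l : R) :
  tensor_poly (fun=> N) q -> tensor_poly (fun=> N) (fun z => q (y0 + l *: z)).
Proof.
have [r [ur rn rP]] := tensor_polyP (fun=> N).
move=> /rP[c ->] /=; under [X in tensor_poly _ X]eq_fun do rewrite big_seq_cond.
apply: tensor_poly_sum => k /andP[/rn kN _]; apply: tensor_polyZ.
pose P j : {poly R} := ((y0 ord0 j)%:P + l *: 'X) ^+ k j.
have sP j : (size (P j) <= N.+1)%N.
  apply: leq_trans (size_exp_leq _ _) _; rewrite ltnS.
  apply: leq_trans (kN j); rewrite -[leqRHS]mul1n leq_mul2r; apply/orP; right.
  rewrite -subn1 leq_subLR; apply: leq_trans (size_polyD _ _) _.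
  rewrite geq_max (leq_trans (size_polyC_leq1 _))//=.
  by rewrite (leq_trans (size_scale_leq _ _))// size_polyX.
have -> : (fun z : E => monomial k (y0 + l *: z)) = fun z =>
    \sum_(f : {ffun 'I_d -> 'I_N.+1}) (\prod_j (P j)`_(f j)) *
      monomial [ffun j => val (f j)] z.
  apply/funext => z; transitivity (\prod_j \sum_(i < N.+1) (P j)`_i * z ord0 j ^+ i).
    apply: eq_bigr => j _; rewrite -horner_coef_wide// /P !hornerE !mxE.
    by [].
  rewrite bigA_distr_bigA /=; apply: eq_bigr => f _; rewrite /monomial -big_split /=.
  by apply: eq_bigr => j _; rewrite ffunE.
apply: tensor_poly_sum => f _; apply: tensor_polyZ; apply: tensor_poly_monomial => j.
by rewrite ffunE /= -ltnS.
Qed.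

(** The weights are the entries of the inverse Vandermonde matrix. *)
Lemma vandermonde_dual N (t : 'I_N -> R) : injective t ->
  exists W : nat -> 'I_N -> R, forall k k', (k < N)%N -> (k' < N)%N ->
    \sum_i t i ^+ k * W k' i = (k == k')%:R.
Proof.
move=> tI; pose V := Vandermonde N (\row_i t i).
have uV : V \in unitmx.
  rewrite unitmxE det_Vandermonde unitfE; apply/prodf_neq0 => i _.
  apply/prodf_neq0 => j ij; rewrite !mxE subr_eq0; apply/eqP => /tI ji.
  by rewrite ji ltnn in ij.
exists (fun k' i => if insub k' is Some k then invmx V i k else 0) => k k' kN k'N.
have := congr1 (fun M : 'M[R]_N => M (Ordinal kN) (Ordinal k'N)) (mulmxV uV).
rewrite /= !mxE => VV; rewrite insubT.
by rewrite -[RHS]VV; apply: eq_bigr => i _; rewrite !mxE.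
Qed.

(** Summing the values on a grid of points against products of dual weights
    extracts a single coefficient. *)
Lemma monomial_independent (r : seq exponent) (c : exponent -> R) (a b : 'I_d -> R) :
  uniq r -> (forall j, a j < b j) ->
  (forall x, box a b x -> \sum_(k <- r) c k * monomial k x = 0) ->
  forall k, k \in r -> c k = 0.
Proof.
move=> ur ab h k0 k0r.
pose N := (\max_(k <- r) \max_j k j).+1%N.
have rN k j : k \in r -> (k j < N)%N.
  move=> kr; rewrite ltnS; apply: leq_trans (leq_bigmax_seq _ kr isT).
  exact: (leq_bigmax (F := fun j => k j)).
have N0 : 0 < N.+1%:R :> R by [].
pose t j (i : 'I_N) := a j + (b j - a j) * (i.+1%:R / N.+1%:R).
have tI j : injective (t j).
  move=> i i' /addrI/(mulfI _) hh; have {hh} := hh _.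
  rewrite subr_eq0 gt_eqF// => /(_ isT) /(divIf _) hh; have {hh} := hh _.
  rewrite gt_eqF// => /(_ isT) /eqP; rewrite eqr_nat eqSS => /eqP ii'.
  exact: val_inj.
have /choice[W hW] := fun j => vandermonde_dual (tI j).
have tbox (g : {ffun 'I_d -> 'I_N}) : box a b (\row_j t j (g j)).
  move=> j; rewrite mxE /t; have bj : 0 < b j - a j by rewrite subr_gt0.
  rewrite ltrDl mulr_gt0 ?divr_gt0//= addrC -ltrBrDr gtr_pMr//.
  by rewrite ltr_pdivrMr// mul1r ltr_nat ltnS ltn_ord.
have : \sum_(g : {ffun 'I_d -> 'I_N}) (\prod_j W j (k0 j) (g j)) *
    \sum_(k <- r) c k * monomial k (\row_j t j (g j)) = 0.
  by apply: big1 => g _; rewrite h ?mulr0.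
under eq_bigr do rewrite mulr_sumr.
rewrite exchange_big /= (bigD1_seq k0)//= => <-.
have inner k : k \in r -> \sum_(g : {ffun 'I_d -> 'I_N}) (\prod_j W j (k0 j) (g j)) *
    (c k * monomial k (\row_j t j (g j))) = c k * \prod_j (k j == k0 j)%:R.
  move=> kr; transitivity (c k * \sum_(g : {ffun 'I_d -> 'I_N})
      \prod_j (t j (g j) ^+ k j * W j (k0 j) (g j))).
    rewrite mulr_sumr; apply: eq_bigr => g _; rewrite mulrCA; congr (_ * _).
    rewrite big_split /= mulrC; congr (_ * _).
    by apply: eq_bigr => j _; rewrite mxE.
  rewrite -(bigA_distr_bigA (fun j i => t j i ^+ k j * W j (k0 j) i)); congr (_ * _).
  by apply: eq_bigr => j _; rewrite hW ?rN.
rewrite inner// big1 => [|j _]; last by rewrite eqxx.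
rewrite mulr1 big_seq_cond big1 ?addr0// => k /andP[kr kk0].
rewrite inner//; have [j kj] : exists j, k j != k0 j.
  apply: contrapT => /forallNP hh; move/eqP: kk0; apply; apply/ffunP => j.
  by apply/eqP; apply: contrapT => /negP; exact: hh.
by rewrite (bigD1 j)//= (negPf kj) mul0r mulr0.
Qed.

Section basis.
Variable r : seq exponent.

Definition monomial_basis (i : 'I_(size r)) : E -> R := monomial (nth [ffun=> 0%N] r i).

Lemma smooth_monomial_basis i : smooth setT (monomial_basis i).
Proof. exact: smooth_monomial. Qed.

Lemma monomial_combE (c : exponent -> R) (x : E) : \sum_(k <- r) c k * monomial k x =
  lincomb monomial_basis (\row_i c (nth [ffun=> 0%N] r i)) x.
Proof.
by rewrite (big_nth [ffun=> 0%N]) big_mkord; apply: eq_bigr => i _; rewrite mxE.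
Qed.

Lemma lincomb_monomialE (c : 'rV[R]_(size r)) : uniq r -> exists c' : exponent -> R,
  c = \row_i c' (nth [ffun=> 0%N] r i).
Proof.
move=> ur; exists (fun k => if insub (index k r) is Some i then c ord0 i else 0).
apply/rowP => i; rewrite mxE index_uniq//.
by rewrite insubT//= => p; congr (c _ _); exact: val_inj.
Qed.

Lemma monomial_basis_independent (O : set E) (a b : 'I_d -> R) : uniq r ->
  (forall j, a j < b j) -> box a b `<=` O -> independent_on monomial_basis O.
Proof.
move=> ur ab bO c h; have [c' cE] := lincomb_monomialE c ur; rewrite cE.
have c'0 := @monomial_independent r c' a b ur ab _.
apply/rowP => i; rewrite !mxE c'0 ?mem_nth// => x /bO/h.
by rewrite cE monomial_combE.
Qed.

End basis.

(** The default value of the projection is the zero polynomial. *)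
Lemma tensor_poly_L2proj n (Q : set E) (g : E -> R) : tensor_poly n (L2proj n Q g).
Proof.
rewrite /L2proj; case: xgetP => [p _ []//|_].
exact: tensor_poly0.
Qed.

End polynomials.

(** * Bubble functions *)

Section dilation.
Context {R : realType} {d : nat}.
Local Notation E := 'rV[R]_d.
Local Notation mu := (lebesgue_rV R d).

Lemma Rintegral_dilate (c : E) (r : R) (f : E -> R) : 0 < r ->
  measurable_fun setT f -> (forall x, 0 <= f x) ->
  \int[mu]_x f (r^-1 *: (x - c)) = r ^+ d * \int[mu]_x f x.
Proof.
move=> r0 mf f0; rewrite /Rintegral.
rewrite (@integral_dilate _ _ c r (EFin \o f))//=.
- case: (\int[mu]_x (f x)%:E)%E => [s||] //=.
  + by rewrite mulry gtr0_sg ?exprn_gt0// mul1e /= mulr0.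
  + by rewrite mulrNy gtr0_sg ?exprn_gt0// mul1e /= mulr0.
- exact/measurable_EFinP.
Qed.

Lemma partial_dilate (f : E -> R) (y0 y : E) (l : R) j : smooth setT f ->
  partial j (fun y => f (l^-1 *: (y - y0))) y = l^-1 * partial j f (l^-1 *: (y - y0)).
Proof.
move=> sf; set z := l^-1 *: (y - y0).
have df : differentiable f z by exact: (@smooth_differentiable _ _ setT _ sf z I).
transitivity ('D_(l^-1 *: delta_mx ord0 j : E) f z).
  rewrite /partial /derive; congr (lim (_ @ 0^')); apply/funext => h /=.
  congr (_ *: (f _ - _)); rewrite /z -addrA scalerDr !scalerA; congr (_ + _).
  by rewrite mulrC.
by rewrite deriveE// linearZ /= /partial deriveE.
Qed.

Definition bubble (y0 : E) (l : R) (y : E) : R :=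
  bump 1 (fun=> - 1) (fun=> 1) (l^-1 *: (y - y0)).

Lemma smooth_bubble y0 l D : smooth D (bubble y0 l).
Proof.
by apply: (@smooth_subset _ _ _ setT) => //; apply: smooth_dilate; exact: smooth_bump.
Qed.

Lemma unit_boxE (z : E) : box (fun=> - 1) (fun=> 1) z <-> `|z| < 1.
Proof.
rewrite rV_norm_lt//; split=> h j; have := h j; first by rewrite ltr_norml.
by rewrite ltr_norml.
Qed.

Lemma bubble_ge0 y0 l y : 0 <= bubble y0 l y.
Proof. exact: bump_ge0. Qed.

Lemma bubble_le1 y0 l y : bubble y0 l y <= 1.
Proof. exact: bump_le1. Qed.

Lemma bubble_eq0 y0 l y : 0 < l -> ~ cube y0 l y -> bubble y0 l y = 0.
Proof.
move=> l0 ny; apply: bump_eq0 => /unit_boxE; rewrite normrZ normfV gtr0_norm//.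
by rewrite ltr_pdivrMl// mulr1 => h; apply: ny; apply/cubeE.
Qed.

(** Norm equivalence on the polynomials of bounded degree, transported from the
    unit cube to all cubes by dilations. *)
Lemma bubble_inequalities (N : nat) (A : R) : 0 < A -> exists2 K : R, 0 <= K &
  forall (q : E -> R) (y0 : E) (l : R), tensor_poly (fun=> N) q -> 0 < l ->
    \int[mu]_(y in cube y0 (A * l)) (q y ^+ 2) <=
      K * \int[mu]_y (bubble y0 l y * q y ^+ 2) /\
    forall j, \int[mu]_y (partial j (fun y => bubble y0 l y * q y) y ^+ 2) <=
      K * l^-1 ^+ 2 * \int[mu]_y (bubble y0 l y * q y ^+ 2).
Proof.
move=> A0; have [r [ur rn rP]] := @tensor_polyP R d (fun=> N).
pose psi := bump 1 (fun=> - 1) (fun=> 1) : E -> R.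
have spsi : smooth setT psi by exact: smooth_bump.
have ind : independent_on (@monomial_basis R d r) (box (fun=> - 1) (fun=> 1)).
  by apply: monomial_basis_independent ur _ (@subset_refl _ _) => j; lra.
have [K K0 hK] := @span_norm_equivalence R d _ (@monomial_basis R d r)
  (@smooth_monomial_basis R d r) psi (box (fun=> - 1) (fun=> 1)) A spsi
  (@box_open _ _ _ _) A0 (fun x h => ltW ((unit_boxE x).1 h)) (fun x h => bump_gt0 1 h)
  (fun x => bump_ge0 _ _ _ x) (fun x h => bump_eq0 1 h)
  ind.
exists K => // q y0 l Pq l0.
have /rP[c pE] := tensor_poly_affine y0 l Pq.
pose p z := q (y0 + l *: z).
have [c' {}pE] : exists c', p = lincomb (@monomial_basis R d r) c'.
  exists (\row_i c (nth [ffun=> 0%N] r i)); rewrite /p pE.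
  by apply/funext => x; rewrite monomial_combE.
have [h1 h2] := hK c'; rewrite -pE in h1 h2.
have sp : smooth setT p.
  by rewrite pE; apply: smooth_lincomb; exact: smooth_monomial_basis.
have qE y : q y = p (l^-1 *: (y - y0)).
  by rewrite /p scalerA divff ?gt_eqF// scale1r addrC subrK.
have ld : 0 < l ^+ d by rewrite exprn_gt0.
have I1 : \int[mu]_y (bubble y0 l y * q y ^+ 2) =
    l ^+ d * \int[mu]_x (psi x * p x ^+ 2).
  rewrite -(Rintegral_dilate y0 l0).
  - by apply: eq_Rintegral => y _; rewrite -qE.
  - by apply: smoothT_measurable; apply: smoothM => //; exact: smoothX.
  - by move=> x; rewrite mulr_ge0 ?sqr_ge0// bump_ge0.
split.
  have -> : \int[mu]_(y in cube y0 (A * l)) (q y ^+ 2) =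
      l ^+ d * \int[mu]_(x in cube 0 A) (p x ^+ 2).
    rewrite [in RHS]Rintegral_mkcond -(Rintegral_dilate y0 l0).
    - rewrite Rintegral_mkcond; apply: eq_Rintegral => y _; rewrite /patch -qE.
      congr (if _ then _ else _); apply/idP/idP; rewrite !inE.
        move=> /cubeE; rewrite mulr_gt0// => /(_ isT) h; apply/cubeE => //.
        by rewrite subr0 normrZ normfV gtr0_norm// ltr_pdivrMl// mulrC.
      move=> /(cubeE _ _ A0); rewrite subr0 normrZ normfV gtr0_norm// ltr_pdivrMl// => h.
      by apply/cubeE; rewrite ?mulr_gt0// mulrC.
    - apply/(measurable_restrictT _ _).1; first exact: measurable_box.
      by apply: smoothT_measurable; exact: smoothX.
    - by move=> x; rewrite /patch; case: ifP => // _; exact: sqr_ge0.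
  by rewrite I1 mulrCA ler_pM2l.
move=> j; have -> : (fun y => bubble y0 l y * q y) =
    (fun y => (fun x => psi x * p x) (l^-1 *: (y - y0))).
  by apply/funext => y /=; rewrite -qE.
have spp : smooth setT (fun x => psi x * p x) by exact: smoothM.
under eq_Rintegral do rewrite (partial_dilate y0 _ l j spp) exprMn.
rewrite (Rintegral_dilate y0 l0 (f := fun x => l^-1 ^+ 2 * partial j (fun x => psi x * p x) x ^+ 2)).
- rewrite RintegralZl//.
    have l2 : 0 < l^-1 ^+ 2 by rewrite exprn_gt0 ?invr_gt0.
    have -> : K * l^-1 ^+ 2 * \int[mu]_y (bubble y0 l y * q y ^+ 2) =
        l ^+ d * (l^-1 ^+ 2 * (K * \int[mu]_x (psi x * p x ^+ 2))) by rewrite I1; ring.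
    by rewrite ler_pM2l// ler_pM2l.
  apply: (@continuous_support_integrable _ _ _ 1).
    exact/smoothT_continuous/smoothX/smoothT_partial.
  move=> x x1; rewrite /partial (@derive_support _ _ _ _ 1) ?expr0n// => y y1.
  rewrite [psi y]bump_eq0 ?mul0r// => /unit_boxE.
  by rewrite ltNge ltW.
- by apply: smoothT_measurable; apply: smoothM; [exact: smooth_cst|apply: smoothX; exact: smoothT_partial].
- by move=> x; rewrite mulr_ge0 ?sqr_ge0.
Qed.

End dilation.

(** * The estimate on one element *)

Section cauchy_schwarz.
Context {R : realType} {d : nat}.
Local Notation E := 'rV[R]_d.
Local Notation mu := (lebesgue_rV R d).

(** A quadratic polynomial without sign change has nonpositive discriminant; the
    degenerate case [c] = 0 is an affine function bounded below. *)
Lemma discriminant_bound (a b c : R) : 0 <= a -> 0 <= c ->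
  (forall t, 0 <= a - 2 * t * b + t ^+ 2 * c) -> `|b| <= Num.sqrt a * Num.sqrt c.
Proof.
move=> a0 c0 h; rewrite -sqrtrM// -sqrtr_sqr ler_wsqrtr//.
have [c00|cn0] := eqVneq c 0.
  have [->|bn0] := eqVneq b 0; first by rewrite expr0n mulr_ge0.
  exfalso; have := h ((a + 1) / (2 * b)).
  rewrite c00 mulr0 addr0 (_ : 2 * ((a + 1) / (2 * b)) * b = a + 1); last by field.
  by clear -a0; lra.
have cp : 0 < c by rewrite lt_def cn0.
have := h (b / c).
rewrite (_ : a - 2 * (b / c) * b + (b / c) ^+ 2 * c = (a * c - b ^+ 2) / c); last by field.
by rewrite pmulr_lge0 ?invr_gt0// subr_ge0.
Qed.

Lemma Rintegral_sqr_ge0 (A : set E) (f : E -> R) : 0 <= \int[mu]_(x in A) (f x ^+ 2).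
Proof. by apply: Rintegral_ge0 => x _; exact: sqr_ge0. Qed.

Lemma dot_ge0 (x : E) : 0 <= dot x x.
Proof. by apply: sumr_ge0 => j _; rewrite -expr2 sqr_ge0. Qed.

Lemma Rintegral_dot_ge0 (A : set E) (g : E -> E) : 0 <= \int[mu]_(x in A) dot (g x) (g x).
Proof. by apply: Rintegral_ge0 => x _; exact: dot_ge0. Qed.

Lemma dot_cauchy_schwarz (A : set E) (g h : E -> E) : measurable A ->
  (forall j, L2 A (fun x => g x ord0 j)) -> (forall j, L2 A (fun x => h x ord0 j)) ->
  `|\int[mu]_(x in A) dot (g x) (h x)| <=
    Num.sqrt (\int[mu]_(x in A) dot (g x) (g x)) *
    Num.sqrt (\int[mu]_(x in A) dot (h x) (h x)).
Proof.
move=> mA lg lh; apply: discriminant_bound; try exact: Rintegral_dot_ge0.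
move=> t; have Igg := dot_integrable mA lg lg; have Igh := dot_integrable mA lg lh.
have Ihh := dot_integrable mA lh lh.
have -> : \int[mu]_(x in A) dot (g x) (g x) - 2 * t * \int[mu]_(x in A) dot (g x) (h x) +
    t ^+ 2 * \int[mu]_(x in A) dot (h x) (h x) =
    \int[mu]_(x in A) dot (g x - t *: h x) (g x - t *: h x).
  have I1 := integrableZl mA (2 * t) Igh; have I2 := integrableZl mA (t ^+ 2) Ihh.
  rewrite -RintegralZl// -RintegralZl// -RintegralB//.
  have I3 := integrableB mA Igg I1.
  rewrite -RintegralD//; apply: eq_Rintegral => x _.
  rewrite /dot !mulr_sumr -sumrB -big_split /=; apply: eq_bigr => j _.
  by rewrite !mxE; ring.
exact: Rintegral_dot_ge0.
Qed.

Lemma cauchy_schwarz (A : set E) (f g : E -> R) : measurable A -> L2 A f -> L2 A g ->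
  `|\int[mu]_(x in A) (f x * g x)| <= L2norm A f * L2norm A g.
Proof.
move=> mA lf lg; apply: discriminant_bound; try exact: Rintegral_sqr_ge0.
move=> t; have Iff := L2_sqr_integrable mA lf; have Igg := L2_sqr_integrable mA lg.
have Ifg := L2_mul_integrable mA lf lg.
have -> : \int[mu]_(x in A) (f x ^+ 2) - 2 * t * \int[mu]_(x in A) (f x * g x) +
    t ^+ 2 * \int[mu]_(x in A) (g x ^+ 2) = \int[mu]_(x in A) ((f x - t * g x) ^+ 2).
  have I1 := integrableZl mA (2 * t) Ifg; have I2 := integrableZl mA (t ^+ 2) Igg.
  rewrite -RintegralZl// -RintegralZl// -RintegralB//.
  have I3 := integrableB mA Iff I1.
  rewrite -RintegralD//; apply: eq_Rintegral => x _; ring.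
exact: Rintegral_sqr_ge0.
Qed.

Lemma L2norm_ge0 (A : set E) (f : E -> R) : 0 <= L2norm A f.
Proof. exact: sqrtr_ge0. Qed.

Lemma L2norm_sqr (A : set E) (f : E -> R) : L2norm A f ^+ 2 = \int[mu]_(x in A) (f x ^+ 2).
Proof. by rewrite sqr_sqrtr// Rintegral_sqr_ge0. Qed.

Lemma minkowski (A : set E) (f g : E -> R) : measurable A -> L2 A f -> L2 A g ->
  L2norm A (fun x => f x + g x) <= L2norm A f + L2norm A g.
Proof.
move=> mA lf lg; have := cauchy_schwarz mA lf lg.
have f0 := L2norm_ge0 A f; have g0 := L2norm_ge0 A g => h.
rewrite -(@ler_pXn2r _ 2) ?nnegrE ?addr_ge0 ?L2norm_ge0// L2norm_sqr.
have Iff := L2_sqr_integrable mA lf; have Igg := L2_sqr_integrable mA lg.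
have Ifg := L2_mul_integrable mA lf lg.
have -> : \int[mu]_(x in A) ((f x + g x) ^+ 2) =
    L2norm A f ^+ 2 + 2 * \int[mu]_(x in A) (f x * g x) + L2norm A g ^+ 2.
  have I1 := integrableZl mA 2 Ifg.
  have I3 := integrableD mA Iff I1.
  rewrite !L2norm_sqr -RintegralZl// -RintegralD// -RintegralD//.
  by apply: eq_Rintegral => x _; ring.
have := le_trans (ler_norm _) h.
move: (\int[mu]_(x in A) (f x * g x)) (L2norm A f) (L2norm A g) => I a b Iab.
rewrite sqrrD -mulr_natl; lra.
Qed.

End cauchy_schwarz.

Section bubble_estimate.
Context {R : realType} {d : nat}.
Local Notation E := 'rV[R]_d.
Local Notation mu := (lebesgue_rV R d).

(** With s^2 = int bubble p^2, the inequalities for bubbles bound the norm of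
    [p] by a multiple of s, and splitting s^2 into int r v and int (p - r) v
    for v = bubble p bounds s^2 by s times the right-hand side, up to a factor
    [l]. *)
Lemma bubble_estimate (n : 'I_d -> nat) (A : R) : 0 < A ->
  exists2 K : R, 0 <= K & forall (Q : set E) (y0 : E) (l : R) (r p : E -> R) (G : R),
    open Q -> 0 < l -> ccube y0 l `<=` Q -> Q `<=` cube y0 (A * l) ->
    L2 Q r -> tensor_poly n p -> 0 <= G ->
    \int[mu]_(x in Q) (r x * (bubble y0 l x * p x)) <= G *
      Num.sqrt (\sum_j \int[mu]_x (partial j (fun y => bubble y0 l y * p y) x ^+ 2)) ->
    l * L2norm Q r <= K * (G + l * L2norm Q (r - p)).
Proof.
move=> A0; pose N := (\max_j n j)%N.
have [K K0 hK] := @bubble_inequalities R d N A A0.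
pose k1 := Num.sqrt K; pose k2 := Num.sqrt (d%:R * K).
exists (k1 * k2 + (k1 + 1)); first by rewrite addr_ge0 ?addr_ge0 ?mulr_ge0 ?sqrtr_ge0.
move=> Q y0 l r p G oQ l0 lQ QA lr Pp G0 hG.
have mQ := open_measurable_rV oQ.
have [|h1 h2] := hK p y0 l _ l0.
  by apply: tensor_poly_sub Pp => j; exact: (leq_bigmax j).
set s2 := \int[mu]_y (bubble y0 l y * p y ^+ 2) in h1 h2.
have s20 : 0 <= s2.
  by apply: Rintegral_ge0 => x _; rewrite mulr_ge0 ?sqr_ge0 ?bubble_ge0.
pose s := Num.sqrt s2; have s0 : 0 <= s by exact: sqrtr_ge0.
have sE : s ^+ 2 = s2 by rewrite sqr_sqrtr.
have sp : smooth setT p by exact: smooth_tensor_poly Pp.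
have sb : smooth setT (bubble y0 l) by exact: smooth_bubble.
have Al : 0 < A * l by rewrite mulr_gt0.
have mC : measurable (cube y0 (A * l)) by exact: measurable_box.
have CM x : cube y0 (A * l) x -> `|x| <= `|y0| + A * l.
  move=> /(cubeE _ _ Al)/ltW h; rewrite -(subrK y0 x) (le_trans (ler_normD _ _))//.
  by rewrite addrC lerD2l.
have lC f : smooth setT f -> L2 (cube y0 (A * l)) f.
  move=> sf; have [|B B0 hB] := @continuous_bounded_on_ball R d f (`|y0| + A * l).
    exact: smoothT_continuous.
  apply: (@L2_bounded _ _ _ _ B) => // [||x /CM/hB//]; first exact: lebesgue_cube_fin.
  exact: smoothT_measurable.
have lS f : smooth setT f -> L2 Q f by move=> /lC; exact: L2_sub.
have lp := lS _ sp; have lv := lS _ (smoothM sb sp).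
have lrp : L2 Q (fun x => r x - p x) by apply: L2_sum => //; exact: L2_opp.
have Qs x : ~ Q x -> bubble y0 l x = 0.
  move=> nQ; apply: bubble_eq0 => // c; apply/nQ/lQ => j.
  by have /andP[/ltW-> /ltW->] := c j.
have s2Q : s2 = \int[mu]_(x in Q) (bubble y0 l x * p x ^+ 2).
  rewrite (@Rintegral_support _ _ Q Q)// => x nQ.
  by rewrite Qs// mul0r.
have normp : L2norm Q p <= k1 * s.
  rewrite /k1 /s -sqrtrM// ler_wsqrtr//; apply: le_trans h1.
  apply: fine_le.
  - by apply: integrable_fin_num => //; exact: L2_sqr_integrable.
  - by apply: integrable_fin_num => //; apply: L2_sqr_integrable => //; exact: lC.
  - apply: ge0_subset_integral => //.
      apply/measurable_EFinP; apply: smoothT_measurable; exact: smoothX.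
    by move=> x _; rewrite lee_fin sqr_ge0.
have normv : L2norm Q (fun x => bubble y0 l x * p x) <= s.
  rewrite /s ler_wsqrtr// s2Q; apply: le_Rintegral => //.
  - exact: L2_sqr_integrable.
  - have := L2_mul_integrable mQ lp lv; apply: eq_integrable => // x _ /=.
    by congr EFin; ring.
  - move=> x _; rewrite exprMn ler_wpM2r ?sqr_ge0// expr2 ler_piMr ?bubble_ge0//.
    exact: bubble_le1.
have key : s ^+ 2 <= G * (k2 * l^-1 * s) + L2norm Q (r - p) * s.
  have -> : s ^+ 2 = \int[mu]_(x in Q) (r x * (bubble y0 l x * p x)) +
      - \int[mu]_(x in Q) ((r x - p x) * (bubble y0 l x * p x)).
    have I1 := L2_mul_integrable mQ lr lv; have I2 := L2_mul_integrable mQ lrp lv.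
    rewrite sE s2Q -RintegralB//; apply: eq_Rintegral => x _; ring.
  apply: lerD.
    apply: (le_trans hG); rewrite ler_wpM2l//.
    have -> : k2 * l^-1 * s = Num.sqrt (d%:R * K * l^-1 ^+ 2 * s2).
      have dK : 0 <= d%:R * K by rewrite mulr_ge0.
      rewrite [RHS]sqrtrM; last by rewrite mulr_ge0// sqr_ge0.
      by rewrite (sqrtrM _ dK) sqrtr_sqr ger0_norm// invr_ge0 ltW.
    rewrite ler_wsqrtr//; apply: (@le_trans _ _ (\sum_(j < d) K * l^-1 ^+ 2 * s2)).
      by apply: ler_sum => j _; exact: h2.
    rewrite sumr_const card_ord -[leLHS]mulr_natl -!mulrA; exact: lexx.
  apply: (le_trans (ler_norm _)); rewrite normrN.
  apply: (le_trans (cauchy_schwarz mQ lrp lv)); rewrite ler_wpM2l//.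
  exact: L2norm_ge0.
have sb1 : s <= G * (k2 * l^-1) + L2norm Q (r - p).
  have [->|sn0] := eqVneq s 0.
    by rewrite addr_ge0 ?L2norm_ge0// !mulr_ge0 ?sqrtr_ge0// invr_ge0 ltW.
  have sp0 : 0 < s by rewrite lt_def sn0.
  by rewrite -(ler_pM2r sp0) -expr2 (le_trans key)// mulrDl !mulrA.
have rE : r = (fun x => (r - p) x + p x) by apply/funext => x; rewrite /= subrK.
have h3 : L2norm Q r <= L2norm Q (r - p) + L2norm Q p.
  by rewrite {1}rE; exact: minkowski.
have k10 : 0 <= k1 by exact: sqrtr_ge0.
have k20 : 0 <= k2 by exact: sqrtr_ge0.
have n0 : 0 <= L2norm Q (r - p) by exact: L2norm_ge0.
have h4 : l * L2norm Q r <= l * (L2norm Q (r - p) + k1 * (G * (k2 * l^-1) + L2norm Q (r - p))).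
  rewrite ler_pM2l// (le_trans h3)// lerD2l (le_trans normp)// ler_wpM2l//.
apply: (le_trans h4).
have -> : l * (L2norm Q (r - p) + k1 * (G * (k2 * l^-1) + L2norm Q (r - p))) =
  k1 * k2 * G + (k1 + 1) * (l * L2norm Q (r - p)) by field; rewrite gt_eqF.
rewrite mulrDr lerD//.
  by rewrite ler_wpM2r// lerDl addr_ge0.
by rewrite ler_wpM2r ?mulr_ge0 ?(ltW l0)// lerDr mulr_ge0.
Qed.

End bubble_estimate.

(** * The residual on one element *)

Section local_identity.
Context {R : realType} {d : nat}.
Local Notation E := 'rV[R]_d.
Local Notation mu := (lebesgue_rV R d).
Variables (Omega : set E) (A : E -> 'M[R]_d) (eta1 eta2 : R).
Hypothesis oO : open Omega.
Hypothesis Ael : elliptic Omega A eta1 eta2.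

Lemma mxapp_coord (M : 'M[R]_d) (xi : E) i :
  mxapp M xi ord0 i = \sum_k M i k * xi ord0 k.
Proof. by rewrite /mxapp mxE; apply: eq_bigr => k _; rewrite mxE mulrC. Qed.

Lemma mxappD (M : 'M[R]_d) (x y : E) : mxapp M (x + y) = mxapp M x + mxapp M y.
Proof. by rewrite /mxapp mulmxDl. Qed.

Lemma dotDl (x y z : E) : dot (x + y) z = dot x z + dot y z.
Proof. by rewrite /dot -big_split; apply: eq_bigr => j _; rewrite mxE mulrDl. Qed.

Lemma coord_le_enorm (x : E) i : `|x ord0 i| <= enorm x.
Proof.
rewrite -sqrtr_sqr /enorm ler_wsqrtr// /dot (bigD1 i)//= -expr2 lerDl.
by apply: sumr_ge0 => j _; rewrite -expr2 sqr_ge0.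
Qed.

Lemma enorm_delta (k : 'I_d) : enorm (delta_mx ord0 k : E) = 1.
Proof.
rewrite /enorm /dot (bigD1 k)//= big1 => [|j jk]; last by rewrite mxE (negPf jk) andbF mul0r.
by rewrite mxE !eqxx mul1r addr0 sqrtr1.
Qed.

(** Ellipticity bounds the columns of the matrix. *)
Lemma coefficient_bound x i k : Omega x -> `|A x i k| <= eta2.
Proof.
move=> Ox; have [_ _ h] := Ael; have [_ hk] := h x (delta_mx ord0 k) Ox.
rewrite enorm_delta mulr1 in hk; apply: le_trans hk.
apply: le_trans (coord_le_enorm _ i).
rewrite mxapp_coord (bigD1 k)//= big1 => [|j jk]; last by rewrite mxE (negPf jk) andbF mulr0.
by rewrite mxE !eqxx mulr1 addr0.
Qed.

Lemma coefficient_C1 i k : C1_on Omega (fun x => A x i k).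
Proof.
have [_ h _] := Ael; have [sA _] := h i k => x Ox.
have [c0 d0] := sA [::] x Ox; split => // j; split; first exact: d0.
by have [] := sA [:: j] x Ox.
Qed.

Lemma mxapp_L2 (Q : set E) (g : E -> E) i : open Q -> Q `<=` Omega ->
  (forall j, L2 Q (fun x => g x ord0 j)) -> L2 Q (fun x => mxapp (A x) (g x) ord0 i).
Proof.
move=> oQ QO lg; under eq_fun do rewrite mxapp_coord.
have mQ := open_measurable_rV oQ.
elim: (index_enum _) => [|k s IH].
  under eq_fun do rewrite big_nil.
  by split; [exact: measurable_cst|rewrite expr0n /= integral0].
under eq_fun do rewrite big_cons; apply: L2_sum => //.
apply: (@L2_mul_bounded _ _ _ _ _ eta2) => //.
  by apply: continuous_measurable_rV => // x /QO/(coefficient_C1 i k)[].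
by move=> x /QO; exact: coefficient_bound.
Qed.

Lemma mxapp_norm (Q : set E) (g : E -> E) : open Q -> Q `<=` Omega ->
  (forall j, L2 Q (fun x => g x ord0 j)) ->
  Num.sqrt (\int[mu]_(x in Q) dot (mxapp (A x) (g x)) (mxapp (A x) (g x))) <=
  eta2 * Num.sqrt (\int[mu]_(x in Q) dot (g x) (g x)).
Proof.
move=> oQ QO lg; have mQ := open_measurable_rV oQ; have [/andP[e1 e12] _ h] := Ael.
have e2 : 0 <= eta2 by apply: le_trans e12; exact: ltW.
rewrite -{1}(ger0_norm e2) -sqrtr_sqr -sqrtrM ?sqr_ge0// ler_wsqrtr//.
have lA i := mxapp_L2 i oQ QO lg; have Ig := dot_integrable mQ lg lg.
rewrite -RintegralZl//; apply: le_Rintegral => //.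
- exact: dot_integrable.
- exact: (integrableZl mQ (eta2 ^+ 2) Ig).
- move=> x /QO Ox; have [_ hx] := h x (g x) Ox.
  rewrite -[leLHS]sqr_sqrtr ?dot_ge0// -[X in _ * X]sqr_sqrtr ?dot_ge0// -exprMn.
  by rewrite lerXn2r ?nnegrE ?sqrtr_ge0// mulr_ge0 ?sqrtr_ge0.
Qed.

Variable f : E -> R.
Hypothesis f_L2 : L2 Omega f.
Variables u U : E -> R.
Hypothesis u_sol : weak_solution Omega A f u.
Hypothesis U_L2 : L2 Omega U.
Hypothesis U_grad : weak_gradient Omega U (grad U).

Lemma wgrad_sub : {ae mu, forall x, Omega x ->
  wgrad Omega u x = wgrad Omega (u - U) x + grad U x}.
Proof.
have [[[lu [g wg]] _] _] := u_sol; have mO := open_measurable_rV oO.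
have wu := wgrad_weak_gradient wg.
have := wgradE oO (weak_gradientB mO lu U_L2 wu U_grad).
by apply: filterS => x h /h ->; rewrite subrK.
Qed.

Lemma wgrad_sub_L2 j : L2 Omega (fun x => wgrad Omega (u - U) x ord0 j).
Proof.
have [[[lu [g wg]] _] _] := u_sol; have mO := open_measurable_rV oO.
by have [+ _] := wgrad_weak_gradient (weak_gradientB mO lu U_L2 wg U_grad); exact.
Qed.

(** The test function confines the integrals to the element, the only set on
    which the flux is known to be continuously differentiable. *)
Lemma flux_integration_by_parts (Q : set E) (v : E -> R) (g : E -> E) : open Q ->
  test_function Q v -> (forall i, C1_on Q (fun x => g x ord0 i)) ->
  \int[mu]_(x in Q) dot (g x) (grad v x) =
    - (\int[mu]_(x in Q) ((\sum_i partial i (fun y => g y ord0 i) x) * v x)) /\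
  mu.-integrable Q (EFin \o
    (fun x => (\sum_i partial i (fun y => g y ord0 i) x) * v x)).
Proof.
move=> oQ tv cg; have mQ := open_measurable_rV oQ.
have [K Kv KQ] := test_function_C1c tv; have [cK [M KM] vK cv dv] := Kv.
have I1 i : mu.-integrable setT (EFin \o (fun x => g x ord0 i * partial i v x)).
  apply: (@integrable_cutoff _ _ Q K _ _ M) => //.
  - by move=> x; exact: C1c_partial0.
  - by have [] := dv i.
  - by move=> x /(cg i)[].
have I2 i : mu.-integrable setT (EFin \o (fun x => partial i (fun y => g y ord0 i) x * v x)).
  apply: (@integrable_cutoff _ _ Q K _ _ M) => //.
  by move=> x /(cg i)[_ /(_ i)[]].
have [J1 E1] := Rintegral_sum (index_enum _) measurableT I1.
have [J2 E2] := Rintegral_sum (index_enum _) measurableT I2.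
have F2 : (fun x => (\sum_i partial i (fun y => g y ord0 i) x) * v x) =
    (fun x => \sum_i (partial i (fun y => g y ord0 i) x * v x)).
  by apply/funext => x; rewrite mulr_suml.
split; last by rewrite F2; apply: (@integrableS _ _ _ _ setT).
rewrite F2 (Rintegral_support KQ); last first.
  move=> x nK; rewrite /dot big1// => i _; by rewrite mxE (C1c_partial0 _ Kv)// mulr0.
rewrite (Rintegral_support KQ); last first.
  by move=> x nK; rewrite big1// => i _; rewrite vK// mulr0.
transitivity (\int[mu]_x \sum_i (g x ord0 i * partial i v x)).
  by apply: eq_Rintegral => x _; apply: eq_bigr => i _; rewrite mxE.
rewrite E1 E2 -sumrN; apply: eq_bigr => i _.
apply: integration_by_parts_cutoff oQ Kv KQ _ => x /(cg i)[h1 /(_ i)[h2 h3]].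
by split.
Qed.

(** The test function [v] of the element is an admissible test function for the
    weak equation on [Omega]; the part of the energy that involves [grad U] is
    integrated by parts. *)
Lemma residual_identity (Q : set E) (v : E -> R) : open Q -> Q `<=` Omega ->
  test_function Q v ->
  (forall i, C1_on Q (fun y => mxapp (A y) (grad U y) ord0 i)) ->
  \int[mu]_(x in Q) (residual A f U x * v x) =
  \int[mu]_(x in Q) dot (mxapp (A x) (wgrad Omega (u - U) x)) (grad v x).
Proof.
move=> oQ QO tv cflux; have mO := open_measurable_rV oO; have mQ := open_measurable_rV oQ.
have [K Kv KQ] := test_function_C1c tv; have [cK [M KM] vK cv dv] := Kv.
have tvO : test_function Omega v.
  by have [t1 t2 t3] := tv; split => // x /t3/QO.
have [[[lu [g wg]] _] hu] := u_sol.
have wu := wgrad_weak_gradient wg; have [lwu _] := wu.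
have wv := test_function_weak_gradient oO tvO; have [lv _] := wv.
have [lwv _] := wgrad_weak_gradient wv.
have [lU _] := U_grad.
have v0 x : ~ K x -> grad v x = 0.
  by move=> nK; apply/rowP => j; rewrite !mxE (C1c_partial0 _ Kv).
have dot0 x (y : E) : ~ K x -> dot y (grad v x) = 0.
  by move=> /v0 ->; rewrite /dot big1// => j _; rewrite mxE mulr0.
have toQ (h : E -> E) : \int[mu]_(x in Omega) dot (h x) (grad v x) =
    \int[mu]_(x in Q) dot (h x) (grad v x).
  rewrite (Rintegral_support (subset_trans KQ QO)); last by move=> x /dot0.
  by rewrite (Rintegral_support KQ)// => x /dot0.
have lA (h : E -> E) (lh : forall j, L2 Omega (fun x => h x ord0 j)) i :=
  mxapp_L2 i oO (@subset_refl _ Omega) lh.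
have lw := wgrad_sub_L2.
have Iw := dot_integrable mO (lA _ lw) lv.
have IU := dot_integrable mO (lA _ lU) lv.
have e1 : energy Omega A u v = \int[mu]_(x in Omega)
    (dot (mxapp (A x) (wgrad Omega (u - U) x)) (grad v x) +
     dot (mxapp (A x) (grad U x)) (grad v x)).
  rewrite /energy /Rintegral (@ae_eq_integral _ _ _ mu Omega (EFin \o (fun x =>
    dot (mxapp (A x) (wgrad Omega (u - U) x)) (grad v x) +
     dot (mxapp (A x) (grad U x)) (grad v x))))//.
  - by have /integrableP[] := dot_integrable mO (lA _ lwu) lwv.
  - by have /integrableP[] := integrableD mO Iw IU.
  - have a1 := wgrad_sub; have a2 := wgradE oO wv.
    apply: filterS2 a1 a2 => x h1 h2 Ox /=; congr EFin.
    by rewrite h1// h2// mxappD dotDl.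
have := hu v (test_function_H10 oO tvO).
rewrite e1 RintegralD// !toQ.
have [-> I2] := flux_integration_by_parts oQ tv cflux.
move/eqP; rewrite subr_eq => /eqP ->.
have Ifv : mu.-integrable Q (EFin \o (fun x => f x * v x)).
  apply: L2_mul_integrable => //; first exact: L2_sub f_L2.
  by have [] := C1c_L2 mQ Kv.
have -> : \int[mu]_(x in Omega) (f x * v x) = \int[mu]_(x in Q) (f x * v x).
  have fv0 x : ~ K x -> f x * v x = 0 by move=> /vK ->; rewrite mulr0.
  by rewrite (Rintegral_support (subset_trans KQ QO))// (Rintegral_support KQ).
rewrite -RintegralD//; apply: eq_Rintegral => x _.
by rewrite /residual mulrDl.
Qed.

End local_identity.

(** * Elements in the physical domain *)

Section C1_calculus.
Context {R : realType} {d : nat}.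
Local Notation E := 'rV[R]_d.

Lemma C1_onM (D : set E) (f g : E -> R) : open D -> C1_on D f -> C1_on D g ->
  C1_on D (fun x => f x * g x).
Proof.
move=> oD cf cg.
have dM j y : D y -> is_derive y (delta_mx ord0 j : E) (f \* g)
    (f y *: partial j g y + g y *: partial j f y).
  move=> Dy; have [_ /(_ j)[df _]] := cf y Dy; have [_ /(_ j)[dg _]] := cg y Dy.
  by apply: is_deriveM; exact: derivableP.
move=> x Dx; have [cfx dfx] := cf x Dx; have [cgx dgx] := cg x Dx; split.
  exact: (@cvgM _ _ _ (nbhs_filter x)).
move=> j; have [dM1 _] := dM j x Dx; split; first exact: dM1.
apply: (@near_eq_continuous R d _ (fun y => f y * partial j g y + g y * partial j f y)).
  apply: (near_rVS _ (near_open oD Dx)) => y Dy.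
  exact: (@derive_val _ _ _ _ _ _ _ (dM j y Dy)).
have [_ cpf] := dfx j; have [_ cpg] := dgx j.
by apply: (@cvgD _ _ _ _ (nbhs_filter x)); apply: (@cvgM _ _ _ (nbhs_filter x)).
Qed.

Lemma C1_onD (D : set E) (f g : E -> R) : open D -> C1_on D f -> C1_on D g ->
  C1_on D (fun x => f x + g x).
Proof.
move=> oD cf cg.
have dM j y : D y -> is_derive y (delta_mx ord0 j : E) (f \+ g)
    (partial j f y + partial j g y).
  move=> Dy; have [_ /(_ j)[df _]] := cf y Dy; have [_ /(_ j)[dg _]] := cg y Dy.
  by apply: is_deriveD; exact: derivableP.
move=> x Dx; have [cfx dfx] := cf x Dx; have [cgx dgx] := cg x Dx; split.
  exact: (@cvgD _ _ _ _ (nbhs_filter x)).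
move=> j; have [dM1 _] := dM j x Dx; split; first exact: dM1.
apply: (@near_eq_continuous R d _ (fun y => partial j f y + partial j g y)).
  apply: (near_rVS _ (near_open oD Dx)) => y Dy.
  exact: (@derive_val _ _ _ _ _ _ _ (dM j y Dy)).
have [_ cpf] := dfx j; have [_ cpg] := dgx j.
exact: (@cvgD _ _ _ _ (nbhs_filter x)).
Qed.

Lemma C1_on_cst (D : set E) (c : R) : C1_on D (fun=> c).
Proof.
move=> x _; split; first exact: (smoothT_continuous (smooth_cst _ c)).
move=> j; split; first by apply: smoothT_derivable; exact: smooth_cst.
exact/smoothT_continuous/smoothT_partial/smooth_cst.
Qed.

Lemma C1_on_sum (D : set E) (I : Type) (s : seq I) (F : I -> E -> R) : open D ->
  (forall i, C1_on D (F i)) -> C1_on D (fun x => \sum_(i <- s) F i x).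
Proof.
move=> oD cF; apply: (big_pointwise_closed (C := C1_on D)) => //.
  exact: C1_on_cst.
by move=> f g; exact: C1_onD.
Qed.

End C1_calculus.

Section elements.
Context {R : realType} {d : nat}.
Local Notation E := 'rV[R]_d.
Local Notation mu := (lebesgue_rV R d).
Hypothesis d_gt0 : (0 < d)%N.
Variable S : spline_data R d.
Hypothesis SN : nested_splines S.
Variable H0 : hierarchy R d.
Hypothesis HH0 : domain_hierarchy S H0.
Variables (C : (E -> R) -> E) (Omega : set E) (CF cF : R).
Hypothesis Olip : bounded_lipschitz_domain Omega.
Hypothesis Fpar : parametrization S H0 C Omega CF cF.
Local Notation F := (geo_map S H0 C).
Local Notation Finv := (inv_on (dom H0 0) F).

Lemma inverse_geo_map x : dom H0 0 x -> Finv (F x) = x.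
Proof.
move=> Dx; have [_ _ [_ inj _] _ _] := Fpar.
rewrite /inv_on; case: xgetP => [z _ [Dz Fz]|/(_ x)]; last by case.
by apply: inj; rewrite ?inE.
Qed.

Lemma inverse_in_dom y : closure Omega y -> dom H0 0 (Finv y).
Proof.
move=> Cy; have [_ _ [_ _ sur] _ _] := Fpar.
by have [x Dx <-] := sur y Cy; rewrite inverse_geo_map.
Qed.

Lemma geo_map_bilipschitz : exists L0 L1 : R, [/\ 0 < L0, 0 < L1,
  forall x y, dom H0 0 x -> dom H0 0 y -> `|F x - F y| <= L0 * `|x - y|,
  forall x y, dom H0 0 x -> dom H0 0 y -> `|x - y| <= L1 * `|F x - F y| &
  forall x y, closure Omega x -> closure Omega y -> `|Finv x - Finv y| <= L1 * `|x - y|].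
Proof.
have [_ _ [img _ _] [l0 l1] _] := Fpar.
have [L0 L00 h0] := lipschitz_bound l0; have [L1 L10 h1] := lipschitz_bound l1.
exists L0, L1; split => // x y Dx Dy.
have := h1 (F x) (F y) (img x Dx) (img y Dy).
by rewrite !inverse_geo_map.
Qed.

Lemma descendant_sub (Q Q' : set E) : dyadic_descendant S Q Q' -> Q' `<=` Q.
Proof. by elim=> // l Q1 Q2 _ h _ _ h' x /h'/h. Qed.

Lemma mesh_sub_dom H (Q : set E) : domain_hierarchy S H -> mesh S H Q -> Q `<=` dom H 0.
Proof. by move=> HH [l _ [_ h _]] x /h; exact: dom_sub HH _ _ (leq0n l) x. Qed.

Lemma comb_agrees_mesh H (Q : set E) (c : (E -> R) -> R) : domain_hierarchy S H ->
  mesh S H Q -> agrees Q (fun x => \sum_(tau \in thb_basis S H) c tau * tau x).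
Proof.
move=> HH mQ; have fin := thb_basis_finite S H.
under eq_fun do rewrite (fsbig_finite _ _ fin).
under eq_fun do rewrite big_seq.
apply: agrees_sum => tau; rewrite in_fset_set; last exact: thb_basis_finite.
rewrite inE => bt; apply: agreesM; first exact: agrees_cst.
exact: thb_basis_agrees bt.
Qed.

Lemma comb_piecewise_mesh H (c : (E -> R) -> R) :
  piecewise_smooth (fun x => \sum_(tau \in thb_basis S H) c tau * tau x).
Proof.
have fin := thb_basis_finite S H; under eq_fun do rewrite (fsbig_finite _ _ fin).
under eq_fun do rewrite big_seq.
apply: piecewise_sum => tau; rewrite in_fset_set; last exact: thb_basis_finite.
rewrite inE => bt; apply: piecewiseM; first exact: piecewise_cst.
exact: thb_basis_piecewise bt.
Qed.

(** An element of a refinement is contained in an element of the initial mesh,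
    on which the basis functions that define the geometry map are polynomials. *)
Lemma geo_map_agrees H (Q : set E) : refines S H H0 -> mesh S H Q ->
  exists2 Fs : E -> E, (forall i, smooth setT (fun x => Fs x ord0 i)) &
    forall x, Q x -> F x = Fs x.
Proof.
move=> [_ /(_ Q)ref] /ref[Q0 mQ0 /descendant_sub QQ0].
have /choice[g hg] : forall i, exists g : E -> R, smooth setT g /\
    forall x, Q x -> F x ord0 i = g x.
  move=> i; have [g sg hg] := comb_agrees_mesh (fun tau => C tau ord0 i) HH0 mQ0.
  exists g; split => // x /QQ0/hg <-.
  rewrite /geo_map fsbig_finite; last exact: thb_basis_finite.
  rewrite fsbig_finite; last exact: thb_basis_finite.
  by rewrite summxE; apply: eq_bigr => tau _; rewrite mxE mulrC.
exists (fun x => \row_i g i x).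
  move=> i; have [sg _] := hg i.
  by rewrite (_ : (fun x => _) = g i)//; apply/funext => x; rewrite mxE.
by move=> x Qx; apply/rowP => i; rewrite mxE; have [_ ->] := hg i.
Qed.

(** Elements are shape regular: a cell of level [l] contains and is contained in
    cubes of size comparable to [2 ^- l], and the geometry map distorts distances
    by bounded factors. *)
Lemma element_geometry : exists2 A : R, 0 < A & forall H (Q : set E),
  domain_hierarchy S H -> refines S H H0 -> physical_mesh S H0 C H Q ->
  exists (Qhat : set E) (Fs : E -> E) (L : R) (y0 : E) (l : R),
  [/\ mesh S H Qhat, open Qhat, 0 < L & Q = Fs @` Qhat] /\
  [/\ forall i, smooth setT (fun x => Fs x ord0 i),
      forall x y, Qhat x -> Qhat y -> `|x - y| <= L * `|Fs x - Fs y| &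
      forall x, Qhat x -> Finv (Fs x) = x] /\
  [/\ open Q, Q `<=` Omega, 0 < l, ccube y0 l `<=` Q & Q `<=` cube y0 (A * l)].
Proof.
have [L0 [L1 [L00 L10 lF lG _]]] := geo_map_bilipschitz.
have [c0 [c1 [c00 c10 cs]]] := cell_size SN.
have d1 : 0 < d%:R + 1 :> R by rewrite ltr_wpDl.
(* a cube of radius c0 / 2 ^ (l + 2) fits in the cell; its image contains the ball
   of radius 2 kap / 2 ^ l given by the local surjectivity *)
pose kap := c0 / (8 * (L1 * (d%:R + 1))).
have kap0 : 0 < kap by rewrite divr_gt0// !mulr_gt0.
exists ((L0 * c1 + 1) / kap); first by rewrite divr_gt0// addr_gt0// mulr_gt0.
move=> H Q HH ref [Qh mQh QE]; have [Fs sF FE] := geo_map_agrees ref mQh.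
have [dom0 _] := ref.
have Qdom x : Qh x -> dom H0 0 x.
  by rewrite -dom0; exact: mesh_sub_dom.
have QFs : Q = Fs @` Qh.
  rewrite -QE; apply/seteqP; split => y [x Qx <-]; exists x => //; last exact: FE.
  by rewrite FE.
have [l _ [gl _ _]] := mQh.
have oQh := grid_open SN gl.
have lG' x y : Qh x -> Qh y -> `|x - y| <= L1 * `|Fs x - Fs y|.
  by move=> Qx Qy; rewrite -!FE//; apply: lG; exact: Qdom.
have oQ : open Q by rewrite QFs; exact: (@image_open _ _ Qh Fs L1).
have [a [b [ab QhE]]] := (gridP SN l Qh).1 gl.
pose t : R := (2 ^+ l)^-1; have t0 : 0 < t by rewrite invr_gt0 exprn_gt0.
have cab j : c0 * t <= b j - a j <= c1 * t by exact: cs.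
pose x0 : E := \row_j ((a j + b j) / 2).
pose rho := c0 * t / 4; have rho0 : 0 < rho by rewrite divr_gt0// mulr_gt0.
have c0t : 0 < c0 * t by rewrite mulr_gt0.
have ballQ (x : E) : `|x - x0| <= rho -> Qh x.
  move=> h; rewrite QhE => j; have /andP[h1 _] := cab j.
  have := le_trans (coord_le_norm (x - x0) j) h; rewrite !mxE ler_norml /rho.
  move: (x ord0 j) (a j) (b j) h1 => xj aj bj h1 /andP[h2 h3].
  by move: (c0 * t) c0t h1 h2 h3 => c cp h1 h2 h3; apply/andP; split; lra.
have Qx0 : Qh x0 by apply: ballQ; rewrite subrr normr0 ltW.
have y0E : rho / (L1 * (d%:R + 1)) = 2 * (kap * t).
  by rewrite /rho /kap; field; rewrite !gt_eqF.
have kt0 : 0 < kap * t by rewrite mulr_gt0.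
exists Qh, Fs, L1, (Fs x0), (kap * t); split; [by split|split].
  by split => // x Qx; rewrite -FE// inverse_geo_map//; exact: Qdom.
split => //.
- move=> y Qy; apply: (lipschitz_domain_interior Olip).
  have : nbhs y Q by exact: open_nbhs_nbhs.
  apply: (@filterS _ _ (nbhs_filter y)) => z; rewrite -QE => -[x Qx <-].
  by have [_ _ [img _ _] _ _] := Fpar; apply: img; exact: Qdom.
- move=> y cy; rewrite QFs.
  have [|x xx0 <-] := @ball_in_image _ _ Fs Qh x0 L1 rho d_gt0 oQh L10 rho0 sF lG' ballQ y.
    rewrite y0E (@le_lt_trans _ _ (kap * t))//; last first.
      by rewrite ltr_pMl// ltr1n.
    apply/rV_norm_le; first exact: ltW.
    move=> j; rewrite !mxE ler_norml lerBlDl lerBrDl.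
    by have := cy j; rewrite /ccube /= addrC.
  by exists x => //; apply: ballQ; exact: ltW.
- rewrite QFs => y [x Qx <-]; apply/cubeE.
    by rewrite mulr_gt0// divr_gt0// addr_gt0// mulr_gt0.
  rewrite mulrA divfK ?gt_eqF// -!FE//.
  apply: le_lt_trans (lF _ _ (Qdom _ Qx) (Qdom _ Qx0)) _.
  apply: (@le_lt_trans _ _ (L0 * (c1 * t))).
    rewrite ler_pM2l//; apply/rV_norm_le; first by rewrite mulr_ge0 ?ltW.
    move=> j; move: Qx Qx0; rewrite QhE => /(_ j) h1 /(_ j) h2.
    have /andP[_ h3] := cab j; rewrite !mxE ler_norml in h2 *.
    move: (x ord0 j) (a j) (b j) (c1 * t) h1 h2 h3 => xj aj bj c /andP[? ?] _ ?.
    by apply/andP; split; lra.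
  by rewrite mulrA ltr_pM2r// ltrDl.
Qed.

Lemma Omega_open : open Omega. Proof. by have [] := Olip. Qed.

Lemma Omega_finite : (mu Omega < +oo)%E.
Proof.
have [_ _ _ [M [_ hM]] _] := Olip.
have M1 : M < `|M| + 1 by rewrite (le_lt_trans (ler_norm _))// ltrDl.
have M0 : 0 < `|M| + 2 by rewrite ltr_wpDl.
apply: (@le_lt_trans _ _ (mu (cube 0 (`|M| + 2)))); last exact: lebesgue_cube_fin.
apply: le_measure; rewrite ?inE.
- exact: open_measurable_rV Omega_open.
- exact: measurable_box.
- move=> x Ox; apply/cubeE => //; rewrite subr0.
  by apply: le_lt_trans (hM _ M1 x Ox) _; rewrite ltrD2l ltr1n.
Qed.

Lemma physical_spaceE H (V : E -> R) : physical_space S H0 C H V ->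
  exists c : (E -> R) -> R, forall y,
    V y = \sum_(tau \in thb_basis S H) c tau * tau (Finv y).
Proof. by move=> [c ->]; exists c. Qed.

(** The gradient is bounded, as the values of [V] are those of finitely many
    Lipschitz functions composed with the inverse of the geometry map. *)
Lemma spline_weak_gradient H (V : E -> R) : domain_hierarchy S H ->
  physical_space S H0 C H V -> C1_on Omega V ->
  L2 Omega V /\ weak_gradient Omega V (grad V).
Proof.
move=> HH /physical_spaceE[c Vc] C1V; have oO := Omega_open.
have mO := open_measurable_rV oO.
have [L0 [L1 [L00 L10 _ _ lG]]] := geo_map_bilipschitz.
have [_ dom_patch _ _ _] := HH0.
pose M := \sum_j (`|lower S j| + `|upper S j|).
have Mj j : `|lower S j| + `|upper S j| <= M.
  by rewrite /M (bigD1 j)//= lerDl sumr_ge0// => i _; rewrite addr_ge0.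
have M0 : 0 <= M by apply: sumr_ge0 => j _; rewrite addr_ge0.
have GM y : Omega y -> `|Finv y| <= M.
  move=> /subset_closure/inverse_in_dom/dom_patch h; apply/rV_norm_le => // j.
  have hj := h j; apply: le_trans (Mj j); rewrite ler_norml.
  move: (Finv y ord0 j) (lower S j) (upper S j) hj => x a b /andP[h1 h2].
  have := ler_norm b; have := ler_norm (- a); rewrite normrN.
  have := normr_ge0 a; have := normr_ge0 b.
  by move: `|a| `|b| => a' b' *; apply/andP; split; lra.
have [B hB] := @piecewise_gradient_bound _ _ Omega Finv
  (fun x => \sum_(tau \in thb_basis S H) c tau * tau x) V M L1 oO C1V
  (comb_piecewise_mesh H c) GM
  (fun x y Ox Oy => lG x y (subset_closure Ox) (subset_closure Oy)) L10 (fun y _ => Vc y).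
have [j0] : exists j : 'I_d, True by exists (Ordinal d_gt0).
move=> _; split.
  apply: (@L2_bounded _ _ _ _ B) => //; first exact: Omega_finite.
    by apply: continuous_measurable_rV => // x /C1V[].
  by move=> x Ox; have [] := hB x j0 Ox.
apply: C1_weak_gradient => // j.
apply: (@L2_bounded _ _ _ _ B) => //; first exact: Omega_finite.
  by apply: continuous_measurable_rV => // x /C1V[_ /(_ j)[]].
by move=> x Ox; have [] := hB x j Ox.
Qed.

(** On one element, a spline is a smooth function composed with the inverse of
    the smooth geometry map, so that its flux is continuously differentiable. *)
Lemma spline_flux_C1 H (V : E -> R) (A : E -> 'M[R]_d) (Qhat : set E) (Fs : E -> E)
    (L : R) i : domain_hierarchy S H -> physical_space S H0 C H V ->
  mesh S H Qhat -> open Qhat -> 0 < L ->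
  (forall i, smooth setT (fun x => Fs x ord0 i)) ->
  (forall x y, Qhat x -> Qhat y -> `|x - y| <= L * `|Fs x - Fs y|) ->
  (forall x, Qhat x -> Finv (Fs x) = x) ->
  (forall i k, C1_on (Fs @` Qhat) (fun y => A y i k)) ->
  C1_on (Fs @` Qhat) (fun y => mxapp (A y) (grad V y) ord0 i).
Proof.
move=> HH /physical_spaceE[c Vc] mQ oQ L0 sF lF GF cA.
have oV : open (Fs @` Qhat) by exact: (@image_open _ _ Qhat Fs L).
have [Vs sVs hVs] := comb_agrees_mesh c HH mQ.
have pV : pulled Qhat Fs Finv V.
  exists Vs; first exact: (@smooth_subset _ _ _ setT).
  by move=> y [x Qx <-]; rewrite Vc GF// hVs.
have pP k : pulled Qhat Fs Finv (partial k V).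
  exact: (pulled_partial d_gt0 oQ L0 sF lF GF).
have cP k : C1_on (Fs @` Qhat) (partial k V).
  move=> y Vy; split; first exact: (pulled_continuous d_gt0 oQ L0 sF lF GF).
  move=> j; split; first exact: (pulled_derivable d_gt0 oQ L0 sF lF GF).
  apply: (pulled_continuous d_gt0 oQ L0 sF lF GF) => //.
  exact: (pulled_partial d_gt0 oQ L0 sF lF GF).
under eq_fun do rewrite mxapp_coord.
apply: C1_on_sum => // k; apply: C1_onM => //.
rewrite (_ : (fun x => grad V x ord0 k) = partial k V)//.
by apply/funext => x; rewrite mxE.
Qed.

End elements.

Section meshsize.
Context {R : realType} {d : nat}.
Local Notation E := 'rV[R]_d.

(** The d-th root of the measure of the enclosing cube. *)
Lemma meshsize_le (Q : set E) (y0 : E) (r : R) : (0 < d)%N -> measurable Q -> 0 <= r ->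
  Q `<=` cube y0 r -> meshsize Q <= 2 * r.
Proof.
move=> d0 mQ r0 Qr; have r20 : 0 <= 2 * r by rewrite mulr_ge0.
have -> : 2 * r = ((2 * r) ^+ d) `^ (d%:R^-1).
  by rewrite -powR_mulrn// -powRrM mulfV ?pnatr_eq0 -?lt0n// powRr1.
apply: ge0_ler_powR; rewrite ?nnegrE ?invr_ge0 ?exprn_ge0 ?fine_ge0//.
have h : (lebesgue_rV R d Q <= ((2 * r) ^+ d)%:E)%E.
  rewrite -(lebesgue_cube y0 r0); apply: le_measure; rewrite ?inE//.
  exact: measurable_box.
have f : lebesgue_rV R d Q \is a fin_num.
  by rewrite ge0_fin_numE// (le_lt_trans h)// ltry.
by rewrite -lee_fin fineK.
Qed.

End meshsize.

(** * The lower bound *)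

Section efficiency.
Context {R : realType} {d : nat}.
Local Notation E := 'rV[R]_d.
Local Notation mu := (lebesgue_rV R d).

Lemma meshsize_ge0 (Q : set E) : 0 <= meshsize Q.
Proof. exact: powR_ge0. Qed.

(** The real value of an infinite integral is 0. *)
Lemma L2norm_not_L2 (Q : set E) (g : E -> R) : measurable_fun Q g -> ~ L2 Q g ->
  L2norm Q g = 0.
Proof.
move=> mg ng; rewrite /L2norm /Rintegral.
have [h|] := ltP (\int[mu]_(x in Q) (g x ^+ 2)%:E)%E +oo%E; first by exfalso; apply: ng.
by rewrite leye_eq => /eqP -> /=; rewrite sqrtr0.
Qed.

Lemma residual_measurable (Omega Q : set E) (A : E -> 'M[R]_d) (f U : E -> R) :
  open Omega -> open Q -> Q `<=` Omega -> L2 Omega f ->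
  (forall i, C1_on Q (fun y => mxapp (A y) (grad U y) ord0 i)) ->
  measurable_fun Q (residual A f U).
Proof.
move=> oO oQ QO lf cflux; have mO := open_measurable_rV oO.
apply: measurable_funD.
  by apply: (measurable_funS mO QO); exact: L2_measurable.
apply: measurable_sum => i.
by apply: continuous_measurable_rV => // x /(cflux i)[_ /(_ i)[]].
Qed.

Lemma gradient_norm_bound (Q K : set E) (v : E -> R) : open Q -> C1c K v -> K `<=` Q ->
  Num.sqrt (\int[mu]_(x in Q) dot (grad v x) (grad v x)) =
  Num.sqrt (\sum_j \int[mu]_x (partial j v x ^+ 2)).
Proof.
move=> oQ Kv KQ; congr Num.sqrt; have mQ := open_measurable_rV oQ.
have [_ lv] := C1c_L2 mQ Kv.
have [_ E1] := Rintegral_sum (index_enum _) mQ (fun j => L2_sqr_integrable mQ (lv j)).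
transitivity (\int[mu]_(x in Q) \sum_j (partial j v x ^+ 2)).
  by apply: eq_Rintegral => x _; apply: eq_bigr => j _; rewrite !mxE expr2.
rewrite E1; apply: eq_bigr => j _; apply: Rintegral_support KQ _ => x nK.
by rewrite (C1c_partial0 _ Kv)// expr0n.
Qed.

Lemma gradient_le_H1norm (Omega Q : set E) (v : E -> R) :
  Num.sqrt (\int[mu]_(x in Q) dot (wgrad Omega v x) (wgrad Omega v x)) <=
  H1norm Omega Q v.
Proof. by rewrite ler_wsqrtr// lerDl Rintegral_sqr_ge0. Qed.

End efficiency.

Theorem theorem12 (R : realType) (d : nat) (d_gt0 : (0 < d)%N)
    (S : spline_data R d) (S_nested : nested_splines S)
    (H0 : hierarchy R d) (m0 : nat)
    (H0_hier : domain_hierarchy S H0) (H0_adm : strictly_admissible S H0 m0)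
    (Omega : set 'rV[R]_d) (C : ('rV[R]_d -> R) -> 'rV[R]_d) (CF cF : R)
    (Omega_lip : bounded_lipschitz_domain Omega)
    (F_param : parametrization S H0 C Omega CF cF)
    (A : 'rV[R]_d -> 'M[R]_d) (eta1 eta2 : R)
    (A_ell : elliptic Omega A eta1 eta2)
    (f : 'rV[R]_d -> R) (f_L2 : L2 Omega f)
    (n : 'I_d -> nat) (m : nat)
    (u : 'rV[R]_d -> R) (u_sol : weak_solution Omega A f u) :
  exists Clb : R, forall H : hierarchy R d,
    domain_hierarchy S H -> refines S H H0 -> admissible S H m ->
    let SD := dirichlet_space S H0 C Omega H in
    SD `<=` C1_on Omega ->
    forall U, galerkin Omega A f SD U ->
    forall Q, physical_mesh S H0 C H Q ->
      indicator A f U Q <=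
        Clb * (H1norm Omega Q (u - U) + oscillation A f n U Q).
Proof.
have oO := Omega_open Omega_lip; have mO := open_measurable_rV oO.
have [a a0 geo] := element_geometry d_gt0 S_nested H0_hier Omega_lip F_param.
have [K K0 est] := bubble_estimate n a0.
have e20 : 0 <= eta2 by have [/andP[/ltW e1 e12] _ _] := A_ell; exact: le_trans e12.
have ae : 0 <= 2 * a * eta2 by rewrite !mulr_ge0// ltW.
exists (K * (2 * a * eta2 + 1)) => H HH ref _ SD SDC U [SDU _] Q QH.
have [Qh [Fs [L [y0 [l [[mQh oQh L0 QE] [[sF lF GF] [oQ QO l0 lQ Qa]]]]]]]] := geo H Q HH ref QH.
have mQ := open_measurable_rV oQ.
have [pU _] := SDU; have C1U := SDC U SDU.
have [lU wU] := spline_weak_gradient d_gt0 H0_hier Omega_lip F_param HH pU C1U.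
have cflux i : C1_on Q (fun y => mxapp (A y) (grad U y) ord0 i).
  rewrite QE; apply: spline_flux_C1 HH pU mQh oQh L0 sF lF GF _ => // j k x Qx.
  by apply: (coefficient_C1 A_ell); apply: QO; rewrite QE.
set r := residual A f U; set p := L2proj n Q r; set h := meshsize Q.
set w := wgrad Omega (u - U).
have rhs0 : 0 <= H1norm Omega Q (u - U) + oscillation A f n U Q.
  by rewrite addr_ge0 ?sqrtr_ge0// mulr_ge0 ?meshsize_ge0 ?L2norm_ge0.
have [lr|nlr] := pselect (L2 Q r); last first.
  rewrite /indicator L2norm_not_L2// ?mulr0; last exact: residual_measurable oO oQ QO f_L2 cflux.
  by rewrite !mulr_ge0// addr_ge0.
pose v := fun y => bubble y0 l y * p y.
have tv : test_function Q v.
  apply: (@test_functionP _ _ _ _ (fun j => y0 ord0 j - l) (fun j => y0 ord0 j + l)) => //.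
    apply: smoothM; first exact: smooth_bubble.
    exact: smooth_tensor_poly (tensor_poly_L2proj n Q r).
  by move=> x nx; rewrite /v bubble_eq0 ?mul0r.
have [Kv C1v KQ] := test_function_C1c tv.
have lw j : L2 Q (fun x => w x ord0 j).
  exact: L2_sub mQ mO QO (wgrad_sub_L2 oO u_sol lU wU j).
have [_ lv] := C1c_L2 mQ C1v.
have lgv j : L2 Q (fun x => grad v x ord0 j).
  by rewrite (_ : (fun x => _) = partial j v)//; apply/funext => x; rewrite mxE.
pose W := Num.sqrt (\int[lebesgue_rV R d]_(x in Q) dot (w x) (w x)).
have W0 : 0 <= W by exact: sqrtr_ge0.
have key : l * L2norm Q r <= K * (eta2 * W + l * L2norm Q (r - p)).
  apply: (est Q y0 l r p) => //; [exact: tensor_poly_L2proj|by rewrite mulr_ge0|].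
  rewrite -/v (residual_identity oO A_ell f_L2 u_sol lU wU oQ QO tv cflux).
  rewrite -(gradient_norm_bound oQ C1v KQ).
  apply: le_trans (ler_norm _) _.
  have lAw i := mxapp_L2 A_ell i oQ QO lw.
  apply: le_trans (dot_cauchy_schwarz mQ lAw lgv) _.
  by rewrite ler_wpM2r ?sqrtr_ge0// (mxapp_norm A_ell).
(* the factor h / l turns the estimate for l into one for the mesh size *)
have hl : h <= 2 * a * l.
  by rewrite -mulrA; apply: meshsize_le Qa => //; rewrite mulr_ge0 ?ltW.
have h0 : 0 <= h by exact: meshsize_ge0.
have N0 := L2norm_ge0 Q (r - p).
have W1 : W <= H1norm Omega Q (u - U) by exact: gradient_le_H1norm.
rewrite /indicator /oscillation -/r -/p -/h.
have hl' : h / l <= 2 * a by rewrite ler_pdivrMr.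
have hl0 : 0 <= h / l by rewrite divr_ge0// ltW.
have -> : h * L2norm Q r = h / l * (l * L2norm Q r) by rewrite mulrA divfK ?gt_eqF.
apply: le_trans (ler_wpM2l hl0 key) _.
rewrite mulrCA -mulrA ler_wpM2l//.
have -> : h / l * (eta2 * W + l * L2norm Q (r - p)) =
    h / l * (eta2 * W) + h * L2norm Q (r - p) by field; rewrite gt_eqF.
have b1 : h / l * (eta2 * W) <= 2 * a * eta2 * H1norm Omega Q (u - U).
  rewrite -[leRHS]mulrA; apply: ler_pM => //; first exact: mulr_ge0.
  by rewrite ler_wpM2l.
have X0 : 0 <= H1norm Omega Q (u - U) by exact: sqrtr_ge0.
have Y0 : 0 <= h * L2norm Q (r - p) by rewrite mulr_ge0.
move: (2 * a * eta2) ae b1 => c c0 b1; rewrite mulrDl mul1r mulrDr.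
rewrite addrACA; apply: lerD; first by rewrite (le_trans b1)// lerDl.
by rewrite lerDr mulr_ge0.
Qed.
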